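(* Let $\mathfrak s$ be a symmetry jet on a manifold $M$ and suppose that the torsion of $\nabla=\nabla^{\mathfrak s}$ vanishes identically. Let $a\in\mathbb R$ with $a\neq0,\pm1$ and, for $x\in M$, let $m_a\in\mathcal B^{(1)}$ denote the homothety $T_xM\to T_xM$, $X_x\mapsto aX_x$. Then the curvature $R$ of $\nabla^{\mathfrak s}$ is given by $$R(X_x,Y_x)Z_x=\frac1{a(1-a^2)}\,\Pi\bigl(\mathbb S(m_a)\cdot\mathfrak X,\;\kappa(\mathbb S(m_a))\cdot\mathfrak X\bigr),$$ where $X,Y,Z\in\mathfrak X(M)$ and $\mathfrak X=Z_{**_{Y_x}}Y_{*_x}X_x\in T^3M$.
   Context: All objects are smooth. $\mathcal B^{(1)}$ is the Lie groupoid over $M$ of linear isomorphisms $\xi:T_xM\to T_yM$, source $\alpha(\xi)=x$, target $\beta(\xi)=y$; $-I_x=-\mathrm{id}_{T_xM}$. A local bisection of a Lie groupoid $G\rightrightarrows M$ is a section $b:U\to G$ of $\alpha$ over an open $U$ with $b^0:=\beta\circ b$ a diffeomorphism onto an open set; the $1$-jets $j^1_xb$ of local bisections of $G$ form a Lie groupoid over $M$. $\mathcal B^{(1,1)}_{nh}$ (resp. $\mathcal B^{(1,1,1)}_{nh}$) is the groupoid of $1$-jets of local bisections of $\mathcal B^{(1)}$ (resp. of $\mathcal B^{(1,1)}_{nh}$). On $\mathcal B^{(1,1)}_{nh}$: $p(j^1_xb)=b(x)$, $p_*(j^1_xb)=(b^0)_{*_x}$; $\mathcal B^{(1,1)}_{sh}=\{p=p_*\}$.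 On $\mathcal B^{(1,1,1)}_{nh}$: $p(j^1_xb)=b(x)$, $p_*(j^1_xb)=j^1_x(p\circ b)$, $p_{**}(j^1_xb)=j^1_x(p_*\circ b)$; $\mathcal B^{(1,1,1)}=\{p=p_*=p_{**}\in\mathcal B^{(1,1)}_{sh}\}$. A symmetry jet is a smooth section $\mathfrak s:M\to\mathcal B^{(1,1)}_{sh}$, $\mathfrak s(x)$ being a jet at $x$ with $p(\mathfrak s(x))=-I_x$. With $(bY)_{b^0(x')}=b(x')Y_{x'}$, $(\nabla^{\mathfrak s}_XY)_x=\frac12[X,Y+s_xY]_x$ where $\mathfrak s(x)=j^1_xs_x$. Each $\xi\in\mathcal B^{(1)}$ with $\alpha(\xi)=x$ has a unique extension $S(\xi)=j^1_xb\in\mathcal B^{(1,1)}_{sh}$ with $p(S(\xi))=\xi$ that is affine: $\xi(\nabla_{X_x}Y)=\nabla_{\xi X_x}(bY)$ for all $X_x,Y$. $\mathbb S(\xi)=j^1_x(S\circ b)\in\mathcal B^{(1,1,1)}$, for any such $b$. Iterated tangent bundles: $T^kM=T(T^{k-1}M)$; $Y_*:TM\to T^2M$ is the differential of $Y:M\to TM$, and $Z_{**}:T^2M\to T^3M$ the second differential of $Z:M\to TM$. $j^1_xb\in\mathcal B^{(1,1)}_{nh}$ acts on $T^2M$ over $x$ by $j^1_xb\cdot\frac{dX_t}{dt}|_0=\frac{d}{dt}(b(x_t)X_t)|_0$ ($X_t\in T_{x_t}M$), and $j^1_xb\in\mathcal B^{(1,1,1)}_{nh}$ acts on $T^3M$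 over $x$ by $j^1_xb\cdot\frac{d\mathcal Z_t}{dt}|_0=\frac{d}{dt}(b(x_t)\cdot\mathcal Z_t)|_0$ ($\mathcal Z_t\in T^2M$ over $x_t$). The canonical involution of $T^2N$ is $(u,Q,R,W)\mapsto(u,R,Q,W)$ in coordinates induced by a chart of $N$ (vector with components $(R,W)$ at $(u,Q)\in TN$); $\kappa:T^3M\to T^3M$ is that of $T^2N$ with $N=TM$. $\kappa(\eta)$, for $\eta\in\mathcal B^{(1,1,1)}$, is determined by $\kappa(\eta)\cdot\mathfrak X=\kappa(\eta\cdot\kappa(\mathfrak X))$. $T^3M$ has three projections to $T^2M$: $p$ (canonical), $p_*$ (differential of the canonical projection $T^2M\to TM$), $p_{**}$ (second differential of $TM\to M$). If two elements of $T^3M$ over $x$ have the same images under $p,p_*,p_{**}$, then in the coordinates induced by a chart of $M$ they differ only in the last $n=\dim M$ coordinates; $\Pi(\mathfrak X_1,\mathfrak X_2)\in T_xM$ is the (chart-independent) vector whose components are the difference (first minus second) of these. $R(X,Y)Z=\nabla_X\nabla_YZ-\nabla_Y\nabla_XZ-\nabla_{[X,Y]}Z$. *)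

(* Defs.v *)
From HB Require Import structures.
From mathcomp Require Import all_boot all_order all_algebra.
From mathcomp Require Import all_classical all_reals all_analysis.

Set Implicit Arguments.
Unset Strict Implicit.
Unset Printing Implicit Defensive.

Import Order.TTheory GRing.Theory Num.Theory.
Import numFieldNormedType.Exports.

Local Open Scope classical_set_scope.
Local Open Scope ring_scope.

(* Smooth manifolds are given by atlases.  Tangent vectors at [x] are row     *)
(* vectors: their components in a distinguished chart [chart_at x] around     *)
(* [x].  Row vectors are acted on from the right, so the matrix of a linear   *)
(* map [T_x -> T_y] is the one of ['J] (that is, [v *m 'J f u = 'd f u v]).    *)

Fixpoint Ck (R : realType) (m p k : nat) (A : set 'rV[R]_m)
    (f : 'rV[R]_m -> 'rV[R]_p) : Prop :=
  if k is k'.+1 then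
    (forall u, A u -> differentiable f u) /\
    (forall v, Ck k' A (fun u => 'D_v f u))
  else forall u, A u -> {for u, continuous f}.

Definition Cinfty (R : realType) (m p : nat) (A : set 'rV[R]_m)
  (f : 'rV[R]_m -> 'rV[R]_p) : Prop := forall k, Ck k A f.

(* The points of the space described by a [charted] structure are those of    *)
(* [points]; other elements of the carrier lie in no chart and are junk.      *)
(* The image of a chart need not be open in ['rV_m]: jet groupoids are        *)
(* described below with redundant coordinates, i.e. as submanifolds.          *)
Record charted (R : realType) (m : nat) := Charted {
  carrier :> Type;
  chart : Type;
  dom : chart -> set carrier;
  coord : chart -> carrier -> 'rV[R]_m;
  chart_at : carrier -> chart
}.
Arguments dom {R m} _ _.
Arguments coord {R m} _ _.
Arguments chart_at {R m} _ _.

Section Charted.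
Context {R : realType}.

Definition points m (M : charted R m) : set M :=
  [set x | dom M (chart_at M x) x].

(* inverse of the chart [c]; [x] is the value outside the image of [c] *)
Definition param m (M : charted R m) (x : M) (c : chart M) : 'rV[R]_m -> M :=
  'pinv_(fun=> x) (dom M c) (coord M c).

Definition open_in m (M : charted R m) (U : set M) : Prop :=
  forall c, open (coord M c @` (U `&` dom M c)).

(* The topology is the one induced by the atlas ([open_in]): it is required    *)
(* to be Hausdorff, and a countable cover by charts makes it second countable. *)
Definition is_manifold m (M : charted R m) : Prop :=
  [/\ forall x : M, points x,
      forall c, set_inj (dom M c) (coord M c),
      forall c d (W := coord M c @` (dom M c `&` dom M d)), open W /\
        forall x, Cinfty W (coord M d \o param x c),
      forall x y : M, x <> y -> exists U V : set M,
        [/\ open_in U, open_in V, U x, V y & U `&` V = set0]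
    & exists2 A : set (chart M), countable A &
        forall x, exists2 c, A c & dom M c x].

(* [M] is a manifold and [U] is open; the openness of [W] expresses that [f]   *)
(* is continuous on [U].                                                     *)
Definition smooth_on m p (M : charted R m) (N : charted R p) (U : set M)
    (f : M -> N) : Prop :=
  (forall x, U x -> points (f x)) /\
  forall c d (W := coord M c @` (U `&` dom M c `&` f @^-1` dom N d)), open W /\
    forall x, Cinfty W (coord N d \o f \o param x c).

(* the differential of [f] at [x] in the distinguished charts *)
Definition jac m p (M : charted R m) (N : charted R p) (f : M -> N) (x : M) :
    'M[R]_(m, p) :=
  'J (coord N (chart_at N (f x)) \o f \o param x (chart_at M x))
     (coord M (chart_at M x) x).

Definition tangent m (M : charted R m) : charted R (m + m) :=
  @Charted R (m + m) (M * 'rV[R]_m)%type (chart M)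
    (fun c X => dom M c X.1)
    (fun c X => row_mx (coord M c X.1)
       (X.2 *m 'J (coord M c \o param X.1 (chart_at M X.1))
                  (coord M (chart_at M X.1) X.1)))
    (fun X => chart_at M X.1).

Definition tproj m (M : charted R m) (X : tangent M) : M := X.1.

(* the differential [f_*] *)
Definition tmap m p (M : charted R m) (N : charted R p) (f : M -> N)
  (X : tangent M) : tangent N := (f X.1, X.2 *m jac f X.1).

(* [X = dg/dt|_0]; differentiability of [g] at 0 is enough *)
Definition velocity m (M : charted R m) (g : R -> M) (X : tangent M) : Prop :=
  [/\ g 0 = X.1,
      \forall t \near (0 : R), dom M (chart_at M X.1) (g t)
    & is_derive (0 : R) (1 : R) (fun t : R => coord M (chart_at M X.1) (g t))
        X.2].

(* canonical involution of [T(TN)]: [(u, Q, R, W) |-> (u, R, Q, W)] *)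
Definition cinv m (N : charted R m) (X : tangent (tangent N)) :
    tangent (tangent N) :=
  ((X.1.1, lsubmx X.2), row_mx X.1.2 (rsubmx X.2)).

End Charted.

Section VectorFields.
Context {R : realType} {n : nat} (M : charted R n).

(* [Y x] stands for a vector of [T_xM]; only values on the set where [Y] is   *)
(* required to be smooth are meaningful.                                      *)
Definition vfield := M -> 'rV[R]_n.

Definition vsec (Y : vfield) (x : M) : tangent M := (x, Y x).

Definition smooth_vfield (U : set M) (Y : vfield) : Prop :=
  smooth_on U (vsec Y).

(* components of [Y] in the chart [chart_at x], as a function of the          *)
(* coordinates in this chart                                                  *)
Definition vcomp (x : M) (Y : vfield) (u : 'rV[R]_n) : 'rV[R]_n :=
  rsubmx (coord (tangent M) (chart_at M x)
            (vsec Y (param x (chart_at M x) u))).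

Definition bracket (X Y : vfield) : vfield := fun x =>
  let u := coord M (chart_at M x) x in
  'd (vcomp x Y) u (vcomp x X u) - 'd (vcomp x X) u (vcomp x Y u).

End VectorFields.

(* The data of a groupoid over [M] that enter the notions of local bisection  *)
(* and of jet of local bisection: composition plays no role.                  *)
Record groupoid_over (R : realType) (n : nat) (M : charted R n) (m : nat) :=
  GroupoidOver {
    arrows :> charted R m;
    src : arrows -> M;
    tgt : arrows -> M
  }.
Arguments src {R n M m g} _.
Arguments tgt {R n M m g} _.

Record local_section (R : realType) (n : nat) (M : charted R n) (m : nat)
    (G : groupoid_over M m) := LocalSection {
  ldom : set M;
  lfun :> M -> G
}.
Arguments ldom {R n M m G} _.
Arguments lfun {R n M m G} _ _.

Section Jets.
Context {R : realType} {n : nat} (M : charted R n).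

Section Jet1.
Context {m : nat} (G : groupoid_over M m).

Definition base_map (b : local_section G) : M -> M := fun x => tgt (b x).

Definition local_bisection (b : local_section G) : Prop :=
  [/\ open_in (ldom b),
      smooth_on (ldom b) b,
      forall x, ldom b x -> src (b x) = x
    & [/\ smooth_on (ldom b) (base_map b),
          open_in (base_map b @` ldom b)
        & exists2 g : M -> M, smooth_on (base_map b @` ldom b) g &
            forall x, ldom b x -> g (base_map b x) = x]].

(* A 1-jet at [x] is encoded as the value at [x] together with the            *)
(* differential at [x]; the source [x] is [src] of the value.                 *)
Definition jet : Type := (G * 'M[R]_(n, m))%type.

Definition j1 (b : M -> G) (x : M) : jet := (b x, jac b x).

Definition represents (b : local_section G) (j : jet) : Prop :=
  [/\ local_bisection b, ldom b (src j.1) & j = j1 b (src j.1)].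

Definition is_jet (j : jet) : Prop := exists b, represents b j.

Definition rep (j : jet) : local_section G :=
  @xget {classic local_section G} (LocalSection set0 (fun=> j.1))
    [set b | represents b j].

(* Coordinates of a jet: those of its value, and the matrix of its            *)
(* differential in the given charts.                                          *)
Definition jet_charted : charted R (m + n * m) :=
  @Charted R (m + n * m) jet (chart M * chart G)%type
    (fun cd j => [/\ is_jet j, dom M cd.1 (src j.1) & dom G cd.2 j.1])
    (fun cd j => row_mx (coord G cd.2 j.1)
       (mxvec ('J (coord G cd.2 \o rep j \o param (src j.1) cd.1)
                  (coord M cd.1 (src j.1)))))
    (fun j => (chart_at M (src j.1), chart_at G j.1)).

Definition J1 : groupoid_over M (m + n * m) :=
  @GroupoidOver R n M (m + n * m) jet_charted
    (fun j => src j.1) (fun j => tgt j.1).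

Definition jp (j : J1) : G := j.1.

(* Action of [J1 G] on [TP] induced by an action of [G] on [P], where [P] is  *)
(* fibred over [M] by [pr]:                                                   *)
(* [j^1_x b . dZ_t/dt|_0 = d/dt (b(pr Z_t) . Z_t)|_0]                         *)
Definition jact q (P : charted R q) (pr : P -> M) (act : G -> P -> P)
    (j : J1) (Z : tangent P) : tangent P :=
  @xget {classic tangent P} Z [set W | exists b (z : R -> P),
    [/\ represents b j, velocity z Z
      & velocity (fun t => act (b (pr (z t))) (z t)) W]].

End Jet1.

Record linmap := Linmap { lsrc : M; ltgt : M; lmx : 'M[R]_n }.

Definition B1_charted : charted R (n + (n + n * n)) :=
  @Charted R (n + (n + n * n)) linmap (chart M * chart M)%type
    (fun cd xi => [/\ lmx xi \in unitmx, dom M cd.1 (lsrc xi)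
                    & dom M cd.2 (ltgt xi)])
    (fun cd xi => row_mx (coord M cd.1 (lsrc xi))
       (row_mx (coord M cd.2 (ltgt xi))
         (mxvec ('J (coord M (chart_at M (lsrc xi)) \o param (lsrc xi) cd.1)
                    (coord M cd.1 (lsrc xi))
                 *m lmx xi
                 *m 'J (coord M cd.2 \o param (ltgt xi) (chart_at M (ltgt xi)))
                       (coord M (chart_at M (ltgt xi)) (ltgt xi))))))
    (fun xi => (chart_at M (lsrc xi), chart_at M (ltgt xi))).

Definition B1 : groupoid_over M (n + (n + n * n)) :=
  @GroupoidOver R n M (n + (n + n * n)) B1_charted lsrc ltgt.

Definition homothety (a : R) (x : M) : B1 := Linmap x x a%:M.

Definition act1 (xi : B1) (X : tangent M) : tangent M :=
  (ltgt xi, X.2 *m lmx xi).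

(* [p_* : J1 G -> B1], [j^1_x b |-> (b^0)_{*x}] *)
Definition jpstar m (G : groupoid_over M m) (j : J1 G) : B1 :=
  Linmap (src j) (tgt j) (jac (base_map (rep j)) (src j)).

(* nh: nonholonomic; sh: semiholonomic *)
Definition B11nh := J1 B1.

Definition B11sh : set B11nh := [set j | is_jet j /\ jp j = jpstar j].

Definition B111nh := J1 B11nh.

Definition T2 := tangent (tangent M).
Definition T3 := tangent T2.

Definition act2 : B11nh -> T2 -> T2 := jact (@tproj R n M) act1.

Definition act3 : B111nh -> T3 -> T3 :=
  jact (fun Z : T2 => tproj (tproj Z)) act2.

Definition T3base (Z : T3) : M := tproj (tproj (tproj Z)).

Definition kappa : T3 -> T3 := @cinv R _ (tangent M).

(* [kappa(e)] is described by [kappa(e) . Z = kappa(e . kappa(Z))], [Z] over   *)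
(* the source of [e].                                                         *)
Definition kappaJ (e : B111nh) : B111nh :=
  @xget {classic B111nh} e [set k : B111nh | [/\ is_jet k, src k = src e
    & forall Z : T3, T3base Z = src e ->
        act3 k Z = kappa (act3 e (kappa Z))]].

Definition T3p (Z : T3) : T2 := tproj Z.
Definition T3pstar : T3 -> T2 := tmap (@tproj R _ (tangent M)).
Definition T3pstarstar : T3 -> T2 := tmap (tmap (@tproj R n M)).

Definition same_projections (Z1 Z2 : T3) : Prop :=
  [/\ T3p Z1 = T3p Z2, T3pstar Z1 = T3pstar Z2
    & T3pstarstar Z1 = T3pstarstar Z2].

(* last [n] of the [8 n] coordinates induced by the chart [c] of [M] *)
Definition last_coords (c : chart M) (Z : T3) : 'rV[R]_n :=
  rsubmx (rsubmx (rsubmx (coord T3 c Z))).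

Definition Pi (Z1 Z2 : T3) : 'rV[R]_n :=
  let c := chart_at M (T3base Z1) in last_coords c Z1 - last_coords c Z2.

Definition symmetry_jet (s : M -> B11nh) : Prop :=
  smooth_on setT s /\
  forall x, B11sh (s x) /\ jp (s x) = homothety (-1) x.

(* [bY] on the image of [b^0]: [(bY)_{b^0(x')} = b(x') Y_{x'}] *)
Definition pushfield (b : local_section B1) (Y : vfield M) : vfield M := fun y =>
  let x' := 'pinv_(fun=> y) (ldom b) (base_map b) y in
  (act1 (b x') (vsec Y x')).2.

Definition nabla (s : M -> B11nh) (X Y : vfield M) : vfield M := fun x =>
  2^-1 *: bracket X (fun y => Y y + pushfield (rep (s x)) Y y) x.

Definition torsion (s : M -> B11nh) (X Y : vfield M) : vfield M := fun x =>
  nabla s X Y x - nabla s Y X x - bracket X Y x.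

Definition curvature (s : M -> B11nh) (X Y Z : vfield M) : vfield M := fun x =>
  nabla s X (nabla s Y Z) x - nabla s Y (nabla s X Z) x
  - nabla s (bracket X Y) Z x.

(* [nabla] takes vector fields, so [nabla_{X_x}] and [nabla_{xi X_x}] are     *)
(* computed with arbitrary local extensions [X], [X'] of the two vectors.     *)
Definition affine_jet (s : M -> B11nh) (j : B11nh) : Prop :=
  forall b, represents b j ->
  forall (U V : set M) (X Y X' : vfield M),
    open_in U -> U (src j) -> smooth_vfield U X -> smooth_vfield U Y ->
    open_in V -> V (tgt j) -> smooth_vfield V X' ->
    vsec X' (tgt j) = act1 (jp j) (vsec X (src j)) ->
    act1 (jp j) (vsec (nabla s X Y) (src j)) =
      vsec (nabla s X' (pushfield b Y)) (tgt j).

(* the affine extension [S(xi)], by unique description *)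
Definition Sext (s : M -> B11nh) (xi : B1) : B11nh :=
  @xget {classic B11nh} (xi, 0)
    [set j | [/\ B11sh j, jp j = xi & affine_jet s j]].

(* [SS(xi) = j^1_x (S o b)], with [S(xi) = j^1_x b] *)
Definition SSext (s : M -> B11nh) (xi : B1) : B111nh :=
  j1 (fun x => Sext s (rep (Sext s xi) x)) (src xi).

End Jets.

Arguments homothety {R n M} _ _.

(* Main.v *)
(* Let G be the Christoffel symbols of the connection in a chart, so that      *)
(* nabla_X Y = DY(X) + G(X, Y).  The second order part of the affine extension *)
(* of a linear map A : T_xM -> T_yM is C(V, W) = A G_x(V, W) - G_y(AV, AW).    *)
(* Letting kappa act on a jet of [B111] exchanges the first two arguments of   *)
(* the derivative D of its second order part, so that the vector Pi of the     *)
(* statement is D(X; Y, Z) - D(Y; X, Z).  Differentiating C along the          *)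
(* prolonged bisection at A = a gives                                          *)
(*   D(X; Y, Z) = a(1 - a^2) (dG_X)(Y, Z)                                      *)
(*     + a(1 - a) (G(X, G(Y, Z)) - a G(G(X, Y), Z) - a G(Y, G(X, Z))),         *)
(* and as G(X, Y) = G(Y, X) by vanishing of the torsion, the difference is     *)
(* a(1 - a^2) times the coordinate expression of R(X, Y)Z.                     *)

From HB Require Import structures.
From mathcomp Require Import all_boot all_order all_algebra.
From mathcomp Require Import all_classical all_reals all_analysis.
From mathcomp Require Import perm ring.
Require Import Defs.

Set Implicit Arguments.
Unset Strict Implicit.
Unset Printing Implicit Defensive.

Import Order.TTheory GRing.Theory Num.Theory.
Import numFieldNormedType.Exports.

Local Open Scope classical_set_scope.
Local Open Scope ring_scope.

(** * Differentials *)

(** Homotheties detect curvature for the following reason. When the torsion vanishes, the iterated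
    affine extension of a linear map A differs from its image under [kappa] by A R(X, Y)Z - R(AX,
    AY)AZ; for A = a this is (a - a^3) R(X, Y)Z. The proof makes this explicit in the distinguished
    chart at [x], with G, C and D as in the preceding comment.

    Two expressions in G are computed and compared. On one side, [nabla_chart] identifies G with
    -1/2 times the derivative of the symmetry jet, and [curvature_christoffel] is the classical
    coordinate formula of the curvature, in which the second derivatives of Z cancel by
    [derive_comm]. On the other side, [Sext_spec] finds C, [SSext_spec] differentiates it along a
    bisection representing S(m_a), and [dext_christoffel] evaluates the resulting D. [act3E]
    describes the action of a jet on T^3M in charts; together with [kappaJ_act] it gives
    [Pi_kappaJ], which reduces [Pi] to D(X; Y, Z) - D(Y; X, Z).

    Vanishing torsion, in the form G(X, Y) = G(Y, X), enters twice: it makes the third projections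
    of the two vectors agree, so that [Pi] is meaningful, and it cancels the terms in G(G(X, Y), Z).

    The objects [Sext], [kappaJ] and the actions are picked by [xget], so each needs an existence
    proof, and a jet exists only if a smooth local bisection represents it.
    [chart_section_bisection] builds bisections from coordinate expressions; [B1_jet_exists] and
    [B11_jet_exists] deduce jets with prescribed matrices. *)

Section Differentials.
Context {R : realType}.
Implicit Types U V W : normedModType R.

(** Differentials of maps read in charts are obtained in this way: near the point the map agrees
    with an explicit formula, to which the rules below apply. *)
Lemma near_is_diff V W (f g df : V -> W) (x : V) :
  (\forall y \near x, f y = g y) -> is_diff x f df -> is_diff x g df.
Proof.
move=> fg dfx; have fgx := nbhs_singleton fg.
have fd : differentiable f x by [].
have key : g \o shift x = cst (g x) + 'd f x +o_ 0 id.
  have /diff_locally := fd.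
  move/eqaddoP => H; apply/eqaddoP => e e0.
  have fg0 : \forall y \near (0 : V), f (y + x) = g (y + x).
    by move: fg; rewrite (near_shift 0) /= subr0; apply: filterS => y /=; rewrite addrC.
  near=> y => /=.
  have h1 : f (y + x) = g (y + x) by near: y.
  have : `|((f \o shift x) - (cst (f x) + 'd f x)) y| <= e * `|id y|.
    by near: y; exact: H.
  by rewrite !fctE /= -h1 -fgx.
have dg : 'd g x = 'd f x :> (V -> W).
  by apply: diff_unique => //; exact: diff_continuous.
apply: DiffDef; last by rewrite dg diff_val.
by apply/diff_locallyP; rewrite dg; split => //; exact: diff_continuous.
Unshelve. all: by end_near. Qed.

Lemma is_diff_ext V W (f g df dg : V -> W) (x : V) :
  is_diff x f df -> f =1 g -> df =1 dg -> is_diff x g dg.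
Proof. by move=> h /funext <- /funext <-. Qed.
Arguments is_diff_ext {V W f g df dg x}.

Lemma near_differentiable V W (f g : V -> W) (x : V) :
  (\forall y \near x, f y = g y) -> differentiable f x -> differentiable g x.
Proof.
by move=> fg /differentiableP df; have [] := near_is_diff fg df.
Qed.

Lemma jacobianE m p (f : 'rV[R]_m -> 'rV[R]_p) df u v :
  is_diff u f df -> v *m 'J f u = df v.
Proof. by move=> h; rewrite /jacobian mul_rV_lin1 diff_val. Qed.

Lemma is_diff_jacobian m p (f : 'rV[R]_m -> 'rV[R]_p) u :
  differentiable f u -> is_diff u f (mulmxr ('J f u)).
Proof.
move=> df; apply: DiffDef => //; apply/funext => v.
by rewrite /= /jacobian mul_rV_lin1.
Qed.

Lemma eq_jacobian m p (f : 'rV[R]_m -> 'rV[R]_p) df u (A : 'M[R]_(m, p)) :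
  is_diff u f df -> (forall v, df v = v *m A) -> 'J f u = A.
Proof.
move=> fd H; apply/row_matrixP => i.
by rewrite !rowE (jacobianE _ fd) H.
Qed.

Lemma is_diff_scalevec V W (k dk : V -> R) (w : W) x :
  is_diff x k dk -> is_diff x (fun v => k v *: w) (fun v => dk v *: w).
Proof.
move=> dkx; have dkd : differentiable k x by [].
apply: DiffDef; first exact: differentiableZl.
by rewrite diffZl // diff_val.
Qed.

Lemma is_diff_add V W (f g df dg : V -> W) x : is_diff x f df ->
  is_diff x g dg -> is_diff x (fun v => f v + g v) (fun v => df v + dg v).
Proof. exact: is_diffD. Qed.

Lemma is_diff_sub V W (f g df dg : V -> W) x : is_diff x f df ->
  is_diff x g dg -> is_diff x (fun v => f v - g v) (fun v => df v - dg v).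
Proof. exact: is_diffB. Qed.

Lemma is_diff_scale V W (f df : V -> W) (k : R) x : is_diff x f df ->
  is_diff x (fun v => k *: f v) (fun v => k *: df v).
Proof. exact: is_diffZ. Qed.

Lemma is_diff_const V W (w : W) (x : V) :
  is_diff x (fun=> w) (fun=> 0).
Proof. by have := is_diff_cst w x. Qed.

Lemma is_diff_mul V (f g df dg : V -> R) x : is_diff x f df ->
  is_diff x g dg -> is_diff x (fun v => f v * g v)
    (fun v => df v * g x + f x * dg v).
Proof.
move=> h1 h2; apply: is_diff_eq.
by apply/funext => v /=; rewrite !fctE addrC; congr (_ + _); rewrite mulrC.
Qed.

Lemma is_diff_chain U V W (f df : U -> V) (g dg : V -> W) x :
  is_diff x f df -> is_diff (f x) g dg ->
  is_diff x (fun u => g (f u)) (fun u => dg (df u)).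
Proof. exact: is_diff_comp. Qed.

Lemma is_diff_sumvec V W (I : Type) (r : seq I) (f df : I -> V -> W) x :
  (forall i, is_diff x (f i) (df i)) ->
  is_diff x (fun v => \sum_(i <- r) f i v) (fun v => \sum_(i <- r) df i v).
Proof.
move=> H; elim: r => [|i r IH].
  by apply: is_diff_ext (is_diff_const (0 : W) x) _ _ => y; rewrite big_nil.
by apply: is_diff_ext (is_diff_add (H i) IH) _ _ => y; rewrite big_cons.
Qed.

Lemma is_diff_entry V p q (f df : V -> 'M[R]_(p, q)) x i j :
  is_diff x f df -> is_diff x (fun v => f v i j) (fun v => df v i j).
Proof.
pose c (N : 'M[R]_(p, q)) := N i j.
move=> fd; apply: (is_diff_chain (g := c) (dg := c) fd).
(* Reading off an entry is given its linear structure, so that [diff_lin] makes it its own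
   differential. *)
have @L : {linear 'M[R]_(p, q) -> R}.
  by exists (fun N : 'M[R]_(_, _) => N i j); do 2![eexists]; do ?[constructor];
     rewrite ?mxE// => ? *; rewrite ?mxE//; move=> ?; rewrite !mxE.
apply: DiffDef; first exact: differentiable_coord.
by rewrite (@diff_lin _ _ _ L) //; exact: coord_continuous.
Qed.

Lemma is_diff_mxP V p q (f df : V -> 'M[R]_(p, q)) x :
  (forall i j, is_diff x (fun v => f v i j) (fun v => df v i j)) ->
  is_diff x f df.
Proof.
move=> H.
have E (g : V -> 'M[R]_(p, q)) :
    g = fun v => \sum_i \sum_j g v i j *: delta_mx i j.
  by apply/funext => v; exact: matrix_sum_delta.
rewrite (E f) (E df); apply: is_diff_sumvec => i; apply: is_diff_sumvec => j.
exact: is_diff_scalevec.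
Qed.

(** Expanding on the matrix units [delta_mx] makes the map a finite sum of entries times fixed
    vectors; continuity comes out as a consequence. *)
Lemma is_diff_linear p q W (L : {linear 'M[R]_(p, q) -> W}) x : is_diff x L L.
Proof.
have E : L = (fun M : 'M[R]_(p, q) => \sum_i \sum_j M i j *: L (delta_mx i j)) :> (_ -> _).
  apply/funext => M; rewrite {1}[M]matrix_sum_delta linear_sum.
  apply: eq_bigr => i _; rewrite linear_sum; apply: eq_bigr => j _.
  by rewrite (linearZ_LR L).
rewrite E; apply: is_diff_sumvec => i; apply: is_diff_sumvec => j.
by apply: is_diff_scalevec; apply: is_diff_entry.
Qed.

Lemma is_diff_lin V p q W (L : {linear 'M[R]_(p, q) -> W}) (f df : V -> 'M[R]_(p, q)) x :
  is_diff x f df -> is_diff x (fun v => L (f v)) (fun v => L (df v)).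
Proof. by move=> h; apply: (is_diff_chain h); exact: is_diff_linear. Qed.

Lemma is_diff_mulmx V p q r (f df : V -> 'M[R]_(p, q)) (g dg : V -> 'M[R]_(q, r)) x :
  is_diff x f df -> is_diff x g dg ->
  is_diff x (fun v => f v *m g v) (fun v => df v *m g x + f x *m dg v).
Proof.
move=> hf hg; apply: is_diff_mxP => i j.
have K : is_diff x (fun v => \sum_k f v i k * g v k j)
   (fun v => \sum_k (df v i k * g x k j + f x i k * dg v k j)).
  by apply: is_diff_sumvec => k; apply: is_diff_mul; apply: is_diff_entry.
apply: is_diff_ext K _ _ => y; first by rewrite mxE.
by rewrite big_split /= !mxE.
Qed.

Lemma is_diff_row_mx V p q r (f df : V -> 'M[R]_(p, q)) (g dg : V -> 'M[R]_(p, r)) x :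
  is_diff x f df -> is_diff x g dg ->
  is_diff x (fun v => row_mx (f v) (g v)) (fun v => row_mx (df v) (dg v)).
Proof.
move=> hf hg; apply: is_diff_mxP => i j; case: (split_ordP j) => k ->.
  by apply: is_diff_ext (is_diff_entry i k hf) _ _ => y; rewrite row_mxEl.
by apply: is_diff_ext (is_diff_entry i k hg) _ _ => y; rewrite row_mxEr.
Qed.

Lemma is_diffE V W (f df : V -> W) x v : is_diff x f df -> 'd f x v = df v.
Proof. by move=> h; rewrite diff_val. Qed.

Lemma is_diff_uniq V W (f df df' : V -> W) x :
  is_diff x f df -> is_diff x f df' -> df = df'.
Proof. by move=> h1 h2; rewrite -(diff_val (is_diff_def := h1)) [LHS]diff_val. Qed.

End Differentials.

(** * Smooth maps *)

Section Smooth.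
Context {R : realType} {m : nat}.
Implicit Types (W : normedModType R) (A : set 'rV[R]_m).

(** The notion [Ck] for an arbitrary normed codomain: entries and Jacobians of row-valued maps are
    scalar- and matrix-valued, and smoothness proofs pass through them. *)
Fixpoint cdiff W k A (f : 'rV[R]_m -> W) : Prop :=
  if k is k'.+1 then
    (forall u, A u -> differentiable f u) /\
    (forall v, cdiff k' A (fun u => 'D_v f u))
  else forall u, A u -> {for u, continuous f}.

Definition smooth W A (f : 'rV[R]_m -> W) := forall k, cdiff k A f.

Lemma CkE p k A (f : 'rV[R]_m -> 'rV[R]_p) : Ck k A f <-> cdiff k A f.
Proof.
by elim: k f => [//|k IH] f /=; split=> -[h1 h2]; split=> // v; apply/IH.
Qed.

Lemma CinftyE p A (f : 'rV[R]_m -> 'rV[R]_p) : Cinfty A f <-> smooth A f.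
Proof. by split => h k; apply/CkE. Qed.

Lemma cdiffW W k A (f : 'rV[R]_m -> W) : cdiff k.+1 A f -> cdiff k A f.
Proof.
elim: k f => [|k IH] f /= [h1 h2]; last by split=> // v; exact/IH/h2.
by move=> u /h1; exact: differentiable_continuous.
Qed.

Lemma smooth_differentiable W A (f : 'rV[R]_m -> W) u :
  smooth A f -> A u -> differentiable f u.
Proof. by move=> /(_ 1%N)[h _]; exact: h. Qed.

Lemma smooth_is_diff W A (f : 'rV[R]_m -> W) u :
  smooth A f -> A u -> is_diff u f ('d f u).
Proof. by move=> h hu; apply/differentiableP/(smooth_differentiable h). Qed.

Lemma smooth_derive W A (f : 'rV[R]_m -> W) v :
  smooth A f -> smooth A (fun u => 'D_v f u).
Proof. by move=> h k; have [_] := h k.+1; apply. Qed.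

(** The condition constrains a globally defined [f] separately at each point of [A], so the sets [B]
    may be arbitrary sets, not just neighbourhoods. *)
Lemma cdiff_local W k A (f : 'rV[R]_m -> W) :
  (forall u, A u -> exists2 B, B u & cdiff k B f) -> cdiff k A f.
Proof.
elim: k f => [|k IH] f /= H; first by move=> u /H [B Bu] h; exact: h.
split=> [u /H [B Bu [h _]]|v]; first exact: h.
by apply: IH => u /H [B Bu [_ h]]; exists B.
Qed.

Lemma smooth_local W A (f : 'rV[R]_m -> W) :
  (forall u, A u -> exists2 B, B u & smooth B f) -> smooth A f.
Proof. by move=> H k; apply: cdiff_local => u /H [B Bu h]; exists B. Qed.

Lemma smoothS W A B (f : 'rV[R]_m -> W) : A `<=` B -> smooth B f -> smooth A f.
Proof. by move=> AB h; apply: smooth_local => u /AB; exists B. Qed.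

(** Openness turns equality on [A] into equality of germs, which derivatives respect. *)
Lemma cdiff_eq W k A (f g : 'rV[R]_m -> W) : open A ->
  (forall u, A u -> f u = g u) -> cdiff k A f -> cdiff k A g.
Proof.
move=> oA; have nA u : A u -> \forall y \near u, A y by move=> ?; exact: open_nbhs_nbhs.
have nfg (f' g' : 'rV[R]_m -> W) u : (forall u, A u -> f' u = g' u) -> A u ->
    \forall y \near u, f' y = g' y.
  by move=> h Au; near=> y; apply: h; near: y; exact: nA.
elim: k f g => [|k IH] f g fg /=.
  move=> H u Au; have := H u Au.
  rewrite /prop_for /continuous_at (fg _ Au) => h; apply: cvg_trans h.
  exact: near_eq_cvg (nfg _ _ _ fg Au).
move=> [h1 h2]; split=> [u Au|v].
  exact: near_differentiable (nfg _ _ _ fg Au) (h1 u Au).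
apply: IH (h2 v) => u Au; exact: near_eq_derive (nfg _ _ _ fg Au).
Unshelve. all: by end_near. Qed.

Lemma smooth_eq W A (f g : 'rV[R]_m -> W) : open A ->
  (forall u, A u -> f u = g u) -> smooth A f -> smooth A g.
Proof. by move=> oA fg h k; exact: cdiff_eq (h k). Qed.

Lemma cdiff_const W k A (w : W) : cdiff k A (fun=> w).
Proof.
elim: k w => [|k IH] w /=; first by move=> u _; exact: cst_continuous.
split=> [u _|v]; first exact: differentiable_cst.
have -> : (fun u : 'rV[R]_m => 'D_v (fun=> w) u) = (fun=> 0).
  by apply/funext => u; exact: derive_cst.
exact: IH.
Qed.

Lemma smooth_const W A (w : W) : smooth A (fun=> w).
Proof. by move=> k; exact: cdiff_const. Qed.

Lemma derive_is_diff W (f df : 'rV[R]_m -> W) u v :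
  is_diff u f df -> 'D_v f u = df v.
Proof. by move=> h; rewrite deriveE // diff_val. Qed.

Lemma cdiff_add W k A (f g : 'rV[R]_m -> W) : open A ->
  cdiff k A f -> cdiff k A g -> cdiff k A (fun u => f u + g u).
Proof.
move=> oA; elim: k f g => [|k IH] f g /=.
  by move=> h1 h2 u Au; apply: continuousD; [exact: h1|exact: h2].
move=> [f1 f2] [g1 g2]; split=> [u Au|v].
  by apply: differentiableD; [exact: f1|exact: g1].
apply: cdiff_eq (IH _ _ (f2 v) (g2 v)) => // u Au.
by rewrite -deriveD //; apply: diff_derivable; [exact: f1|exact: g1].
Qed.

Lemma smooth_add W A (f g : 'rV[R]_m -> W) : open A ->
  smooth A f -> smooth A g -> smooth A (fun u => f u + g u).
Proof. by move=> oA h1 h2 k; apply: cdiff_add. Qed.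

Lemma cdiff_mul k A (f g : 'rV[R]_m -> R) : open A ->
  cdiff k A f -> cdiff k A g -> cdiff k A (fun u => f u * g u).
Proof.
move=> oA; elim: k f g => [|k IH] f g.
  by move=> h1 h2 u Au; apply: continuousM; [exact: h1|exact: h2].
move=> hf hg; have := hf; have := hg; move=> [g1 g2] [f1 f2].
split=> [u Au|v]; first by apply: differentiableM; [exact: f1|exact: g1].
apply: cdiff_eq (cdiff_add oA (IH _ _ (f2 v) (cdiffW hg))
  (IH _ _ (cdiffW hf) (g2 v))) => // u Au.
rewrite (derive_is_diff _ (is_diff_mul (differentiableP (f1 u Au))
  (differentiableP (g1 u Au)))).
by rewrite (deriveE _ (f1 u Au)) (deriveE _ (g1 u Au)).
Qed.

Lemma smooth_mul A (f g : 'rV[R]_m -> R) : open A ->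
  smooth A f -> smooth A g -> smooth A (fun u => f u * g u).
Proof. by move=> oA h1 h2 k; apply: cdiff_mul. Qed.

Lemma cdiff_scalevec W k A (f : 'rV[R]_m -> R) (w : W) : open A ->
  cdiff k A f -> cdiff k A (fun u => f u *: w).
Proof.
move=> oA; elim: k f => [|k IH] f.
  by move=> h1 u Au; apply: continuousZr_tmp; exact: h1.
move=> [f1 f2]; split=> [u Au|v].
  by apply: differentiableZl; exact: f1.
apply: cdiff_eq (IH _ (f2 v)) => // u Au.
rewrite (derive_is_diff _ (is_diff_scalevec _ (differentiableP (f1 u Au)))).
by rewrite deriveE //; exact: f1.
Qed.

Lemma smooth_scalevec W A (f : 'rV[R]_m -> R) (w : W) : open A ->
  smooth A f -> smooth A (fun u => f u *: w).
Proof. by move=> oA h1 k; apply: cdiff_scalevec. Qed.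

Lemma cdiff_sum W k A (I : Type) (r : seq I) (f : I -> 'rV[R]_m -> W) : open A ->
  (forall i, cdiff k A (f i)) -> cdiff k A (fun u => \sum_(i <- r) f i u).
Proof.
move=> oA h; elim: r => [|i r IH].
  by apply: cdiff_eq (cdiff_const k A 0) => // u _; rewrite big_nil.
by apply: cdiff_eq (cdiff_add oA (h i) IH) => // u _; rewrite big_cons.
Qed.

Lemma smooth_sum W A (I : Type) (r : seq I) (f : I -> 'rV[R]_m -> W) : open A ->
  (forall i, smooth A (f i)) -> smooth A (fun u => \sum_(i <- r) f i u).
Proof. by move=> oA h1 k; apply: cdiff_sum => // i; exact: h1. Qed.

Lemma cdiff_entry k p q A (f : 'rV[R]_m -> 'M[R]_(p, q)) i j : open A ->
  cdiff k A f -> cdiff k A (fun u => f u i j).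
Proof.
move=> oA; elim: k f => [|k IH] f /=.
  move=> h u Au.
  apply: (@continuous_comp _ _ _ f (fun M : 'M[R]_(p, q) => M i j)).
    exact: h.
  exact: coord_continuous.
move=> [f1 f2]; split=> [u Au|v].
  by have [] := is_diff_entry i j (differentiableP (f1 u Au)).
apply: cdiff_eq (IH _ (f2 v)) => // u Au.
rewrite (derive_is_diff _ (is_diff_entry i j (differentiableP (f1 u Au)))).
by rewrite deriveE //; exact: f1.
Qed.

Lemma smooth_entry p q A (f : 'rV[R]_m -> 'M[R]_(p, q)) i j : open A ->
  smooth A f -> smooth A (fun u => f u i j).
Proof. by move=> oA h1 k; apply: cdiff_entry. Qed.

Lemma smooth_mxP p q A (f : 'rV[R]_m -> 'M[R]_(p, q)) : open A ->
  (forall i j, smooth A (fun u => f u i j)) -> smooth A f.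
Proof.
move=> oA h; have S : smooth A (fun u => \sum_i \sum_j f u i j *: delta_mx i j).
  apply: smooth_sum => // i; apply: smooth_sum => // j.
  exact: smooth_scalevec.
by apply: smooth_eq S => // u _; rewrite -matrix_sum_delta.
Qed.

Lemma smooth_lin p q W A (L : {linear 'M[R]_(p, q) -> W}) (f : 'rV[R]_m -> 'M[R]_(p, q)) :
  open A -> smooth A f -> smooth A (fun u => L (f u)).
Proof.
move=> oA h.
have S : smooth A (fun u => \sum_i \sum_j f u i j *: L (delta_mx i j)).
  apply: smooth_sum => // i; apply: smooth_sum => // j.
  exact/smooth_scalevec/smooth_entry.
apply: smooth_eq S => // u _; rewrite [in RHS](matrix_sum_delta (f u)) linear_sum.
apply: eq_bigr => i _; rewrite linear_sum; apply: eq_bigr => j _.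
by rewrite (linearZ_LR L).
Qed.

Lemma smooth_mulmx p q r A (f : 'rV[R]_m -> 'M[R]_(p, q)) (g : 'rV[R]_m -> 'M[R]_(q, r)) :
  open A -> smooth A f -> smooth A g -> smooth A (fun u => f u *m g u).
Proof.
move=> oA hf hg; apply: smooth_mxP => // i j.
have S : smooth A (fun u => \sum_k f u i k * g u k j).
  by apply: smooth_sum => // k; apply: smooth_mul => //; exact: smooth_entry.
by apply: smooth_eq S => // u _; rewrite mxE.
Qed.

Lemma smooth_row_mx p q r A (f : 'rV[R]_m -> 'M[R]_(p, q)) (g : 'rV[R]_m -> 'M[R]_(p, r)) :
  open A -> smooth A f -> smooth A g -> smooth A (fun u => row_mx (f u) (g u)).
Proof.
move=> oA hf hg; apply: smooth_mxP => // i j; case: (split_ordP j) => k ->.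
  by apply: smooth_eq (smooth_entry i k oA hf) => // u _; rewrite row_mxEl.
by apply: smooth_eq (smooth_entry i k oA hg) => // u _; rewrite row_mxEr.
Qed.

Lemma smooth_id A : smooth A (id : 'rV[R]_m -> 'rV[R]_m).
Proof.
move=> [|k]; first by move=> u _; exact: cvg_id.
split=> [u _|v]; first by have [] := is_diff_id u.
apply: cdiff_local => u _; exists setT => //.
by apply: (cdiff_eq openT) (cdiff_const k _ v) => w _; rewrite derive_id.
Qed.

Lemma smooth_jacobian p A (f : 'rV[R]_m -> 'rV[R]_p) : open A ->
  smooth A f -> smooth A (fun u => 'J f u).
Proof.
move=> oA h; apply: smooth_mxP => // i j.
have S := smooth_entry 0 j oA (smooth_derive (delta_mx 0 i) h).
apply: smooth_eq S => // u Au.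
rewrite (derive_is_diff _ (is_diff_jacobian (smooth_differentiable h Au))) /=.
by rewrite -rowE mxE.
Qed.

End Smooth.

Section SmoothComp.
Context {R : realType} {m p : nat}.

(** For scalar [f] the chain rule is a finite sum of products of entries of the derivative of [g]
    with partial derivatives of [f] along the basis; the induction hypothesis applies to each of
    these partial derivatives. *)
Lemma cdiff_comp_scalar k (A : set 'rV[R]_m) (B : set 'rV[R]_p)
    (g : 'rV[R]_m -> 'rV[R]_p) (f : 'rV[R]_p -> R) : open A ->
  (forall u, A u -> B (g u)) -> cdiff k A g -> cdiff k B f ->
  cdiff k A (fun u => f (g u)).
Proof.
move=> oA AB; elim: k f => [|k IH] f.
  by move=> hg hf u Au; apply: continuous_comp; [exact: hg|exact/hf/AB].
move=> hg; have := hg; move=> [g1 g2] [f1 f2]; split=> [u Au|v].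
  by apply: differentiable_comp; [exact: g1|exact/f1/AB].
have S : cdiff k A (fun u => \sum_j 'D_v g u 0 j * 'D_(delta_mx 0 j) f (g u)).
  apply: cdiff_sum => // j; apply: cdiff_mul => //.
    by apply: cdiff_entry => //; exact: g2.
  exact: (IH ('D_(delta_mx 0 j) f) (cdiffW hg) (f2 _)).
apply: cdiff_eq S => // u Au.
have dg := differentiableP (g1 u Au); have df := differentiableP (f1 _ (AB u Au)).
rewrite (derive_is_diff _ (is_diff_chain dg df)) [X in 'd f _ X](row_sum_delta).
rewrite linear_sum; apply: eq_bigr => j _.
by rewrite linearZ /= (deriveE _ (g1 u Au)) (deriveE _ (f1 _ (AB u Au))).
Qed.

Lemma smooth_comp q r (A : set 'rV[R]_m) (B : set 'rV[R]_p)
    (g : 'rV[R]_m -> 'rV[R]_p) (f : 'rV[R]_p -> 'M[R]_(q, r)) :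
  open A -> open B -> (forall u, A u -> B (g u)) ->
  smooth A g -> smooth B f -> smooth A (fun u => f (g u)).
Proof.
move=> oA oB AB hg hf; apply: smooth_mxP => // i j k.
apply: (@cdiff_comp_scalar k A B g (fun x => f x i j) oA AB (hg k)).
exact: cdiff_entry.
Qed.

End SmoothComp.

(** * Symmetry of second derivatives *)

Section Schwarz.
Context {R : realType} {m : nat}.
Implicit Types (f : 'rV[R]_m -> R) (u v w : 'rV[R]_m).

Lemma is_diff_shift (V : normedModType R) (a u : V) : is_diff u (fun y => y + a) id.
Proof.
have := is_diff_add (is_diff_id u) (is_diff_const a u).
by move/is_diff_ext; apply => // y; rewrite addr0.
Qed.

Lemma is_derive_line f u v s : differentiable f (u + s *: v) ->
  is_derive s 1 (fun t : R => f (u + t *: v)) ('D_v f (u + s *: v)).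
Proof.
move=> df; have dl : is_diff s (fun t : R => u + t *: v) (fun t : R => t *: v).
  have := is_diff_add (is_diff_const u s) (is_diff_scalevec v (is_diff_id s)).
  by move/is_diff_ext; apply => // y; rewrite add0r.
have dc := is_diff_chain dl (differentiableP df).
apply: DeriveDef; first by apply: diff_derivable.
by rewrite deriveE // diff_val scale1r deriveE.
Qed.

Lemma mean_value_line f u v (h : R) : 0 <= h ->
  (forall s : R, 0 <= s <= h -> differentiable f (u + s *: v)) ->
  exists2 s : R, 0 <= s <= h & f (u + h *: v) - f u = 'D_v f (u + s *: v) * h.
Proof.
move=> h0 df; pose F (t : R) := f (u + t *: v).
have dF s : 0 <= s <= h -> is_derive s 1 F ('D_v f (u + s *: v)).
  by move=> sh; apply: is_derive_line; exact: df.
have dF' s : s \in `]0, h[ -> is_derive s 1 F ('D_v f (u + s *: v)).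
  by rewrite in_itv /= => /andP [/ltW a /ltW b]; apply: dF; rewrite a b.
have cF : {within `[0, h], continuous F}.
  apply: derivable_within_continuous => s; rewrite in_itv /= => sh.
  by have [] := dF s sh.
have [s sh E] := MVT_segment h0 dF' cF.
exists s; first by move: sh; rewrite in_itv.
by move: E; rewrite /F scale0r addr0 subr0.
Qed.

(** Two applications of the mean value theorem: along [v] to y |-> f(y + hw) - f(y), then along [w]
    to the derivative of [f] in the direction [v]. *)
Lemma second_difference f u v w (h : R) (A : set 'rV[R]_m) : 0 <= h ->
  (forall y, A y -> differentiable f y) ->
  (forall y, A y -> differentiable ('D_v f) y) ->
  (forall s t : R, 0 <= s <= h -> 0 <= t <= h -> A (u + s *: v + t *: w)) ->
  exists s t : R, [/\ 0 <= s <= h, 0 <= t <= h &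
    f (u + h *: v + h *: w) - f (u + h *: v) - (f (u + h *: w) - f u) =
    'D_w ('D_v f) (u + s *: v + t *: w) * h * h].
Proof.
move=> h0 df dvf hA.
have hh : 0 <= h <= h by rewrite h0 lexx.
have h00 : 0 <= (0 : R) <= h by apply/andP.
have A0 s : 0 <= s <= h -> A (u + s *: v).
  by move=> hs; have := hA s 0 hs h00; rewrite scale0r addr0.
pose phi y := f (y + h *: w) - f y.
have dphi s : 0 <= s <= h -> is_diff (u + s *: v) phi
    (fun y => 'd f (u + s *: v + h *: w) y - 'd f (u + s *: v) y).
  move=> hs; apply: is_diff_sub; last exact/differentiableP/df/A0.
  apply: is_diff_chain (is_diff_shift _ _) _.
  exact/differentiableP/df/hA.
have [s hs E] := @mean_value_line phi u v h h0
  (fun s hs => let: DiffDef d _ := dphi s hs in d).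
have [t ht E'] := @mean_value_line ('D_v f) (u + s *: v) w h h0
  (fun t ht => dvf _ (hA s t hs ht)).
exists s, t; split=> //; rewrite -E' -/(phi (u + h *: v)) -/(phi u) E.
rewrite (derive_is_diff _ (dphi s hs)).
by rewrite (deriveE v (df _ (A0 s hs))) (deriveE v (df _ (hA s h hs hh))).
Qed.

Lemma second_differences_close (a b c d p q p' q' h e : R) : 0 < h ->
  a - b - (c - d) = p' * h * h -> a - c - (b - d) = q' * h * h ->
  `|p - p'| < e -> `|q - q'| < e -> `|p - q| < e + e.
Proof.
move=> h0 E E'; have -> : q' = p'.
  have hh : h * h != 0 by rewrite mulf_neq0 // gt_eqF.
  by apply: (mulIf hh); rewrite !mulrA -E -E'; ring.
move=> C1; rewrite distrC => C2; rewrite -(subrKA p').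
by apply: le_lt_trans (ler_normD _ _) _; rewrite ltrD.
Qed.

(** The second difference is symmetric in [v] and [w], and both mixed derivatives are approximated
    by it divided by h^2, at points of a small parallelogram where they are nearly constant. *)
Lemma derive_comm_scalar (A : set 'rV[R]_m) f u v w : open A -> A u -> smooth A f ->
  'D_w ('D_v f) u = 'D_v ('D_w f) u.
Proof.
move=> oA Au sf; apply/eqP; rewrite -subr_eq0; apply/negPn/negP => ne.
(* Half the supposed gap: near [u] each mixed derivative is within [e] of its value at [u], so equal
   second differences force the gap to be smaller than [e + e], which is the gap itself. *)
pose e := `|'D_w ('D_v f) u - 'D_v ('D_w f) u| / 2.
have e0 : 0 < e by rewrite divr_gt0 // normr_gt0.
have df y : A y -> differentiable f y by exact: smooth_differentiable sf.
have dd v' y : A y -> differentiable ('D_v' f) y.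
  exact/smooth_differentiable/smooth_derive.
have ct a b : {for u, continuous ('D_a ('D_b f))}.
  have := smooth_derive a (smooth_derive b sf).
  by move=> /(_ 0%N); apply.
have c1 := (cvgrPdist_lt _ _).1 (ct w v) e e0.
have c2 := (cvgrPdist_lt _ _).1 (ct v w) e e0.
have nA := filterI (filterI (open_nbhs_nbhs (conj oA Au)) (c1 _)) (c2 _).
have [d /= d0 Hd] := (nbhs_ballP _ _).1 (nA _ _ _ _).
(* With this size the parallelogram of sides [h *: v] and [h *: w] at [u] stays in the ball of
   radius [d]; the summand 1 keeps the denominator positive when both vectors are 0. *)
pose h := d / (`|v| + `|w| + 1).
have N0 : 0 < `|v| + `|w| + 1 by rewrite ltr_wpDl // addr_ge0.
have h0 : 0 < h by rewrite divr_gt0.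
have inb s t : 0 <= s <= h -> 0 <= t <= h -> ball u d (u + s *: v + t *: w).
  move=> /andP [s0 sh] /andP [t0 th].
  rewrite -ball_normE /= -addrA opprD addrA subrr sub0r normrN.
  apply: le_lt_trans (ler_normD _ _) _; rewrite !normrZ !ger0_norm //.
  have dE : d = h * (`|v| + `|w| + 1) by rewrite /h divfK // gt_eqF.
  have a1 : s * `|v| <= h * `|v| by rewrite ler_wpM2r.
  have a2 : t * `|w| <= h * `|w| by rewrite ler_wpM2r.
  by rewrite dE !mulrDr mulr1 (le_lt_trans (lerD a1 a2)) // ltrDl.
have [s [t [hs ht E]]] : exists s t : R, [/\ 0 <= s <= h, 0 <= t <= h &
    f (u + h *: v + h *: w) - f (u + h *: v) - (f (u + h *: w) - f u) =
    'D_w ('D_v f) (u + s *: v + t *: w) * h * h].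
  apply: (second_difference (A := A)) (ltW h0) df (dd v) _ => s t hs ht.
  by have [[]] := Hd _ (inb s t hs ht).
have [t' [s' [ht' hs' E']]] : exists s t : R, [/\ 0 <= s <= h, 0 <= t <= h &
    f (u + h *: w + h *: v) - f (u + h *: w) - (f (u + h *: v) - f u) =
    'D_v ('D_w f) (u + s *: w + t *: v) * h * h].
  apply: (second_difference (A := A)) (ltW h0) df (dd w) _ => a b ha hb.
  by rewrite addrAC; have [[]] := Hd _ (inb b a hb ha).
have [[_ C1] _] := Hd _ (inb s t hs ht).
have [_ C2] := Hd _ (inb s' t' hs' ht').
move: E'; rewrite [u + h *: w + _]addrAC [u + t' *: w + _]addrAC => E'.
have := second_differences_close h0 E E' C1 C2.
by rewrite /e -splitr ltxx.
Qed.

Lemma derive_comm p q (A : set 'rV[R]_m) (f : 'rV[R]_m -> 'M[R]_(p, q)) u v w :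
  open A -> A u -> smooth A f -> 'D_w ('D_v f) u = 'D_v ('D_w f) u.
Proof.
move=> oA Au sf.
have K a b i j : 'D_a ('D_b f) u i j = 'D_a ('D_b (fun y => f y i j)) u.
  have sb := smooth_derive b sf.
  rewrite deriveE; last exact: smooth_differentiable sb Au.
  rewrite -(derive_is_diff a (is_diff_entry i j (smooth_is_diff sb Au))).
  apply: near_eq_derive; near=> y.
  have Ay : A y by near: y; exact: open_nbhs_nbhs.
  rewrite [RHS](derive_is_diff b (is_diff_entry i j (smooth_is_diff sf Ay))).
  by rewrite deriveE //; exact: smooth_differentiable sf Ay.
apply/matrixP => i j; rewrite [LHS]K [RHS]K.
exact: derive_comm_scalar oA Au (smooth_entry i j oA sf).
Unshelve. all: by end_near. Qed.

End Schwarz.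

(** * Charts *)

Section Topology.
Context {R : realType}.

Lemma is_diff_chain_at (U V W : normedModType R) (f df : U -> V) (g dg : V -> W) x y :
  f x = y -> is_diff x f df -> is_diff y g dg ->
  is_diff x (fun u => g (f u)) (fun u => dg (df u)).
Proof. by move=> <-; exact: is_diff_chain. Qed.

Lemma open_preimage_continuous (T U : topologicalType) (f : T -> U) (D : set U) :
  continuous f -> open D -> open (f @^-1` D).
Proof. by move=> cf oD; apply: open_comp => // x _; exact: cf. Qed.

Lemma open_preimage_on (T U : topologicalType) (f : T -> U) (A : set T) (D : set U) :
  open A -> (forall x, A x -> {for x, continuous f}) -> open D ->
  open (A `&` f @^-1` D).
Proof.
move=> oA cf oD; rewrite openE => x [Ax Dx].
apply: filterI; first exact: open_nbhs_nbhs.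
by apply: (cf x Ax); exact: open_nbhs_nbhs.
Qed.

Lemma smooth_open_preimage m (V : normedModType R) (A : set 'rV[R]_m) (D : set V) f :
  open A -> smooth A f -> open D -> open (A `&` f @^-1` D).
Proof. by move=> oA sf; apply: open_preimage_on => // x Ax; exact: (sf 0%N). Qed.

Lemma linear_continuous p q (V : normedModType R) (L : {linear 'M[R]_(p, q) -> V}) :
  continuous L.
Proof.
move=> x; apply: differentiable_continuous.
by have [] := is_diff_linear L x.
Qed.

Lemma open_preimage_linear p q (V : normedModType R) (L : {linear 'M[R]_(p, q) -> V}) (D : set V) :
  open D -> open (L @^-1` D).
Proof. by apply: open_preimage_continuous; exact: linear_continuous. Qed.

Lemma det_continuous n : continuous (fun A : 'M[R]_n => \det A).
Proof.
rewrite /determinant.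
apply: (@continuous_big R _ +%R 0 xpredT (@add_continuous R)) => s _.
have C : continuous (fun B : 'M[R]_n => \prod_i B i (s i)).
  apply: (@continuous_big R _ *%R 1 xpredT (@mul_continuous R)) => i _ B.
  exact: coord_continuous.
move=> A; have D : {for A, continuous (fun B : 'M[R]_n => \prod_i B i (s i))}.
  exact: C.
have D2 : {for A, continuous (fun B : 'M[R]_n => (-1) ^+ s : R)}.
  by move=> ?; apply: cst_continuous.
have E := continuousM D2 D.
exact: E.
Qed.

Lemma open_unitmx n : open [set A : 'M[R]_n | A \in unitmx].
Proof.
have -> : [set A : 'M[R]_n | A \in unitmx] = (fun A => \det A) @^-1` [set x | x != 0].
  by apply/funext => A /=; rewrite unitmxE unitfE.
apply: open_preimage_continuous; first exact: det_continuous.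
exact: open_neq.
Qed.

End Topology.

Arguments smooth_open_preimage {R m V A D f} _ _ _.
Arguments open_preimage_linear {R p q V} L {D} _.

Section Charts.
Context {R : realType} {m : nat} (N : charted R m).

(** The atlas conditions of [is_manifold], isolated because they are what passes from [M] to
    [tangent M] and to [B1 M]. *)
Definition smooth_atlas : Prop :=
  (forall c, set_inj (dom N c) (coord N c)) /\
  forall c d (W := coord N c @` (dom N c `&` dom N d)), open W /\
    forall x, Cinfty W (coord N d \o param x c).

Definition overlap c d := coord N c @` (dom N c `&` dom N d).

Lemma coord_param (x : N) c u : (coord N c @` dom N c) u ->
  dom N c (param x c u) /\ coord N c (param x c u) = u.
Proof.
move=> im; split; last by apply: pinvK; rewrite inE.
have S : set_surj (dom N c) (coord N c @` dom N c) (coord N c) by move=> v.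
have h := surjpinv_image_sub (dflt := fun=> x) S.
by apply: h; exists u.
Qed.

Hypothesis aN : smooth_atlas.

Lemma coord_inj c p q : dom N c p -> dom N c q -> coord N c p = coord N c q -> p = q.
Proof. by move=> h1 h2; apply: (aN.1 c); rewrite inE. Qed.

Lemma param_coord (x : N) c p : dom N c p -> param x c (coord N c p) = p.
Proof.
move=> dp; have im : (coord N c @` dom N c) (coord N c p) by exists p.
by have [h1 h2] := coord_param x im; exact: coord_inj h2.
Qed.

Lemma open_overlap c d : open (overlap c d).
Proof. exact: (aN.2 c d).1. Qed.

Lemma open_image c : open (coord N c @` dom N c).
Proof. by have := @open_overlap c c; rewrite /overlap setIid. Qed.

Lemma overlap_coord c d p : dom N c p -> dom N d p -> overlap c d (coord N c p).
Proof. by move=> h1 h2; exists p. Qed.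

Lemma smooth_transition x c d : smooth (overlap c d) (fun u => coord N d (param x c u)).
Proof. by apply/CinftyE; exact: (aN.2 c d).2. Qed.

Lemma near_overlap c d p : dom N c p -> dom N d p ->
  \forall u \near coord N c p, overlap c d u.
Proof.
move=> h1 h2; apply: open_nbhs_nbhs; split; first exact: open_overlap.
exact: overlap_coord.
Qed.

(* Sealed, since comparing Jacobians up to conversion blows up. *)
Fact tr_def : {t : chart N -> chart N -> N -> 'M[R]_m |
  t = fun c d p => 'J (coord N d \o param p c) (coord N c p)}.
Proof. by eexists. Qed.

(* Jacobian at [p] of the transition from [c] to [d] *)
Definition tr : chart N -> chart N -> N -> 'M[R]_m := sval tr_def.

Lemma trJ c d p : tr c d p = 'J (coord N d \o param p c) (coord N c p).
Proof. by rewrite /tr (svalP tr_def). Qed.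

Lemma is_diff_transition x c d p : dom N c p -> dom N d p ->
  is_diff (coord N c p) (fun u => coord N d (param x c u)) (mulmxr (tr c d p)).
Proof.
move=> h1 h2.
have K y : differentiable (coord N d \o param y c) (coord N c p).
  exact/(smooth_differentiable (smooth_transition y c d))/overlap_coord.
rewrite trJ; apply: near_is_diff (is_diff_jacobian (K p)).
near=> u; have [v [e1 e2] <- /=] : overlap c d u by near: u; exact: near_overlap.
by rewrite !param_coord.
Unshelve. all: by end_near. Qed.

Lemma trE x c d p : dom N c p -> dom N d p ->
  tr c d p = 'J (fun u => coord N d (param x c u)) (coord N c p).
Proof.
move=> h1 h2; apply/esym/eq_jacobian; first exact: (is_diff_transition x h1 h2).
by [].
Qed.

Lemma tr_id c p : dom N c p -> tr c c p = 1%:M.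
Proof.
move=> dp; rewrite trJ; apply: (@eq_jacobian _ _ _ _ id); last by move=> v; rewrite mulmx1.
apply: near_is_diff (is_diff_id _).
near=> u; have [v [e1 _] <- /=] : overlap c c u by near: u; exact: near_overlap.
by rewrite !param_coord.
Unshelve. all: by end_near. Qed.

Lemma tr_comp c d e p : dom N c p -> dom N d p -> dom N e p ->
  tr c d p *m tr d e p = tr c e p.
Proof.
move=> h1 h2 h3; rewrite [RHS]trJ; apply/esym/(@eq_jacobian _ _ _ _ (fun v => v *m tr c d p *m tr d e p)).
  have K := is_diff_transition p h1 h2.
  have K2 := is_diff_transition p h2 h3.
  have E : coord N d (param p c (coord N c p)) = coord N d p by rewrite param_coord.
  apply: near_is_diff (is_diff_chain_at E K K2).
  near=> u; have [v [e1 e2] <- /=] : overlap c d u by near: u; exact: near_overlap.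
  by rewrite !param_coord.
by move=> v; rewrite mulmxA.
Unshelve. all: by end_near. Qed.

Lemma tr_unit c d p : dom N c p -> dom N d p -> tr c d p \in unitmx.
Proof.
move=> h1 h2; have := tr_comp h1 h2 h1; rewrite tr_id // => /mulmx1_unit [h _].
exact: h.
Qed.

Lemma near_dom x c d p : dom N c p -> dom N d p ->
  \forall u \near coord N c p, dom N d (param x c u).
Proof.
move=> h1 h2; near=> u.
have [v [e1 e2] <- /=] : overlap c d u by near: u; exact: near_overlap.
by rewrite param_coord.
Unshelve. all: by end_near. Qed.

Lemma curve_chart c d (g : R -> N) v : dom N c (g 0) -> dom N d (g 0) ->
  (\forall t \near (0 : R), dom N c (g t)) ->
  is_derive (0 : R) (1 : R) (fun t : R => coord N c (g t)) v ->
  (\forall t \near (0 : R), dom N d (g t)) /\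
  is_derive (0 : R) (1 : R) (fun t : R => coord N d (g t)) (v *m tr c d (g 0)).
Proof.
move=> h1 h2 nc dg.
have dd : differentiable (fun t : R => coord N c (g t)) 0.
  by apply/derivable1_diffP; case: dg.
have cv := differentiable_continuous dd.
(* The chart [d] is reached through coordinates: the curve is continuous at 0 in the chart [c], and
   overlaps have open images. *)
have nW : \forall t \near (0 : R), overlap c d (coord N c (g t)).
  exact: (cv _ (near_overlap h1 h2)).
have nd : \forall t \near (0 : R), dom N d (g t).
  near=> t; have [p [p1 p2] e] : overlap c d (coord N c (g t)) by near: t.
  have ct : dom N c (g t) by near: t.
  by rewrite -(coord_inj p1 ct e).
split=> //.
have K := is_diff_chain (differentiableP dd) (is_diff_transition (g 0) h1 h2).
have K' : is_diff (0 : R) (fun t => coord N d (g t))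
    (fun t => 'd (fun t : R => coord N c (g t)) 0 t *m tr c d (g 0)).
  apply: near_is_diff K; near=> t; rewrite param_coord //.
  by near: t.
have dK' : differentiable (fun t => coord N d (g t)) 0 by [].
apply: DeriveDef; first exact: diff_derivable.
rewrite deriveE // (is_diffE _ K') -deriveE //.
by case: dg => _ ->.
Unshelve. all: by end_near. Qed.

End Charts.

Arguments open_overlap {R m N} aN c d.
Arguments smooth_transition {R m N} aN x c d.
Arguments tr {R m N} _ _ _.
Arguments overlap {R m N} _ _.

(** * Smooth maps between charted spaces, tested in suitable charts *)

Section Maps.
Context {R : realType} {m p : nat} (M : charted R m) (N : charted R p).

(** A substitute for [smooth_atlas] suited to [B11nh M], whose charts have redundant coordinates:
    transition maps are asked to extend smoothly to open sets of the coordinate space. *)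
Definition extendable_atlas q (P : charted R q) : Prop :=
  forall c d x, dom P c x -> dom P d x -> exists E (t : 'rV[R]_q -> 'rV[R]_q),
    [/\ open E, E (coord P c x), smooth E t &
      forall y, dom P c y -> E (coord P c y) ->
        dom P d y /\ coord P d y = t (coord P c y)].

Lemma smooth_atlas_extendable q (P : charted R q) :
  smooth_atlas P -> extendable_atlas P.
Proof.
move=> aP c d x cx dx; exists (overlap c d), (fun u => coord P d (param x c u)).
split; [exact: open_overlap|exact: overlap_coord|exact: smooth_transition|].
move=> y cy [z [cz dz] /(coord_inj aP cz cy) <-].
by rewrite param_coord.
Qed.

Definition chart_diff c d (f : M -> N) x : Prop :=
  [/\ dom M c x, dom N d (f x),
      \forall u \near coord M c x, dom N d (f (param x c u)) &
      differentiable (fun u => coord N d (f (param x c u))) (coord M c x)].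

Fact jacin_def : {j : chart M -> chart N -> (M -> N) -> M -> 'M[R]_(m, p) |
  j = fun c d f x => 'J (fun u => coord N d (f (param x c u))) (coord M c x)}.
Proof. by eexists. Qed.

Definition jacin : chart M -> chart N -> (M -> N) -> M -> 'M[R]_(m, p) :=
  sval jacin_def.

Lemma jacinJ c d f x :
  jacin c d f x = 'J (fun u => coord N d (f (param x c u))) (coord M c x).
Proof. by rewrite /jacin (svalP jacin_def). Qed.

Lemma jac_jacin f x : jac f x = jacin (chart_at M x) (chart_at N (f x)) f x.
Proof. by rewrite jacinJ. Qed.

Lemma is_diff_jacin c d f x : chart_diff c d f x ->
  is_diff (coord M c x) (fun u => coord N d (f (param x c u)))
    (mulmxr (jacin c d f x)).
Proof. by case=> _ _ _ h; rewrite jacinJ; exact: is_diff_jacobian. Qed.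

Hypothesis aM : smooth_atlas M.

Lemma chart_diff_change (aN : smooth_atlas N) c d c' d' f x :
  chart_diff c d f x -> dom M c' x -> dom N d' (f x) ->
  chart_diff c' d' f x /\
  jacin c' d' f x = tr c' c x *m jacin c d f x *m tr d d' (f x).
Proof.
move=> fcd; have [cx dx nd df] := fcd => cx' dx'.
pose T u := coord M c (param x c' u).
have Tx : T (coord M c' x) = coord M c x by rewrite /T param_coord.
have dT : is_diff (coord M c' x) T (mulmxr (tr c' c x)).
  exact: is_diff_transition.
pose F u := coord N d (f (param x c u)).
have dF := is_diff_jacin fcd.
have Fx : F (T (coord M c' x)) = coord N d (f x) by rewrite /F Tx param_coord.
have dG : is_diff (coord N d (f x)) (fun v => coord N d' (param (f x) d v))
    (mulmxr (tr d d' (f x))) by exact: is_diff_transition.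
have dFT := is_diff_chain_at Tx dT dF.
have K := is_diff_chain_at (f := fun u => F (T u)) Fx dFT dG.
have cFT : {for (coord M c' x), continuous (fun u => F (T u))}.
  by apply: differentiable_continuous; case: dFT.
have nW : \forall u \near coord M c' x, overlap d d' (F (T u)).
  by apply: cFT; rewrite /= Fx; exact: near_overlap.
have nT : \forall u \near coord M c' x, dom N d (f (param x c (T u))).
  have cT : {for (coord M c' x), continuous T}.
    by apply: differentiable_continuous; case: dT.
  by have := cT (fun v => dom N d (f (param x c v))); apply; rewrite Tx.
have nE : \forall u \near coord M c' x, param x c (T u) = param x c' u.
  near=> u; have [v [e1 e2] <-] : overlap c' c u by near: u; exact: near_overlap.
  by rewrite /T !param_coord.
have nd' : \forall u \near coord M c' x, dom N d' (f (param x c' u)).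
  near=> u; have [q [q1 q2] e] : overlap d d' (F (T u)) by near: u.
  have h1 : dom N d (f (param x c (T u))) by near: u.
  have h2 : param x c (T u) = param x c' u by near: u.
  by rewrite -h2 -(coord_inj aN q1 h1 e).
have L : is_diff (coord M c' x) (fun u => coord N d' (f (param x c' u)))
   (fun v => v *m tr c' c x *m jacin c d f x *m tr d d' (f x)).
  apply: near_is_diff K; near=> u.
  have h1 : dom N d (f (param x c (T u))) by near: u.
  have h2 : param x c (T u) = param x c' u by near: u.
  by rewrite /F param_coord // h2.
split; first by split=> //; case: L.
by rewrite [LHS]jacinJ; apply: (eq_jacobian L) => v; rewrite !mulmxA.
Unshelve. all: by end_near. Qed.

Lemma smooth_on_chart_diff U (f : M -> N) x c d : smooth_on U f -> U x ->
  dom M c x -> dom N d (f x) -> chart_diff c d f x.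
Proof.
move=> [_ sf] Ux cx dx; have [oW sW] := sf c d.
set W := _ @` _ in oW sW.
have Wx : W (coord M c x) by exists x.
split=> //.
  near=> u; have [y [[Uy cy] dy] <-] : W u by near: u; exact: open_nbhs_nbhs.
  by rewrite param_coord.
exact: (smooth_differentiable (proj1 (CinftyE _ _) (sW x)) Wx).
Unshelve. all: by end_near. Qed.

(** [smooth_on] quantifies over all pairs of charts; around each point one convenient pair is
    enough, the others being reached by transition maps. *)
Lemma smooth_on_local (eN : extendable_atlas N) (U : set M) (f : M -> N) :
  (forall x, U x -> points (f x)) ->
  (forall x, U x -> exists c d E (g : 'rV[R]_m -> 'rV[R]_p),
    [/\ dom M c x, open E, E (coord M c x), smooth E g &
      forall y, dom M c y -> E (coord M c y) ->
        [/\ U y, dom N d (f y) & coord N d (f y) = g (coord M c y)]]) ->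
  smooth_on U f.
Proof.
move=> Pf H; split=> // c d; set W := _ @` _.
have key x : W (coord M c x) -> dom M c x -> exists B, exists2 g,
    [/\ open B, B (coord M c x), B `<=` W & smooth B g] &
    forall u z, B u -> coord N d (f (param z c u)) = g u.
  move=> [x' [[Ux cx'] dx] exx cx].
  have e := coord_inj aM cx' cx exx; subst x'.
  have [c0 [d0 [E [g [c0x oO Ox sg fg]]]]] := H x Ux.
  have [_ d0x fx] := fg x c0x Ox.
  (* The extended transition [t] leads from the convenient chart [d0] to the arbitrary chart [d]. *)
  have [E' [t [oO' E'x st ft]]] := eN d0 d (f x) d0x dx.
  pose T u := coord M c0 (param x c u).
  have sT : smooth (overlap c c0) T by exact: smooth_transition.
  pose B1 := overlap c c0 `&` T @^-1` E.
  have oB1 : open B1 by exact: smooth_open_preimage (open_overlap aM c c0) sT oO.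
  have sgT : smooth B1 (fun u => g (T u)).
    apply: smooth_comp oB1 oO _ _ sg; first by move=> u [].
    by apply: smoothS sT => u [].
  pose B := B1 `&` (fun u => g (T u)) @^-1` E'.
  have oB : open B by exact: smooth_open_preimage oB1 sgT oO'.
  have Bu u : B u -> exists y, [/\ dom M c y, coord M c y = u, U y, dom N d (f y) &
     coord N d (f y) = t (g (T u))].
    move=> [[[y [cy c0y] <-]]]; rewrite /T /= param_coord // => Oy E'y.
    have [Uy d0y fy] := fg y c0y Oy; rewrite -fy in E'y *.
    by have [dy ty] := ft _ d0y E'y; exists y.
  exists B; exists (fun u => t (g (T u))); last first.
    move=> u z /Bu [y [cy yu Uy dy fy]].
    by rewrite -fy -yu param_coord.
  split=> //.
  - split; last by rewrite /= /T param_coord // -fx.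
    by split; [exact: overlap_coord|rewrite /= /T param_coord].
  - by move=> u /Bu [y [cy <- Uy dy _]]; exists y.
  - apply: (smooth_comp oB oO' _ _ st); first by move=> u [].
    by apply: smoothS sgT => u [].
split.
  rewrite openE => u Wu; have [x [[Ux cx] dx] e] := Wu.
  have [B [g [oB Bx BW _] _]] := key x (ltac:(by rewrite e)) cx.
  by rewrite /interior -e; apply: filterS BW _; exact: open_nbhs_nbhs.
move=> z; apply/CinftyE; apply: smooth_local => u Wu.
have [x [[Ux cx] dx] e] := Wu.
have [B [g [oB Bx BW sg] fg]] := key x (ltac:(by rewrite e)) cx.
exists B; first by rewrite -e.
by apply: smooth_eq oB _ sg => v Bv /=; rewrite fg.
Qed.

Lemma open_in_local (U : set M) :
  (forall x, U x -> exists c E, [/\ dom M c x, open E, E (coord M c x) &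
      forall y, dom M c y -> E (coord M c y) -> U y]) ->
  open_in U.
Proof.
move=> H c; rewrite openE => _ [x [Ux cx] <-].
have [c0 [E [c0x oO Ox OU]]] := H x Ux.
pose T u := coord M c0 (param x c u).
have sT : smooth (overlap c c0) T by exact: smooth_transition.
have oB := smooth_open_preimage (open_overlap aM c c0) sT oO.
apply: (@filterS _ _ _ (overlap c c0 `&` T @^-1` E)).
  move=> u [[y [cy c0y] <-]]; rewrite /T /= param_coord // => Oy.
  by exists y => //; split=> //; exact: OU Oy.
apply: open_nbhs_nbhs; split=> //.
by split; [exact: overlap_coord|rewrite /= /T param_coord].
Qed.

Lemma open_in_near (U : set M) c x : open_in U -> U x -> dom M c x ->
  \forall u \near coord M c x, U (param x c u).
Proof.
move=> oU Ux cx; near=> u.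
have [y [Uy cy] <-] : (coord M c @` (U `&` dom M c)) u.
  by near: u; apply: open_nbhs_nbhs; split; [exact: oU|exists x].
by rewrite param_coord.
Unshelve. all: by end_near. Qed.

End Maps.

(** * Tangent bundles *)

Section Tangent.
Context {R : realType} {m : nat} (N : charted R m).
Hypothesis aN : smooth_atlas N.
Hypothesis pN : forall x : N, points x.

Definition tcoord d (X : tangent N) : 'rV[R]_m := X.2 *m tr (chart_at N X.1) d X.1.

Lemma coord_tangent d X : coord (tangent N) d X = row_mx (coord N d X.1) (tcoord d X).
Proof. by rewrite /tcoord trJ. Qed.

Lemma tcoord_tr c d X : dom N c X.1 -> dom N d X.1 ->
  tcoord d X = tcoord c X *m tr c d X.1.
Proof. by move=> h1 h2; rewrite /tcoord -mulmxA tr_comp //; exact: pN. Qed.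

Lemma tcoord_at X : tcoord (chart_at N X.1) X = X.2.
Proof. by rewrite /tcoord tr_id ?mulmx1 //; exact: pN. Qed.

Lemma tcoord_inj c X Y : dom N c X.1 -> X.1 = Y.1 -> tcoord c X = tcoord c Y -> X = Y.
Proof.
case: X Y => [p v] [q w] /= cp pq; rewrite -{}pq => E.
have h u : tcoord c (p, u) *m tr c (chart_at N p) p = u.
  by rewrite -(@tcoord_tr c (chart_at N p) (p, u)) ?(tcoord_at (p, u)) //; exact: pN.
by rewrite -(h v) E h.
Qed.

Lemma overlap_tangent (c d : chart N) (w : 'rV[R]_(m + m)) :
  @overlap _ _ (tangent N) c d w <-> overlap c d (lsubmx w).
Proof.
split; first by move=> [X [h1 h2] <-]; rewrite coord_tangent row_mxKl; exists X.1.
move=> [p [h1 h2] e].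
exists (p, rsubmx w *m tr c (chart_at N p) p) => //.
rewrite coord_tangent /tcoord /= -mulmxA tr_comp ?tr_id ?mulmx1 //; last exact: pN.
by rewrite e hsubmxK.
Qed.

Lemma tangent_transition (X0 : tangent N) (c d : chart N) (w : 'rV[R]_(m + m)) : overlap c d (lsubmx w) ->
  coord (tangent N) d (param X0 c w) =
  row_mx (coord N d (param X0.1 c (lsubmx w)))
         (rsubmx w *m 'J (fun u => coord N d (param X0.1 c u)) (lsubmx w)).
Proof.
move=> /overlap_tangent [X [h1 h2] <-].
have iT : set_inj (dom (tangent N) c) (coord (tangent N) c).
  move=> Y Z; rewrite !inE => Yc Zc; rewrite !coord_tangent => /eq_row_mx [e1 e2].
  by apply: (tcoord_inj Yc) e2; exact: (coord_inj aN Yc Zc e1).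
rewrite (_ : param X0 c _ = X); last by apply: pinvKV => //; rewrite inE.
rewrite !coord_tangent row_mxKl row_mxKr (param_coord aN X0.1 h1).
by rewrite -(trE aN X0.1 h1 h2) -(tcoord_tr h1 h2).
Qed.

Lemma tangent_atlas : smooth_atlas (tangent N).
Proof.
split.
  move=> c Y Z; rewrite !inE => Yc Zc; rewrite !coord_tangent => /eq_row_mx [e1 e2].
  by apply: (tcoord_inj Yc) e2; exact: (coord_inj aN Yc Zc e1).
move=> c d W; have EW : W = (lsubmx : 'rV[R]_(m + m) -> 'rV[R]_m) @^-1` @overlap _ _ N c d.
  by apply/seteqP; split=> w /overlap_tangent.
have oW : open W.
  by rewrite EW; apply: open_preimage_linear; exact: open_overlap.
split=> // X0; apply/CinftyE.
have ls : smooth W (fun w : 'rV[R]_(m + m) => lsubmx w : 'rV[R]_m).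
  by apply: (smooth_lin lsubmx oW); exact: smooth_id.
have rs : smooth W (fun w : 'rV[R]_(m + m) => rsubmx w : 'rV[R]_m).
  by apply: (smooth_lin rsubmx oW); exact: smooth_id.
have oO := open_overlap aN c d.
have sT := smooth_transition aN X0.1 (c : chart N) d.
have WO w : W w -> @overlap _ _ N c d (lsubmx w) by rewrite EW.
have S : smooth W (fun w : 'rV[R]_(m + m) =>
    row_mx (coord N d (param X0.1 c (lsubmx w)))
         (rsubmx w *m 'J (fun u => coord N d (param X0.1 c u)) (lsubmx w))).
  apply: smooth_row_mx => //; first exact: (smooth_comp oW oO WO ls sT).
  apply: smooth_mulmx => //.
  exact: (smooth_comp oW oO WO ls (smooth_jacobian oO sT)).
by apply: smooth_eq oW _ S => w /WO h; rewrite -tangent_transition.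
Qed.

Lemma velocity_chart d (X : tangent N) g : dom N d X.1 ->
  velocity g X <-> [/\ g 0 = X.1, \forall t \near (0 : R), dom N d (g t) &
    is_derive (0 : R) (1 : R) (fun t : R => coord N d (g t)) (tcoord d X)].
Proof.
move=> dX; split=> -[g0 n1 d1].
  have dg0 : dom N d (g 0) by rewrite g0.
  have ag0 : dom N (chart_at N X.1) (g 0) by rewrite g0; exact: pN.
  have [h1 h2] := curve_chart aN ag0 dg0 n1 d1.
  by rewrite g0 in h2; split; [exact: g0|exact: h1|exact: h2].
have dg0 : dom N d (g 0) by rewrite g0.
have ag0 : dom N (chart_at N X.1) (g 0) by rewrite g0; exact: pN.
have [h1 h2] := curve_chart aN dg0 ag0 n1 d1.
rewrite g0 in h2; split; [exact: g0|exact: h1|].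
by rewrite -(tcoord_at X) (tcoord_tr dX (pN _)).
Qed.

End Tangent.

Arguments tcoord {R m N} _ _.

Section TangentMap.
Context {R : realType} {m p : nat} (M : charted R m) (N : charted R p).
Hypotheses (aM : smooth_atlas M) (aN : smooth_atlas N).
Hypotheses (pM : forall x : M, points x) (pN : forall x : N, points x).

Lemma tcoord_tmap c d (f : M -> N) (X : tangent M) : chart_diff c d f X.1 ->
  tcoord d (tmap f X) = tcoord c X *m jacin c d f X.1.
Proof.
move=> fX; have [cX dX _ _] := fX.
have [_ E] := chart_diff_change aM aN fX (pM X.1) (pN (f X.1)).
rewrite /tcoord /= jac_jacin E.
have h1 := pN (f X.1); have h2 := pM X.1.
by rewrite -!mulmxA (tr_comp aN dX h1 dX) (tr_id aN dX) mulmx1.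
Qed.

End TangentMap.

(** * Jets of bisections *)

Section LinearMaps.
Context {R : realType} {n : nat} (M : charted R n).
Hypothesis aM : smooth_atlas M.
Hypothesis pM : forall x : M, points x.
Let cM (x : M) : dom M (chart_at M x) x := pM x.

Implicit Types xi : B1 M.

(* matrix of [xi] in the charts [c] and [d] *)
Definition loc (c d : chart M) (xi : B1 M) : 'M[R]_n :=
  tr c (chart_at M (lsrc xi)) (lsrc xi) *m lmx xi
    *m tr (chart_at M (ltgt xi)) d (ltgt xi).

Definition of_loc (c d : chart M) (p q : M) (A : 'M[R]_n) : B1 M :=
  Linmap p q (tr (chart_at M p) c p *m A *m tr d (chart_at M q) q).

Lemma coord_B1 (cd : chart (B1 M)) xi : coord (B1 M) cd xi =
  row_mx (coord M cd.1 (lsrc xi)) (row_mx (coord M cd.2 (ltgt xi)) (mxvec (loc cd.1 cd.2 xi))).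
Proof. by rewrite /loc !trJ. Qed.

Lemma points_B1 (xi : B1 M) : points xi <-> lmx xi \in unitmx.
Proof. by split=> [[]|h] //; split=> //; exact: pM. Qed.

Lemma loc_tr c d c' d' xi : dom M c (lsrc xi) -> dom M c' (lsrc xi) ->
  dom M d (ltgt xi) -> dom M d' (ltgt xi) ->
  loc c' d' xi = tr c' c (lsrc xi) *m loc c d xi *m tr d d' (ltgt xi).
Proof.
move=> h1 h2 h3 h4; rewrite /loc -!mulmxA (tr_comp aM (cM _) h3 h4) !mulmxA.
by rewrite (tr_comp aM h2 h1 (cM _)).
Qed.

Lemma of_locK c d p q A : dom M c p -> dom M d q -> loc c d (of_loc c d p q A) = A.
Proof.
move=> h1 h2; rewrite /loc /= !mulmxA (tr_comp aM h1 (cM _) h1) -!mulmxA.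
by rewrite (tr_comp aM h2 (cM _) h2) !(tr_id aM) // mulmx1 mul1mx.
Qed.

Lemma locK c d xi : dom M c (lsrc xi) -> dom M d (ltgt xi) ->
  of_loc c d (lsrc xi) (ltgt xi) (loc c d xi) = xi.
Proof.
case: xi => p q A /= h1 h2; rewrite /of_loc /loc /=; congr Linmap.
rewrite !mulmxA (tr_comp aM (cM _) h1 (cM _)) -!mulmxA.
by rewrite (tr_comp aM (cM _) h2 (cM _)) (tr_id aM (cM _)) (tr_id aM (cM _)) mulmx1 mul1mx.
Qed.

Lemma loc_unit c d xi : dom M c (lsrc xi) -> dom M d (ltgt xi) ->
  (loc c d xi \in unitmx) = (lmx xi \in unitmx).
Proof.
by move=> h1 h2; rewrite /loc !unitmx_mul !(tr_unit aM) ?andbT.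
Qed.

Lemma of_loc_unit c d p q A : dom M c p -> dom M d q ->
  (lmx (of_loc c d p q A) \in unitmx) = (A \in unitmx).
Proof. by move=> h1 h2; rewrite -(@loc_unit c d) ?of_locK. Qed.

Lemma coord_of_loc (c d : chart M) p q A : dom M c p -> dom M d q ->
  coord (B1 M) (c, d) (of_loc c d p q A) =
  row_mx (coord M c p) (row_mx (coord M d q) (mxvec A)).
Proof. by move=> h1 h2; rewrite coord_B1 /= of_locK. Qed.

Lemma B1_inj (cd : chart (B1 M)) : set_inj (dom (B1 M) cd) (coord (B1 M) cd).
Proof.
move=> x y; rewrite !inE => -[_ h1 h2] [_ h3 h4]; rewrite !coord_B1.
move=> /eq_row_mx [e1 /eq_row_mx [e2 /(can_inj mxvecK) e3]].
rewrite -(locK h1 h2) -(locK h3 h4) e3.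
by rewrite (coord_inj aM h1 h3 e1) (coord_inj aM h2 h4 e2).
Qed.

Lemma overlap_B1 (cd cd' : chart (B1 M)) (w : 'rV[R]_(n + (n + n * n))) :
  @overlap _ _ (B1 M) cd cd' w <->
  [/\ @overlap _ _ M cd.1 cd'.1 (lsubmx w), @overlap _ _ M cd.2 cd'.2 (lsubmx (rsubmx w))
    & vec_mx (rsubmx (rsubmx w)) \in unitmx].
Proof.
case: cd cd' => [c d] [c' d'] /=; split.
  move=> [xi [[h0 h1 h2] [_ h3 h4]] <-]; rewrite coord_B1 row_mxKl row_mxKr row_mxKl row_mxKr mxvecK.
  by split; [exists (lsrc xi)|exists (ltgt xi)|rewrite loc_unit].
move=> [[p [h1 h2] e1] [q [h3 h4] e2] u].
exists (of_loc c d p q (vec_mx (rsubmx (rsubmx w)))).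
  by split; split=> //=; rewrite -(@of_loc_unit c d p q _ h1 h3) in u.
by rewrite coord_of_loc // e1 e2 vec_mxK !hsubmxK.
Qed.

(** The rule (p, q, A) |-> (p', q', J A J'). As matrices act from the right, J belongs to the
    transition from the new source chart back to the old one, hence is taken at the new coordinate
    [u]. *)
Definition B1_trans (x0 y0 : M) (cd cd' : chart (B1 M)) (w : 'rV[R]_(n + (n + n * n))) :
    'rV[R]_(n + (n + n * n)) :=
  let u := coord M cd'.1 (param x0 cd.1 (lsubmx w)) in
  let v := coord M cd'.2 (param y0 cd.2 (lsubmx (rsubmx w))) in
  row_mx u (row_mx v (mxvec ('J (fun u => coord M cd.1 (param x0 cd'.1 u)) u
     *m vec_mx (rsubmx (rsubmx w))
     *m 'J (fun v => coord M cd'.2 (param y0 cd.2 v)) (lsubmx (rsubmx w))))).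

Lemma B1_transition (xi0 : B1 M) (cd cd' : chart (B1 M)) w : @overlap _ _ (B1 M) cd cd' w ->
  coord (B1 M) cd' (param xi0 cd w) = B1_trans (lsrc xi0) (ltgt xi0) cd cd' w.
Proof.
move=> [xi [[h0 h1 h2] [_ h3 h4]] <-].
rewrite (_ : param xi0 cd _ = xi); last first.
  by apply: pinvKV; [exact: B1_inj|rewrite inE; split].
rewrite /B1_trans !coord_B1 !(row_mxKl, row_mxKr) mxvecK.
rewrite (param_coord aM _ h1) (param_coord aM _ h2).
by rewrite -(trE aM _ h3 h1) -(trE aM _ h2 h4) -loc_tr.
Qed.

Lemma B1_atlas : smooth_atlas (B1 M).
Proof.
split; first exact: B1_inj.
move=> cd cd' W; have EW w : W w <-> _ := overlap_B1 cd cd' w.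
pose l (w : 'rV[R]_(n + (n + n * n))) := lsubmx w.
pose r (w : 'rV[R]_(n + (n + n * n))) := rsubmx w.
have oA := open_overlap aM cd.1 cd'.1; have oB := open_overlap aM cd.2 cd'.2.
have oA' := open_overlap aM cd'.1 cd.1.
have oW : open W.
  have -> : W = [set w | @overlap _ _ M cd.1 cd'.1 (lsubmx w)] `&`
    [set w | @overlap _ _ M cd.2 cd'.2 (lsubmx (rsubmx w))] `&`
    [set w | vec_mx (rsubmx (rsubmx w)) \in unitmx].
    by apply/seteqP; split=> w; [case/EW|move=> [[h1 h2] h3]; apply/EW].
  apply: openI; first apply: openI.
  - exact: open_preimage_linear oA.
  - exact: (open_preimage_linear rsubmx (open_preimage_linear lsubmx oB)).
  - exact: (open_preimage_linear rsubmx (open_preimage_linear rsubmx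
      (open_preimage_linear vec_mx (@open_unitmx _ n)))).
split=> // xi0; apply/CinftyE.
have sid := @smooth_id _ _ W.
have sr := smooth_lin rsubmx oW sid.
have s1 : smooth W (fun w : 'rV[R]_(n + (n + n * n)) => lsubmx w) := smooth_lin lsubmx oW sid.
have s2 : smooth W (fun w : 'rV[R]_(n + (n + n * n)) => lsubmx (rsubmx w)) := smooth_lin lsubmx oW sr.
have s3 : smooth W (fun w : 'rV[R]_(n + (n + n * n)) => vec_mx (rsubmx (rsubmx w)) : 'M[R]_n).
  exact: (smooth_lin vec_mx oW (smooth_lin rsubmx oW sr)).
have W1 w : W w -> @overlap _ _ M cd.1 cd'.1 (lsubmx w) by case/EW.
have W2 w : W w -> @overlap _ _ M cd.2 cd'.2 (lsubmx (rsubmx w)) by case/EW.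
have t1 := smooth_transition aM (lsrc xi0) cd.1 cd'.1.
have t2 := smooth_transition aM (ltgt xi0) cd.2 cd'.2.
have t3 := smooth_transition aM (lsrc xi0) cd'.1 cd.1.
have k1 := smooth_comp oW oA W1 s1 t1.
have k2 := smooth_comp oW oB W2 s2 t2.
have k4 := smooth_comp oW oB W2 s2 (smooth_jacobian oB t2).
have W3 w : W w -> @overlap _ _ M cd'.1 cd.1 (coord M cd'.1 (param (lsrc xi0) cd.1 (lsubmx w))).
  by move=> /W1 [p [p1 p2] <-]; rewrite param_coord //; exists p.
have k3 := smooth_comp oW oA' W3 k1 (smooth_jacobian oA' t3).
have S : smooth W (B1_trans (lsrc xi0) (ltgt xi0) cd cd').
  apply: (smooth_row_mx oW k1); apply: (smooth_row_mx oW k2).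
  by apply: (smooth_lin mxvec oW); exact: (smooth_mulmx oW (smooth_mulmx oW k3 s3) k4).
by apply: smooth_eq oW _ S => w Ww; rewrite -B1_transition.
Qed.

End LinearMaps.

Section Affine.
Context {R : realType} {m p q : nat}.
Implicit Types (L : {linear 'rV[R]_m -> 'M[R]_(p, q)}) (A : set 'rV[R]_m).

Lemma smooth_affine L A a (u0 : 'rV[R]_m) : open A ->
  smooth A (fun u => a + L (u - u0)).
Proof.
move=> oA; apply: (smooth_add oA (smooth_const _ _)).
apply: (smooth_lin L oA (smooth_add oA (@smooth_id _ _ _) (smooth_const _ _))).
Qed.

Lemma is_diff_affine L a (u0 u : 'rV[R]_m) : is_diff u (fun u => a + L (u - u0)) L.
Proof.
have K := is_diff_lin L (is_diff_sub (is_diff_id u) (is_diff_const u0 u)).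
apply: is_diff_ext (is_diff_add (is_diff_const a u) K) _ _ => y //.
by rewrite add0r subr0.
Qed.

End Affine.

Section Jets.
Context {R : realType} {n q : nat} (M : charted R n) (G : groupoid_over M q).
Hypotheses (aM : smooth_atlas M) (pM : forall x : M, points x).
Let cM (x : M) : dom M (chart_at M x) x := pM x.

(* matrix in the charts [c] and [d] of the differential part of a jet *)
Definition jmx c d (j : jet G) : 'M[R]_(n, q) :=
  tr c (chart_at M (src j.1)) (src j.1) *m j.2 *m tr (chart_at G j.1) d j.1.

Lemma represents_rep (j : jet G) : is_jet j -> represents (rep j) j.
Proof. by move=> [b hb]; rewrite /rep; exact: (@xgetI {classic local_section G} _ [set b | represents b j] b hb). Qed.

Hypothesis aG : smooth_atlas G.

Lemma bisection_chart_diff (b : local_section G) x c d : local_bisection b -> ldom b x ->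
  dom M c x -> dom G d (b x) ->
  chart_diff c d b x /\ jacin c d b x = jmx c d (j1 b x).
Proof.
move=> [_ sb bs _] bx cx dx; have px : dom G (chart_at G (b x)) (b x) := sb.1 x bx.
have K := smooth_on_chart_diff aM sb bx (cM x) px.
have [h1 h2] := chart_diff_change aM aG K cx dx.
by split; [exact: h1|rewrite h2 /jmx /= bs // jac_jacin].
Qed.

Lemma represents_chart_diff b (j : jet G) c d : represents b j ->
  dom M c (src j.1) -> dom G d j.1 ->
  [/\ b (src j.1) = j.1, chart_diff c d b (src j.1) & jacin c d b (src j.1) = jmx c d j].
Proof.
move=> [lb bx ej] cx dx; have e1 : j.1 = b (src j.1) by rewrite {1}ej.
have dx' : dom G d (b (src j.1)) by rewrite -e1.
have [h1 h2] := bisection_chart_diff lb bx cx dx'.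
by rewrite -ej in h2.
Qed.

(** The charts of [J1 G] differentiate the chosen representative [rep j]; any representative has the
    differential stored in [j], so the choice disappears. *)
Lemma coord_jet c d (j : J1 G) : is_jet j -> dom M c (src j.1) -> dom G d j.1 ->
  coord (J1 G) (c, d) j = row_mx (coord G d j.1) (mxvec (jmx c d j)).
Proof.
move=> hj cx dx; have [_ _ <-] := represents_chart_diff (represents_rep hj) cx dx.
by rewrite jacinJ.
Qed.

Lemma jmx_tr c d c' d' (j : jet G) : dom M c (src j.1) -> dom M c' (src j.1) ->
  dom G d j.1 -> dom G d' j.1 -> points j.1 ->
  jmx c' d' j = tr c' c (src j.1) *m jmx c d j *m tr d d' j.1.
Proof.
move=> h1 h2 h3 h4 h5; rewrite /jmx !mulmxA (tr_comp aM h2 h1 (cM _)).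
by rewrite -!mulmxA (tr_comp aG h5 h3 h4).
Qed.

Lemma jmx_at (j : jet G) : points j.1 ->
  jmx (chart_at M (src j.1)) (chart_at G j.1) j = j.2.
Proof. by move=> h; rewrite /jmx (tr_id aM (cM _)) (tr_id aG h) mul1mx mulmx1. Qed.

Lemma jmx_inj c d (j j' : jet G) : dom M c (src j.1) -> dom G d j.1 ->
  points j.1 -> j.1 = j'.1 -> jmx c d j = jmx c d j' -> j = j'.
Proof.
case: j j' => [g A] [g' A'] /= h1 h2 h3 e; rewrite -{}e => E.
congr pair; rewrite -[A]/((g, A).2) -[A']/((g, A').2).
rewrite -(jmx_at (j := (g, A)) h3) -(jmx_at (j := (g, A')) h3).
rewrite (jmx_tr (j := (g, A')) h1 (cM _) h2 h3 h3).
by rewrite (jmx_tr (j := (g, A)) h1 (cM _) h2 h3 h3) E.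
Qed.

End Jets.

(** * Bisections built from coordinate expressions *)

Section ChartBisection.
Context {R : realType} {n q : nat} (M : charted R n) (G : groupoid_over M q).
Hypotheses (aM : smooth_atlas M) (pM : forall x : M, points x).
Hypothesis eG : extendable_atlas G.
Context (c d : chart M) (e : chart G) (A : set 'rV[R]_n) (u0 v0 : 'rV[R]_n).
Context (P : 'M[R]_n) (beta : 'rV[R]_n -> G).
Let alpha u := v0 + (u - u0) *m P.
Let alphaV v := u0 + (v - v0) *m invmx P.
Hypotheses (uP : P \in unitmx) (oA : open A) (Ac : A `<=` coord M c @` dom M c).
Hypothesis Ad : forall u, A u -> (coord M d @` dom M d) (alpha u).
Hypothesis betaP : forall u, A u -> points (beta u) /\ dom G e (beta u).
Hypothesis beta_src : forall u x, A u -> src (beta u) = param x c u.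
Hypothesis beta_tgt : forall u x, A u -> tgt (beta u) = param x d (alpha u).
Hypothesis beta_smooth : smooth A (fun u => coord G e (beta u)).

Definition chart_section : local_section G :=
  LocalSection [set x | dom M c x /\ A (coord M c x)] (fun x => beta (coord M c x)).

Let alphaK u : alphaV (alpha u) = u.
Proof. by rewrite /alphaV /alpha (addrC v0) addrK mulmxK // addrC subrK. Qed.

Let alphaVK v : alpha (alphaV v) = v.
Proof. by rewrite /alphaV /alpha (addrC u0) addrK mulmxKV // addrC subrK. Qed.

Let s_alpha B : open B -> smooth B alpha.
Proof. exact: (smooth_affine (mulmxr P)). Qed.

Let s_alphaV B : open B -> smooth B alphaV.
Proof. exact: (smooth_affine (mulmxr (invmx P))). Qed.

Let base_chart x : dom M c x -> A (coord M c x) ->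
  dom M d (base_map chart_section x) /\
  coord M d (base_map chart_section x) = alpha (coord M c x).
Proof.
move=> cx Ax; rewrite /base_map /= (beta_tgt x Ax).
exact: (coord_param x (Ad Ax)).
Qed.

Let image_base : base_map chart_section @` ldom chart_section =
  [set y | dom M d y /\ A (alphaV (coord M d y))].
Proof.
apply/seteqP; split=> [_ [x [cx Ax] <-]|y [dy Ay]] /=.
  by have [h1 h2] := base_chart cx Ax; rewrite h2 alphaK.
have [x cx ex] := Ac Ay; have Ax : A (coord M c x) by rewrite ex.
exists x => //=; have [h1 h2] := base_chart cx Ax.
by apply: (coord_inj aM h1 dy); rewrite h2 ex alphaVK.
Qed.

(** In charts the base map is the affine map [alpha], chosen because its inverse is the closed
    formula [alphaV]: smoothness of the inverse and openness of the image are then read off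
    directly. *)
Lemma chart_section_bisection : local_bisection chart_section.
Proof.
have oB : open (alphaV @^-1` A).
  apply: open_preimage_continuous oA => v.
  exact: (s_alphaV openT 0%N).
split.
- apply: (open_in_local aM) => x [cx Ax]; exists c, A; split=> //.
- apply: (smooth_on_local aM eG) => x [cx Ax]; first by have [] := betaP Ax.
  exists c, e, A, (fun u => coord G e (beta u)); split=> // y cy Ay.
  by have [_ h] := betaP Ay.
- by move=> x [cx Ax] /=; rewrite (beta_src x Ax) param_coord.
split.
- apply: (smooth_on_local aM (smooth_atlas_extendable aM)) => x [cx Ax]; first exact: pM.
  exists c, d, A, alpha; split=> //; first exact: s_alpha.
  by move=> y cy Ay; have [h1 h2] := base_chart cy Ay; split.
- rewrite image_base; apply: (open_in_local aM) => y [dy Ay].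
  by exists d, (alphaV @^-1` A); split=> // z dz Az; split.
exists (fun y => param y c (alphaV (coord M d y))); last first.
  move=> x [cx Ax]; have [h1 h2] := base_chart cx Ax.
  by rewrite h2 alphaK param_coord.
rewrite image_base.
apply: (smooth_on_local aM (smooth_atlas_extendable aM)) => y [dy Ay]; first exact: pM.
exists d, c, (alphaV @^-1` A), alphaV; split=> //; first exact: s_alphaV.
move=> z dz Az; have [h1 h2] := coord_param z (Ac Az).
by split.
Qed.

Lemma chart_section_jacin x df : dom M c x -> A (coord M c x) ->
  is_diff (coord M c x) (fun u => coord G e (beta u)) df ->
  forall v, v *m jacin c e chart_section x = df v.
Proof.
move=> cx Ax dbeta v; rewrite jacinJ; apply: jacobianE.
apply: near_is_diff dbeta; near=> u.
have Au : A u by near: u; exact: open_nbhs_nbhs.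
by have [_ h] := coord_param x (Ac Au); rewrite /= h.
Unshelve. all: by end_near. Qed.

End ChartBisection.

Section LinearMapJets.
Context {R : realType} {n : nat} (M : charted R n).
Hypotheses (aM : smooth_atlas M) (pM : forall x : M, points x).
Let aB : smooth_atlas (B1 M) := B1_atlas aM pM.

Definition jmx1 (c d : chart M) (j : B11nh M) : 'M[R]_(n, n + (n + n * n)) :=
  @jmx _ _ _ M (B1 M) c (c, d) j.

Lemma points_dom_B1 (xi : B1 M) c d : lmx xi \in unitmx -> dom M c (lsrc xi) ->
  dom M d (ltgt xi) -> dom (B1 M) (c, d) xi.
Proof. by move=> h1 h2 h3; split. Qed.

Lemma jet_unit (j : J1 (B1 M)) : is_jet j -> lmx (jp j) \in unitmx.
Proof.
move=> [b [[_ sb _ _] bx ej]]; have := sb.1 _ bx.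
by rewrite (_ : b _ = j.1); [case|rewrite {2}ej].
Qed.

(** In charts the bisection is affine: target v0 + (u - u0) P and linear map A0 plus the matrix of
    (u - u0) Q. *)
Lemma B1_jet_exists c d (xi : B1 M) (P : 'M[R]_n) (Q : 'M[R]_(n, n * n)) :
  points xi -> dom M c (lsrc xi) -> dom M d (ltgt xi) -> P \in unitmx ->
  exists j : B11nh M, [/\ is_jet j, j.1 = xi &
    jmx1 c d j = row_mx 1%:M (row_mx P Q)].
Proof.
move=> /(points_B1 pM) uxi cp dq uP.
set p := lsrc xi in cp *; set t := ltgt xi in dq *.
pose u0 := coord M c p; pose v0 := coord M d t; pose A0 := loc c d xi.
pose al u := v0 + (u - u0) *m P.
pose Am u := A0 + vec_mx ((u - u0) *m Q).
(* Where both charts are available and the affine family [Am] remains invertible. *)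
pose A := (coord M c @` dom M c) `&` (al @^-1` (coord M d @` dom M d)) `&`
  (Am @^-1` [set B | B \in unitmx]).
pose L : {linear 'rV[R]_n -> 'M[R]_n} := vec_mx \o mulmxr Q.
have s_al B : open B -> smooth B al by exact: (smooth_affine (mulmxr P)).
have s_Am B : open B -> smooth B Am by exact: (smooth_affine L).
have oA : open A.
  apply: openI; first apply: openI; first exact: open_image.
    apply: open_preimage_continuous; last exact: open_image.
    by move=> u; exact: (s_al setT openT 0%N).
  apply: open_preimage_continuous; last exact: open_unitmx.
  by move=> u; exact: (s_Am setT openT 0%N).
pose beta u := of_loc c d (param p c u) (param t d (al u)) (Am u).
have Ac : A `<=` coord M c @` dom M c by move=> u [[]].
have Ad u : A u -> (coord M d @` dom M d) (al u) by move=> [[]].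
have coordbeta u : A u -> dom (B1 M) (c, d) (beta u) /\
    coord (B1 M) (c, d) (beta u) = row_mx u (row_mx (al u) (mxvec (Am u))).
  move=> Au; have [h1 h2] := coord_param p (Ac _ Au); have [h3 h4] := coord_param t (Ad _ Au).
  have h5 : Am u \in unitmx := Au.2; split; last by rewrite coord_of_loc // h2 h4.
  by split=> //=; rewrite -(of_loc_unit aM pM (Am u) h1 h3) in h5.
have betaP u : A u -> points (beta u) /\ dom (B1 M) (c, d) (beta u).
  by move=> /coordbeta [h _]; split=> //; apply/points_B1 => //; case: h.
have param_def y z c' w : (coord M c' @` dom M c') w -> param y c' w = param z c' w.
  by move=> [r h <-]; rewrite !param_coord.
have beta_src u y : A u -> src (beta u) = param y c u.
  by move=> Au; apply: param_def; exact: Ac.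
have beta_tgt u y : A u -> tgt (beta u) = param y d (al u).
  by move=> Au; apply: param_def; exact: Ad.
have beta_smooth : smooth A (fun u => coord (B1 M) (c, d) (beta u)).
  apply: (@smooth_eq _ _ _ _ (fun u => row_mx u (row_mx (al u) (mxvec (Am u))))) => //.
    by move=> u /coordbeta [].
  apply: (smooth_row_mx oA (@smooth_id _ _ _)); apply: (smooth_row_mx oA (s_al _ oA)).
  exact: (smooth_lin mxvec oA (s_Am _ oA)).
have lb := chart_section_bisection aM pM (smooth_atlas_extendable aB) uP oA Ac Ad betaP
  beta_src beta_tgt beta_smooth.
set b := chart_section _ _ _ in lb.
have al0 : al u0 = v0 by rewrite /al subrr mul0mx addr0.
have Am0 : Am u0 = A0 by rewrite /Am subrr mul0mx linear0 addr0.
have Au0 : A u0.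
  split; first by split; [exists p|exists t].
  by rewrite /= Am0 loc_unit.
have bp : b p = xi.
  rewrite /= /beta -/u0 al0 Am0 /v0 /u0 !param_coord //.
  exact: locK.
have j1E : (j1 b p).1 = xi := bp.
exists (j1 b p); split=> //.
  by exists b; rewrite /represents j1E; split.
have dxi : dom (B1 M) (c, d) (b p) by rewrite bp; exact: points_dom_B1.
have bx : ldom b p by [].
rewrite /jmx1; have [h1 <-] := bisection_chart_diff aM pM aB lb bx cp dxi.
have dbeta : is_diff u0 (fun u => coord (B1 M) (c, d) (beta u))
    (fun v => row_mx v (row_mx (v *m P) (mxvec (L v)))).
  apply: (@near_is_diff _ _ _ (fun u => row_mx u (row_mx (al u) (mxvec (Am u))))).
    near=> u; have Au : A u by near: u; exact: open_nbhs_nbhs.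
    by have [_ ->] := coordbeta u Au.
  apply: (is_diff_row_mx (is_diff_id _)).
  apply: is_diff_row_mx; first exact: (is_diff_affine (mulmxr P)).
  exact: (is_diff_lin mxvec (is_diff_affine L _ _ _)).
have E := chart_section_jacin oA Ac cp Au0 dbeta.
apply/row_matrixP => i; rewrite !rowE E /= !mul_mx_row mulmx1.
by rewrite vec_mxK.
Unshelve. all: by end_near. Qed.

End LinearMapJets.

Section Blocks.
Context {R : realType} {V : normedModType R} {p q r : nat}.

Lemma is_diff_lsubmx (f df : V -> 'M[R]_(p, q + r)) x :
  is_diff x f df -> is_diff x (fun v => lsubmx (f v)) (fun v => lsubmx (df v)).
Proof. exact: is_diff_lin. Qed.

Lemma is_diff_rsubmx (f df : V -> 'M[R]_(p, q + r)) x :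
  is_diff x f df -> is_diff x (fun v => rsubmx (f v)) (fun v => rsubmx (df v)).
Proof. exact: is_diff_lin. Qed.

Lemma is_diff_mxvec (f df : V -> 'M[R]_(p, q)) x :
  is_diff x f df -> is_diff x (fun v => mxvec (f v)) (fun v => mxvec (df v)).
Proof. exact: is_diff_lin. Qed.

Lemma is_diff_vec_mx (f df : V -> 'rV[R]_(p * q)) x :
  is_diff x f df -> is_diff x (fun v => vec_mx (f v)) (fun v => vec_mx (df v)).
Proof. exact: is_diff_lin. Qed.

End Blocks.

(** * Blocks of the matrix of a jet, and semiholonomy *)

Section JetBlocks.
Context {R : realType} {n : nat} (M : charted R n).
Hypotheses (aM : smooth_atlas M) (pM : forall x : M, points x).
Let cM (x : M) : dom M (chart_at M x) x := pM x.
Let aB : smooth_atlas (B1 M) := B1_atlas aM pM.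

Lemma lsubmx_mulmx p q r s (A : 'M[R]_(p, q)) (B : 'M[R]_(q, r + s)) :
  lsubmx (A *m B) = A *m lsubmx B.
Proof. by rewrite -{1}(hsubmxK B) mul_mx_row row_mxKl. Qed.

Lemma rsubmx_mulmx p q r s (A : 'M[R]_(p, q)) (B : 'M[R]_(q, r + s)) :
  rsubmx (A *m B) = A *m rsubmx B.
Proof. by rewrite -{1}(hsubmxK B) mul_mx_row row_mxKr. Qed.

Lemma eq_mulmx_rV p q (A B : 'M[R]_(p, q)) :
  (forall v : 'rV_p, v *m A = v *m B) -> A = B.
Proof. by move=> h; apply/row_matrixP => i; rewrite !rowE h. Qed.

Lemma represents_is_diff b (j : B11nh M) c d : represents b j ->
  dom M c (src j) -> dom M d (tgt j) ->
  [/\ b (src j) = jp j,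
      \forall u \near coord M c (src j),
        [/\ ldom b (param (src j) c u), dom M c (param (src j) c u),
            coord M c (param (src j) c u) = u, dom M d (tgt (b (param (src j) c u)))
          & src (b (param (src j) c u)) = param (src j) c u]
    & is_diff (coord M c (src j))
        (fun u => coord (B1 M) (c, d) (b (param (src j) c u)))
        (mulmxr (jmx1 c d j))].
Proof.
move=> rb cx dx; have [lb bx ej] := rb; have [ob sb bs _] := lb.
have uj : lmx (jp j) \in unitmx by apply: (@jet_unit _ _ _ j); exists b.
have dj : dom (B1 M) (c, d) (jp j) by split.
have [e1 e2 e3] := represents_chart_diff aM pM aB rb cx dj.
split=> //; last by rewrite /jmx1 -e3; exact: is_diff_jacin.
have [_ _ nd _] := e2.
near=> u.
have bu : ldom b (param (src j) c u) by near: u; exact: open_in_near ob bx cx.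
have [h1 h2] : dom M c (param (src j) c u) /\ coord M c (param (src j) c u) = u.
  apply: coord_param; near: u; apply: open_nbhs_nbhs.
  by split; [exact: open_image|exists (src j)].
split=> //; last exact: bs.
by have [] : dom (B1 M) (c, d) (b (param (src j) c u)) by near: u.
Unshelve. all: by end_near. Qed.

(** A bisection is a section of the source map, so its source coordinates are the identity near the
    point. *)
Lemma jmx_src_block (j : B11nh M) c d : is_jet j -> dom M c (src j) -> dom M d (tgt j) ->
  lsubmx (jmx1 c d j) = 1%:M.
Proof.
move=> [b rb] cx dx; have [_ nb df] := represents_is_diff rb cx dx.
have dl := is_diff_lsubmx df.
apply: eq_mulmx_rV => v; rewrite mulmx1 -lsubmx_mulmx.
suff H : (fun v : 'rV_n => lsubmx (mulmxr (jmx1 c d j) v)) = id by rewrite -[RHS]/(id v) -H.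
apply: (is_diff_uniq dl); apply: near_is_diff (is_diff_id _).
apply: filterS nb => u [_ _ h3 _ h5].
by rewrite coord_B1 row_mxKl -[lsrc _]/(src (b (param (src j) c u))) h5 [RHS]h3.
Qed.

Lemma base_map_jacin b (j : B11nh M) c d : represents b j ->
  dom M c (src j) -> dom M d (tgt j) ->
  chart_diff c d (base_map b) (src j) /\
  jacin c d (base_map b) (src j) = lsubmx (rsubmx (jmx1 c d j)).
Proof.
move=> rb cx dx; have [bj nb df] := represents_is_diff rb cx dx.
have dl := is_diff_lsubmx (is_diff_rsubmx df).
have K : is_diff (coord M c (src j)) (fun u => coord M d (base_map b (param (src j) c u)))
    (fun v => lsubmx (rsubmx (mulmxr (jmx1 c d j) v))).
  apply: is_diff_ext dl _ _ => [u|//]; rewrite coord_B1.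
  by rewrite row_mxKr row_mxKl.
split.
  split=> //; first by rewrite /base_map bj.
  by apply: filterS nb => u [].
rewrite jacinJ; apply: (eq_jacobian K) => v.
by rewrite /= rsubmx_mulmx lsubmx_mulmx.
Qed.

(** The middle block is the Jacobian of the base map, which p = p_* identifies with the linear map
    carried by [j]. The remaining last block is the second order part. *)
Lemma B11sh_block (j : B11nh M) c d : B11sh j -> dom M c (src j) -> dom M d (tgt j) ->
  lsubmx (rsubmx (jmx1 c d j)) = loc c d (jp j).
Proof.
move=> [ij ej] cx dx; have rj := represents_rep ij.
have [bj nb df] := represents_is_diff rj cx dx.
have [fd <-] := base_map_jacin rj cx dx.
have tb : base_map (rep j) (src j) = tgt j by rewrite /base_map bj.
have fd1 := cM (src j); have fd2 : dom M (chart_at M (base_map (rep j) (src j))) (base_map (rep j) (src j)) := cM _.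
have [fd' E] := chart_diff_change aM aM fd fd1 fd2.
have dx' : dom M d (base_map (rep j) (src j)) by rewrite tb.
have [_ E'] := chart_diff_change aM aM fd' cx dx'.
by rewrite E' -jac_jacin /loc ej /jpstar -[lmx _]/(jac (base_map (rep j)) (src j)) tb.
Qed.

Lemma B11sh_jmx (j : B11nh M) c d : B11sh j -> dom M c (src j) -> dom M d (tgt j) ->
  jmx1 c d j = row_mx 1%:M (row_mx (loc c d (jp j)) (rsubmx (rsubmx (jmx1 c d j)))).
Proof.
move=> hj cx dx; rewrite -{1}(hsubmxK (jmx1 c d j)) (jmx_src_block hj.1 cx dx).
by rewrite -{1}(hsubmxK (rsubmx _)) (B11sh_block hj cx dx).
Qed.

Lemma B11shP (j : B11nh M) c d : is_jet j -> dom M c (src j) -> dom M d (tgt j) ->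
  lsubmx (rsubmx (jmx1 c d j)) = loc c d (jp j) -> B11sh j.
Proof.
move=> ij cx dx E; split=> //; have rj := represents_rep ij.
have [bj nb df] := represents_is_diff rj cx dx.
have tb : base_map (rep j) (src j) = tgt j by rewrite /base_map bj.
have [fd] := base_map_jacin rj cx dx; rewrite E => E1.
have fd1 := cM (src j); have fd2 : dom M (chart_at M (base_map (rep j) (src j))) (base_map (rep j) (src j)) := cM _.
have [fd' E2] := chart_diff_change aM aM fd fd1 fd2.
rewrite /jpstar jac_jacin E2 E1 tb.
exact/esym/(@locK _ _ _ aM pM c d (jp j)).
Qed.

End JetBlocks.

(** * Charts and existence of second order jets *)

Section SecondJets.
Context {R : realType} {n : nat} (M : charted R n).
Hypotheses (aM : smooth_atlas M) (pM : forall x : M, points x).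
Let cM (x : M) : dom M (chart_at M x) x := pM x.
Let aB : smooth_atlas (B1 M) := B1_atlas aM pM.
Let q := (n + (n + n * n))%N.

Lemma coord_B11 (c d e : chart M) (j : B11nh M) : is_jet j -> dom M c (src j) ->
  dom M d (src j) -> dom M e (tgt j) ->
  coord (B11nh M) (c, (d, e)) j =
  row_mx (coord (B1 M) (d, e) (jp j)) (mxvec (@jmx _ _ _ M (B1 M) c (d, e) j)).
Proof.
move=> ij h1 h2 h3; apply: coord_jet => //.
by split=> //; exact: jet_unit ij.
Qed.

(** Jet matrices begin with the block 1, so chart images lie in an affine subspace. The transition
    formula still makes sense with an arbitrary matrix in place of the jet matrix, and so extends to
    the open set [W]. *)
Lemma B11_extendable : extendable_atlas (B11nh M).
Proof.
move=> [c [d e]] [c' [d' e']] j [ij h1 [uj h2 h3]] [_ h1' [_ h2' h3']].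
(* The source appears in the coordinates through [d] only, whereas the differential is taken in [c];
   the Jacobian from [c'] to [c] has to be evaluated at the coordinate in [c'], which is computed
   from [d]. *)
pose T1 := fun u => coord M c' (param (src j) d u).
pose B1t := fun w => coord (B1 M) (d', e') (param (jp j) (d, e) w).
pose W := [set w : 'rV[R]_(q + n * q) |
  [/\ @overlap _ _ M d c (lsubmx (lsubmx w)), @overlap _ _ M d c' (lsubmx (lsubmx w)) &
      @overlap _ _ (B1 M) (d, e) (d', e') (lsubmx w)]].
have oW : open W.
  have -> : W = (fun w : 'rV[R]_(q + n * q) => lsubmx (lsubmx w)) @^-1` (@overlap _ _ M d c) `&`
     (fun w : 'rV[R]_(q + n * q) => lsubmx (lsubmx w)) @^-1` (@overlap _ _ M d c') `&`
     (fun w : 'rV[R]_(q + n * q) => lsubmx w) @^-1` (@overlap _ _ (B1 M) (d, e) (d', e')).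
    by apply/seteqP; split=> w; [move=> []|move=> [[]]].
  apply: openI; first apply: openI.
  - exact: (open_preimage_linear lsubmx (open_preimage_linear lsubmx (open_overlap aM _ _))).
  - exact: (open_preimage_linear lsubmx (open_preimage_linear lsubmx (open_overlap aM _ _))).
  - exact: (open_preimage_linear lsubmx (open_overlap aB _ _)).
pose t (w : 'rV[R]_(q + n * q)) : 'rV[R]_(q + n * q) :=
  row_mx (B1t (lsubmx w)) (mxvec ('J (fun u => coord M c (param (src j) c' u)) (T1 (lsubmx (lsubmx w)))
    *m vec_mx (rsubmx w) *m 'J B1t (lsubmx w))).
have key (k : B11nh M) : dom (B11nh M) (c, (d, e)) k -> W (coord (B11nh M) (c, (d, e)) k) ->
   dom (B11nh M) (c', (d', e')) k /\
   coord (B11nh M) (c', (d', e')) k = t (coord (B11nh M) (c, (d, e)) k).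
  move=> [ik k1 [uk k2 k3]].
  have E : coord (B11nh M) (c, (d, e)) k = row_mx (coord (B1 M) (d, e) (jp k))
    (mxvec (@jmx _ _ _ M (B1 M) c (d, e) k)) := coord_B11 ik k1 k2 k3.
  have t1 : lsubmx (coord (B11nh M) (c, (d, e)) k) = coord (B1 M) (d, e) (jp k).
    by rewrite E row_mxKl.
  have t2 : vec_mx (rsubmx (coord (B11nh M) (c, (d, e)) k)) = @jmx _ _ _ M (B1 M) c (d, e) k.
    by rewrite E row_mxKr mxvecK.
  have t3 : lsubmx (coord (B1 M) (d, e) (jp k)) = coord M d (src k).
    by rewrite coord_B1 row_mxKl.
  move=> [g1 g2 g3]; rewrite t1 in g1 g2 g3; rewrite t3 in g1 g2.
  have := g3; move=> [xi [[x1 x2 x3] [y1 y2 y3]] e5].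
  have ex : xi = jp k := coord_inj aB (And3 x1 x2 x3) (And3 uk k2 k3) e5.
  rewrite ex in y2 y3.
  have k1' : dom M c' (src k).
    have [p5 [f1 f2] f3] := g2.
    have e6 : p5 = src k := coord_inj aM f1 k2 f3.
    by rewrite -e6.
  split; first exact: (And3 ik k1' (And3 uk y2 y3)).
  have b1 : dom (B1 M) (d, e) (jp k) := And3 uk k2 k3.
  have b2 : dom (B1 M) (d', e') (jp k) := And3 uk y2 y3.
  have b3 : points (jp k) := And3 uk (cM _) (cM _).
  have z1 : B1t (coord (B1 M) (d, e) (jp k)) = coord (B1 M) (d', e') (jp k).
    exact: (congr1 (coord (B1 M) (d', e')) (param_coord aB (jp j) b1)).
  have z2 : T1 (coord M d (src k)) = coord M c' (src k).
    exact: (congr1 (coord M c') (param_coord aM (src j) k2)).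
  have z3 := trE aB (jp j) b1 b2.
  have z4 := trE aM (src j) k1' k1.
  rewrite /t t1 t2 t3 z1 z2.
  rewrite -[X in mxvec (X *m _ *m _)]z4 -[X in mxvec (_ *m X)]z3.
  rewrite (coord_B11 ik k1' y2 y3); congr (row_mx _ (mxvec _)).
  exact: (jmx_tr aM pM aB k1 k1' b1 b2 b3).
exists W, t; split=> //.
- have t1 : lsubmx (coord (B11nh M) (c, (d, e)) j) = coord (B1 M) (d, e) (jp j).
    have E : coord (B11nh M) (c, (d, e)) j = row_mx (coord (B1 M) (d, e) (jp j))
      (mxvec (@jmx _ _ _ M (B1 M) c (d, e) j)) := coord_B11 ij h1 h2 h3.
    by rewrite E row_mxKl.
  have t3 : lsubmx (coord (B1 M) (d, e) (jp j)) = coord M d (src j).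
    by rewrite coord_B1 row_mxKl.
  split; rewrite t1 ?t3.
  + by exists (src j).
  + by exists (src j).
  + exact: (ex_intro2 _ _ (jp j) (conj (And3 uj h2 h3) (And3 uj h2' h3')) erefl).
- have sid := @smooth_id _ _ W.
  have sl : smooth W (fun w : 'rV[R]_(q + n * q) => lsubmx w) := smooth_lin lsubmx oW sid.
  have sll : smooth W (fun w : 'rV[R]_(q + n * q) => lsubmx (lsubmx w) : 'rV[R]_n).
    exact: (smooth_lin lsubmx oW sl).
  have sr : smooth W (fun w : 'rV[R]_(q + n * q) => vec_mx (rsubmx w) : 'M[R]_(n, q)).
    exact: (smooth_lin vec_mx oW (smooth_lin rsubmx oW sid)).
  have oB := open_overlap aB (d, e) (d', e').
  have W1 w : W w -> @overlap _ _ (B1 M) (d, e) (d', e') (lsubmx w) by case.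
  have W2 w : W w -> @overlap _ _ M d c' (lsubmx (lsubmx w)) by case.
  have sB : smooth _ B1t := smooth_transition aB (jp j) (d, e) (d', e').
  have sT : smooth _ T1 := smooth_transition aM (src j) d c'.
  have sT2 := smooth_transition aM (src j) c' c.
  have oM2 := open_overlap aM c' c.
  have W3 w : W w -> @overlap _ _ M c' c (T1 (lsubmx (lsubmx w))).
    move=> [[p1 [g1 g2] g3] [p2 [g4 g5] g6] _]; rewrite /T1 -g6 param_coord //.
    exists p2 => //; split=> //.
    by rewrite (coord_inj aM g4 g1) // g6 g3.
  have s1 := smooth_comp oW oB W1 sl sB.
  have s2 := smooth_comp oW oB W1 sl (smooth_jacobian oB sB).
  have s3 := smooth_comp oW (open_overlap aM d c') W2 sll sT.
  have s4 := smooth_comp oW oM2 W3 s3 (smooth_jacobian oM2 sT2).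
  apply: (smooth_row_mx oW s1); apply: (smooth_lin mxvec oW).
  exact: (smooth_mulmx oW (smooth_mulmx oW s4 sr) s2).
Qed.

End SecondJets.

Section SecondJetExistence.
Context {R : realType} {n : nat} (M : charted R n).
Hypotheses (aM : smooth_atlas M) (pM : forall x : M, points x).
Let cM (x : M) : dom M (chart_at M x) x := pM x.
Let aB : smooth_atlas (B1 M) := B1_atlas aM pM.

(* In the distinguished charts a jet of [B11nh] has coordinates [1 | P | Q];   *)
(* [L1] and [L2] prescribe the derivatives of [P] and [Q], [P1] and [C1] those *)
(* of the target and of the linear map.                                        *)
Lemma B11_jet_exists (j : B11nh M) (P P1 : 'M[R]_n) (Q C1 L1 : 'M[R]_(n, n * n))
    (L2 : 'M[R]_(n, n * (n * n))) :
  is_jet j -> P \in unitmx -> P1 \in unitmx ->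
  jmx1 (chart_at M (src j)) (chart_at M (tgt j)) j = row_mx 1%:M (row_mx P Q) ->
  exists k : B111nh M, [/\ is_jet k, k.1 = j & forall v, v *m k.2 =
    row_mx (row_mx v (row_mx (v *m P1) (v *m C1)))
      (mxvec (row_mx 0 (row_mx (vec_mx (v *m L1)) (vec_mx (v *m L2)))))].
Proof.
move=> ij uP uP1 jPQ.
set p := src j in jPQ *; set t := tgt j in jPQ *.
set c := chart_at M p in jPQ *; set d := chart_at M t in jPQ *.
have cp : dom M c p := cM p; have dt : dom M d t := cM t.
have uj := jet_unit ij.
pose u0 := coord M c p; pose v0 := coord M d t; pose A0 := loc c d (jp j).
pose al u := v0 + (u - u0) *m P1.
pose Am u := A0 + vec_mx ((u - u0) *m C1).
pose Pm u := P + vec_mx ((u - u0) *m L1).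
pose Qm u := Q + vec_mx ((u - u0) *m L2).
pose lC : {linear 'rV[R]_n -> 'M[R]_n} := vec_mx \o mulmxr C1.
pose l1 : {linear 'rV[R]_n -> 'M[R]_n} := vec_mx \o mulmxr L1.
pose l2 : {linear 'rV[R]_n -> 'M[R]_(n, n * n)} := vec_mx \o mulmxr L2.
pose A := (coord M c @` dom M c) `&` (al @^-1` (coord M d @` dom M d)) `&`
  (Am @^-1` [set B | B \in unitmx]) `&` (Pm @^-1` [set B | B \in unitmx]).
have s_al B : open B -> smooth B al by exact: (smooth_affine (mulmxr P1)).
have s_Am B : open B -> smooth B Am by exact: (smooth_affine lC).
have s_Pm B : open B -> smooth B Pm by exact: (smooth_affine l1).
have s_Qm B : open B -> smooth B Qm by exact: (smooth_affine l2).
have oA : open A.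
  apply: openI; first apply: openI; first apply: openI; first exact: open_image.
  - apply: open_preimage_continuous; last exact: open_image.
    by move=> u; exact: (s_al setT openT 0%N).
  - apply: open_preimage_continuous; last exact: open_unitmx.
    by move=> u; exact: (s_Am setT openT 0%N).
  - apply: open_preimage_continuous; last exact: open_unitmx.
    by move=> u; exact: (s_Pm setT openT 0%N).
have Ac : A `<=` coord M c @` dom M c by move=> u [[[]]].
have Ad u : A u -> (coord M d @` dom M d) (al u) by move=> [[[]]].
have AA u : A u -> Am u \in unitmx by move=> [[]].
have AP u : A u -> Pm u \in unitmx by move=> [].
pose xi u := of_loc c d (param p c u) (param t d (al u)) (Am u).
(* Over each [xi u] there is a jet with matrix [1 | Pm u | Qm u]. The axiom of choice assembles
   these into a section, whose smoothness is visible on its coordinates. *)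
have ex u : exists jj : B11nh M, A u -> [/\ is_jet jj, jj.1 = xi u &
    jmx1 c d jj = row_mx 1%:M (row_mx (Pm u) (Qm u))].
  have [Au|nA] := pselect (A u); last by exists j.
  have [h1 _] := coord_param p (Ac _ Au); have [h3 _] := coord_param t (Ad _ Au).
  have [] := @B1_jet_exists _ _ _ aM pM c d (xi u) (Pm u) (Qm u) _ h1 h3 (AP u Au).
    by apply/points_B1 => //; rewrite of_loc_unit //; exact: AA.
  by move=> jj hjj; exists jj.
have [beta betaE] := choice ex.
have coordbeta u : A u -> [/\ is_jet (beta u), dom (B11nh M) (c, (c, d)) (beta u) &
    coord (B11nh M) (c, (c, d)) (beta u) =
    row_mx (row_mx u (row_mx (al u) (mxvec (Am u))))
      (mxvec (row_mx 1%:M (row_mx (Pm u) (Qm u))))].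
  move=> Au; have [h1 h2] := coord_param p (Ac _ Au); have [h3 h4] := coord_param t (Ad _ Au).
  have [i1 i2 i3] := betaE u Au.
  have i4 := jet_unit i1.
  have k1 : dom M c (src (beta u)) by rewrite -[src _]/(lsrc (beta u).1) i2.
  have k2 : dom M d (tgt (beta u)) by rewrite -[tgt _]/(ltgt (beta u).1) i2.
  split; [exact: i1|exact: (And3 i1 k1 (And3 i4 k1 k2))|].
  rewrite (coord_B11 aM pM i1 k1 k1 k2) -i3; congr (row_mx _ _).
  by rewrite /jp i2 coord_of_loc // h2 h4.
have betaP u : A u -> points (beta u) /\ dom (B11nh M) (c, (c, d)) (beta u).
  move=> /coordbeta [h1 h2 _]; split; last exact: h2.
  exact: (And3 h1 (cM _) (And3 (jet_unit h1) (cM _) (cM _))).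
have param_def y z c' w : (coord M c' @` dom M c') w -> param y c' w = param z c' w.
  by move=> [r h <-]; rewrite !param_coord.
have beta_src u y : A u -> src (beta u) = param y c u.
  move=> Au; have [_ i2 _] := betaE u Au; rewrite -[src _]/(lsrc (beta u).1) i2.
  by apply: param_def; exact: Ac.
have beta_tgt u y : A u -> tgt (beta u) = param y d (al u).
  move=> Au; have [_ i2 _] := betaE u Au; rewrite -[tgt _]/(ltgt (beta u).1) i2.
  by apply: param_def; exact: Ad.
have beta_smooth : smooth A (fun u => coord (B11nh M) (c, (c, d)) (beta u)).
  apply: (@smooth_eq _ _ _ _ (fun u => row_mx (row_mx u (row_mx (al u) (mxvec (Am u))))
      (mxvec (row_mx 1%:M (row_mx (Pm u) (Qm u)))))); first exact: oA.
    by move=> u /coordbeta [].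
  apply: (smooth_row_mx oA).
    apply: (smooth_row_mx oA (@smooth_id _ _ _)); apply: (smooth_row_mx oA (s_al _ oA)).
    exact: (smooth_lin mxvec oA (s_Am _ oA)).
  apply: (smooth_lin mxvec oA (smooth_row_mx oA (smooth_const _ _) _)).
  exact: (smooth_row_mx oA (s_Pm _ oA) (s_Qm _ oA)).
have lb := chart_section_bisection aM pM (B11_extendable aM pM) uP1 oA Ac Ad betaP
  beta_src beta_tgt beta_smooth.
set b := chart_section _ _ _ in lb.
have al0 : al u0 = v0 by rewrite /al subrr mul0mx addr0.
have Am0 : Am u0 = A0 by rewrite /Am subrr mul0mx linear0 addr0.
have Pm0 : Pm u0 = P by rewrite /Pm subrr mul0mx linear0 addr0.
have Qm0 : Qm u0 = Q by rewrite /Qm subrr mul0mx linear0 addr0.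
have Au0 : A u0.
  split; last by rewrite /= Pm0.
  split; last by rewrite /= Am0 loc_unit.
  by split; [exists p|exists t].
have bp : b p = j.
  rewrite -[b p]/(beta u0); have [i1 i2 i3] := betaE u0 Au0.
  have xi0 : xi u0 = jp j.
    by rewrite /xi al0 Am0 /v0 /u0 !(param_coord aM) //; exact: locK.
  rewrite xi0 in i2; rewrite Pm0 Qm0 -jPQ in i3.
  apply: (@jmx_inj _ _ _ M (B1 M) aM pM aB c (c, d)) => //.
  - by rewrite i2.
  - by rewrite i2; exact: (And3 uj cp dt).
  - by rewrite i2; exact: (And3 uj (cM _) (cM _)).
exists (j1 b p); split.
- have e : (j1 b p).1 = j := bp.
  by exists b; split; [exact: lb|rewrite e|rewrite e].
- exact: bp.
have dbeta : is_diff u0 (fun u => coord (B11nh M) (c, (c, d)) (beta u))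
    (fun v => row_mx (row_mx v (row_mx (v *m P1) (mxvec (lC v))))
      (mxvec (row_mx 0 (row_mx (l1 v) (l2 v))))).
  apply: (@near_is_diff _ _ _ (fun u => row_mx (row_mx u (row_mx (al u) (mxvec (Am u))))
      (mxvec (row_mx 1%:M (row_mx (Pm u) (Qm u)))))).
    near=> u; have Au : A u by near: u; exact: open_nbhs_nbhs.
    by have [_ _ ->] := coordbeta u Au.
  apply: is_diff_row_mx.
    apply: (is_diff_row_mx (is_diff_id _)); apply: is_diff_row_mx.
      exact: (is_diff_affine (mulmxr P1)).
    exact: is_diff_mxvec (is_diff_affine lC _ _ _).
  have K12 := is_diff_row_mx (is_diff_affine l1 P u0 u0) (is_diff_affine l2 Q u0 u0).
  exact: is_diff_mxvec (is_diff_row_mx (is_diff_const (1%:M : 'M[R]_n) u0) K12).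
have E := chart_section_jacin oA Ac cp Au0 dbeta.
move=> v; rewrite -[(j1 b p).2]/(jac b p) jac_jacin bp.
rewrite -[chart_at (B11nh M) j]/(c, (c, d)) E /=.
by rewrite vec_mxK.
Unshelve. all: by end_near. Qed.

End SecondJetExistence.

(** * Action of jets on iterated tangent bundles *)

Section Curves.
Context {R : realType} {W : normedModType R}.

Lemma is_derive_is_diff (g : R -> W) v :
  is_derive (0 : R) (1 : R) g v -> is_diff (0 : R) g (fun h => h *: v).
Proof.
move=> [dg <-]; have dg' : differentiable g 0 by apply/derivable1_diffP.
apply: DiffDef; first exact: dg'.
rewrite (deriveE _ dg'); apply/funext => h.
by rewrite -[in LHS](mulr1 h) -[h * 1]/(h *: 1) linearZ.
Qed.

Lemma is_diff_is_derive (g : R -> W) dg v :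
  is_diff (0 : R) g dg -> dg 1 = v -> is_derive (0 : R) (1 : R) g v.
Proof.
move=> gd e; have dg' : differentiable g 0 := ex_diff (is_diff_def := gd).
apply: DeriveDef; first exact: diff_derivable dg'.
by rewrite (deriveE _ dg') (is_diffE _ gd).
Qed.

Lemma is_derive_continuous (g : R -> W) v :
  is_derive (0 : R) (1 : R) g v -> {for 0, continuous g}.
Proof.
move=> [dg _]; apply: differentiable_continuous.
exact/derivable1_diffP.
Qed.

Lemma is_derive_uniq (g : R -> W) v w :
  is_derive (0 : R) (1 : R) g v -> is_derive (0 : R) (1 : R) g w -> v = w.
Proof. by move=> [_ <-] [_ <-]. Qed.

End Curves.

Lemma near_continuous (T U : topologicalType) (f : T -> U) x y (Q : U -> Prop) :
  {for x, continuous f} -> f x = y -> (\forall u \near y, Q u) ->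
  \forall t \near x, Q (f t).
Proof. by move=> cf <- h; exact: cf. Qed.

Section DiffFacts.
Context {R : realType} {V W : normedModType R}.

Lemma is_diff_ex (f df : V -> W) x : is_diff x f df -> differentiable f x.
Proof. by case. Qed.

Lemma is_diff_continuous (f df : V -> W) x : is_diff x f df -> {for x, continuous f}.
Proof. by move=> h; apply: differentiable_continuous; exact: is_diff_ex h. Qed.

End DiffFacts.

Section Velocities.
Context {R : realType} {m : nat} (N : charted R m).
Hypotheses (aN : smooth_atlas N) (pN : forall x : N, points x).

Lemma velocity_exists (Z : tangent N) : exists z, velocity z Z.
Proof.
set c := chart_at N Z.1; have cZ : dom N c Z.1 := pN Z.1.
pose l (t : R) := coord N c Z.1 + t *: Z.2.
have l0 : l 0 = coord N c Z.1 by rewrite /l scale0r addr0.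
have dl : is_diff (0 : R) l (fun h => h *: Z.2).
  have := is_diff_add (is_diff_const (coord N c Z.1) (0 : R)) (is_diff_scalevec Z.2 (is_diff_id (0 : R))).
  by move/is_diff_ext; apply => // y; rewrite add0r.
have im : \forall t \near (0 : R), (coord N c @` dom N c) (l t).
  have cl : {for 0, continuous l} := is_diff_continuous dl.
  apply: cl; rewrite l0; apply: open_nbhs_nbhs; split; first exact: open_image.
  by exists Z.1.
exists (fun t => param Z.1 c (l t)); split.
- by rewrite l0 param_coord.
- by apply: filterS im => t /(coord_param Z.1) [].
- apply: (is_diff_is_derive (near_is_diff _ dl)); last by rewrite scale1r.
  by apply: filterS im => t /(coord_param Z.1) [].
Qed.

Lemma velocity_uniq (c : chart N) (Z : tangent N) z (y : N) v :
  dom N c y -> velocity z Z -> z 0 = y ->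
  is_derive (0 : R) (1 : R) (fun t : R => coord N c (z t)) v ->
  Z.1 = y /\ tcoord c Z = v.
Proof.
move=> cy vz z0 dz; have Zy : Z.1 = y by case: vz => <-.
split=> //; rewrite -Zy in cy.
have [_ _ d2] := (velocity_chart aN pN z cy).1 vz.
exact: is_derive_uniq d2 dz.
Qed.

Lemma velocity_of_chart (c : chart N) z v : dom N c (z 0) ->
  (\forall t \near (0 : R), dom N c (z t)) ->
  is_derive (0 : R) (1 : R) (fun t : R => coord N c (z t)) v ->
  velocity z (z 0, v *m tr c (chart_at N (z 0)) (z 0)).
Proof.
move=> cz nz dz; apply/(velocity_chart aN pN z (d := c)) => //; split=> //.
rewrite /tcoord /= -mulmxA (tr_comp aN cz (pN _) cz) (tr_id aN cz) mulmx1.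
exact: dz.
Qed.

End Velocities.

Section JetAction.
Context {R : realType} {n m q : nat} (M : charted R n) (G : groupoid_over M m).
Context (P : charted R q) (pr : P -> M) (act : G -> P -> P).
Hypotheses (aP : smooth_atlas P) (pP : forall x : P, points x).

(* It suffices to compute the velocity in one chart, for all representatives. *)
Lemma jact_chart (c : chart P) (j : J1 G) (Z : tangent P) y v : is_jet j -> dom P c y ->
  (forall b z, represents b j -> velocity z Z ->
    let f t := act (b (pr (z t))) (z t) in
    [/\ f 0 = y, \forall t \near (0 : R), dom P c (f t) &
      is_derive (0 : R) (1 : R) (fun t : R => coord P c (f t)) v]) ->
  (jact pr act j Z).1 = y /\ tcoord c (jact pr act j Z) = v.
Proof.
move=> [b0 hb0] cy H; have [z0 hz0] := velocity_exists aP pP Z.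
rewrite /jact; set S := [set W | _].
have [W SW] : exists W, S W.
  have [f0 nf df] := H b0 z0 hb0 hz0.
  eexists; exists b0, z0; split; [exact: hb0|exact: hz0|].
  by apply: (velocity_of_chart aP pP _ nf df); rewrite f0.
have [b [z [hb hz hv]]] : S (@xget {classic tangent P} Z S) by exact: xgetI SW.
have [f0 nf df] := H b z hb hz.
exact: (velocity_uniq aP pP cy hv f0 df).
Qed.

End JetAction.

Section FirstAction.
Context {R : realType} {n : nat} (M : charted R n).
Hypotheses (aM : smooth_atlas M) (pM : forall x : M, points x).
Let cM (x : M) : dom M (chart_at M x) x := pM x.
Let TM := tangent M.
Let aT : smooth_atlas TM := tangent_atlas aM pM.
Let pT (X : TM) : points X := pM X.1.

Lemma tcoord_act1 c d (xi : B1 M) (X : TM) : X.1 = lsrc xi -> dom M c (lsrc xi) ->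
  dom M d (ltgt xi) -> tcoord d (act1 xi X) = tcoord c X *m loc c d xi.
Proof.
move=> e cx dx; rewrite /tcoord /loc /act1 e !mulmxA.
by rewrite -[X in _ = X *m _ *m _]mulmxA (tr_comp aM (cM _) cx (cM _)) (tr_id aM (cM _)) mulmx1.
Qed.

(* the action of a jet with coordinates [row_mx 1 (row_mx P Q)] over the      *)
(* linear map [A] on the vector [(V, W)] at [(u, X)]                          *)
Definition act_formula (A P : 'M[R]_n) (Q : 'M[R]_(n, n * n)) (X V W : 'rV[R]_n) :
    'rV[R]_(n + n) :=
  row_mx (V *m P) (W *m A + X *m vec_mx (V *m Q)).

(** In charts the curve is (target of b(u_t), X_t A(u_t)), with (u_t, X_t) of velocity (V, W): the
    first entry has derivative V P, and the product rule gives the second. *)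
Lemma act2_chart c d (j : B11nh M) P Q (Z : T2 M) : is_jet j ->
  Z.1.1 = src j -> dom M c (src j) -> dom M d (tgt j) ->
  jmx1 c d j = row_mx 1%:M (row_mx P Q) ->
  (act2 j Z).1 = act1 (jp j) Z.1 /\
  @tcoord _ _ TM d (act2 j Z) = act_formula (loc c d (jp j)) P Q (tcoord c Z.1)
    (lsubmx (@tcoord _ _ TM c Z)) (rsubmx (@tcoord _ _ TM c Z)).
Proof.
move=> ij Zj cj dj jPQ; apply: (jact_chart aT pT ij) => [|b z rb vz f].
  exact: dj.
have [bj nb dB] := represents_is_diff aM pM rb cj dj.
have cZ : dom TM c Z.1 by rewrite -[dom TM c Z.1]/(dom M c Z.1.1) Zj.
have [z0 nz dz] := (velocity_chart aT pT z cZ).1 vz.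
have cz : {for 0, continuous (fun t : R => coord TM c (z t))} := is_derive_continuous dz.
pose u0 := coord M c (src j).
pose w (t : R) := coord TM c (z t).
pose F u := coord (B1 M) (c, d) (b (param (src j) c u)).
have w0 : w 0 = row_mx u0 (tcoord c Z.1) by rewrite /w z0 coord_tangent Zj.
have dw : is_diff (0 : R) w (fun h => h *: @tcoord _ _ TM c Z) := is_derive_is_diff dz.
have du := is_diff_lsubmx dw; have dX := is_diff_rsubmx dw.
have lu0 : lsubmx (w 0) = u0 by rewrite w0 row_mxKl.
have dFu := is_diff_chain_at (f := fun t => lsubmx (w t)) (g := F) lu0 du dB.
have cu : {for 0, continuous (fun t => lsubmx (w t))}.
  exact: is_diff_continuous du.
have nu : \forall t \near (0 : R), [/\ dom M d (tgt (b (param (src j) c (lsubmx (w t)))))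
   & src (b (param (src j) c (lsubmx (w t)))) = param (src j) c (lsubmx (w t))].
  apply: (near_continuous (Q := fun u => dom M d (tgt (b (param (src j) c u))) /\
    src (b (param (src j) c u)) = param (src j) c u) cu lu0).
  by apply: filterS nb => u [_ _ _ h1 h2]; exact: conj h1 h2.
have nf : \forall t \near (0 : R), dom TM d (f t) /\
    coord TM d (f t) = row_mx (lsubmx (rsubmx (F (lsubmx (w t)))))
      (rsubmx (w t) *m vec_mx (rsubmx (rsubmx (F (lsubmx (w t)))))).
  apply: (filterS2 _ _ nz nu) => t zt [h1 h2].
  have e1 : lsubmx (w t) = coord M c (z t).1 by rewrite /w coord_tangent row_mxKl.
  have e2 : rsubmx (w t) = tcoord c (z t) by rewrite /w coord_tangent row_mxKr.
  have e3 : param (src j) c (lsubmx (w t)) = (z t).1.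
    by rewrite e1; exact: param_coord.
  rewrite /F e3 in h1 h2 *; split; first exact: h1.
  rewrite e2 coord_tangent coord_B1 !row_mxKr row_mxKl mxvecK.
  congr (row_mx _ _); apply: tcoord_act1; [exact/esym/h2| |exact: h1].
  by rewrite -[lsrc _]/(src (b (z t).1)) h2.
split.
- by rewrite /f z0 -[tproj _]/(Z.1.1) Zj bj.
- by apply: filterS nf => t [].
have FuE : F u0 = coord (B1 M) (c, d) (jp j).
  by rewrite /F /u0 (param_coord aM _ cj) bj.
have D := is_diff_row_mx (is_diff_lsubmx (is_diff_rsubmx dFu))
  (is_diff_mulmx dX (is_diff_vec_mx (is_diff_rsubmx (is_diff_rsubmx dFu)))).
apply: (is_diff_is_derive (near_is_diff _ D)).
  by apply: filterS nf => t [_ ->].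
have rw0 : rsubmx (w 0) = tcoord c Z.1 by rewrite w0 row_mxKr.
have FuE2 : vec_mx (rsubmx (rsubmx (F u0))) = loc c d (jp j).
  by rewrite FuE coord_B1 !row_mxKr mxvecK.
have jv (v : 'rV_n) : mulmxr (jmx1 c d j) v = row_mx v (row_mx (v *m P) (v *m Q)).
  by rewrite /= jPQ !mul_mx_row mulmx1.
by rewrite lu0 FuE2 rw0 scale1r jv !row_mxKr row_mxKl.
Qed.

End FirstAction.

Section CurveRules.
Context {R : realType}.
Local Notation deriv f v := (is_derive (0 : R) (1 : R) f v).

Lemma deriv_chain (V W : normedModType R) (g : R -> V) v (F dF : V -> W) x :
  deriv g v -> g 0 = x -> is_diff x F dF -> deriv (fun t => F (g t)) (dF v).
Proof.
move=> dg e dFx; have K := is_diff_chain_at e (is_derive_is_diff dg) dFx.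
by apply: (is_diff_is_derive K); rewrite scale1r.
Qed.

Lemma deriv_lsubmx p q r (f : R -> 'M[R]_(p, q + r)) v :
  deriv f v -> deriv (fun t => lsubmx (f t)) (lsubmx v).
Proof.
by move=> h; apply: (is_diff_is_derive (is_diff_lsubmx (is_derive_is_diff h))); rewrite scale1r.
Qed.

Lemma deriv_rsubmx p q r (f : R -> 'M[R]_(p, q + r)) v :
  deriv f v -> deriv (fun t => rsubmx (f t)) (rsubmx v).
Proof.
by move=> h; apply: (is_diff_is_derive (is_diff_rsubmx (is_derive_is_diff h))); rewrite scale1r.
Qed.

Lemma deriv_vec_mx p q (f : R -> 'rV[R]_(p * q)) v :
  deriv f v -> deriv (fun t => vec_mx (f t)) (vec_mx v).
Proof.
by move=> h; apply: (is_diff_is_derive (is_diff_vec_mx (is_derive_is_diff h))); rewrite scale1r.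
Qed.

Lemma deriv_row_mx p q r (f : R -> 'M[R]_(p, q)) (g : R -> 'M[R]_(p, r)) v w :
  deriv f v -> deriv g w -> deriv (fun t => row_mx (f t) (g t)) (row_mx v w).
Proof.
move=> h k.
apply: (is_diff_is_derive (is_diff_row_mx (is_derive_is_diff h) (is_derive_is_diff k))).
by rewrite !scale1r.
Qed.

Lemma deriv_add (V : normedModType R) (f g : R -> V) v w :
  deriv f v -> deriv g w -> deriv (fun t => f t + g t) (v + w).
Proof. exact: is_deriveD. Qed.

Lemma deriv_mulmx p q r (f : R -> 'M[R]_(p, q)) (g : R -> 'M[R]_(q, r)) v w A B :
  deriv f v -> deriv g w -> f 0 = A -> g 0 = B ->
  deriv (fun t => f t *m g t) (v *m B + A *m w).
Proof.
move=> h k <- <-.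
apply: (is_diff_is_derive (is_diff_mulmx (is_derive_is_diff h) (is_derive_is_diff k))).
by rewrite !scale1r.
Qed.

Lemma deriv_near (V : normedModType R) (f g : R -> V) v :
  (\forall t \near (0 : R), f t = g t) -> deriv f v -> deriv g v.
Proof. exact: near_eq_is_derive. Qed.

End CurveRules.

Section SecondAction.
Context {R : realType} {n : nat} (M : charted R n).
Hypotheses (aM : smooth_atlas M) (pM : forall x : M, points x).
Let cM (x : M) : dom M (chart_at M x) x := pM x.
Let TM := tangent M.
Let aT : smooth_atlas TM := tangent_atlas aM pM.
Let pT (X : TM) : points X := pM X.1.
Let TTM := tangent TM.
Let aTT : smooth_atlas TTM := tangent_atlas aT pT.
Let pTT (X : TTM) : points X := pM X.1.1.

Lemma jet2_is_jet (k : B111nh M) : is_jet k -> is_jet (jp k).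
Proof.
move=> [b [[_ sb _ _] bx ek]]; have := sb.1 _ bx.
by rewrite (_ : b _ = k.1); [case|rewrite {2}ek].
Qed.

Lemma represents2_is_diff b (k : B111nh M) (x := src k) (c := chart_at M x)
  (d := chart_at M (tgt k)) : represents b k ->
  [/\ b x = jp k,
      \forall u \near coord M c x, [/\ is_jet (b (param x c u)),
        src (b (param x c u)) = param x c u, dom M c (param x c u) &
        dom M d (tgt (b (param x c u)))]
    & is_diff (coord M c x) (fun u => coord (B11nh M) (c, (c, d)) (b (param x c u)))
        (mulmxr k.2)].
Proof.
move=> [lb bx ek]; have [ob sb bs _] := lb.
have e1 : b x = k.1 := esym (congr1 fst ek).
have e2 : k.2 = jac b x := congr1 snd ek.
have cx : dom M c x := cM x.
have dk : dom (B11nh M) (c, (c, d)) (b x).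
  have ij : is_jet (b x) by case: (sb.1 _ bx).
  rewrite e1 in ij *; exact: (And3 ij cx (And3 (jet_unit ij) cx (cM (tgt k)))).
have K := smooth_on_chart_diff aM sb bx cx dk.
have [_ _ nd _] := K.
split; first exact: e1.
  have no := open_in_near aM ob bx cx.
  apply: filterS2 nd no => u [i1 i2 [_ i3 i4]] bu.
  by split; [exact: i1|exact: bs|rewrite -(bs _ bu)|exact: i4].
have E : @jacin _ _ _ M (B11nh M) c (c, (c, d)) b x = k.2 by rewrite e2 jac_jacin e1.
by rewrite -E; exact: is_diff_jacin K.
Qed.

(* derivative of [act_formula] along a curve of jets and vectors *)
Definition dact_formula (A A' P P' : 'M[R]_n) (Q Q' : 'M[R]_(n, n * n))
    (X X' V V' W W' : 'rV[R]_n) : 'rV[R]_(n + n) :=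
  row_mx (V' *m P + V *m P')
    (W' *m A + W *m A' + (X' *m vec_mx (V *m Q) + X *m vec_mx (V' *m Q + V *m Q'))).

(** One more differentiation of [act2_chart], with [P], [Q] and the linear map now varying along the
    bisection. The block 0 in the differential reflects that the source block is constantly 1. *)
Lemma act3E (k : B111nh M) (P P1 : 'M[R]_n) (Q C1 L1 : 'M[R]_(n, n * n))
    (L2 : 'M[R]_(n, n * (n * n))) (Z : T3 M) : is_jet k ->
  jmx1 (chart_at M (src k)) (chart_at M (tgt k)) (jp k) = row_mx 1%:M (row_mx P Q) ->
  (forall v, v *m k.2 =
    row_mx (row_mx v (row_mx (v *m P1) (v *m C1)))
      (mxvec (row_mx 0 (row_mx (vec_mx (v *m L1)) (vec_mx (v *m L2)))))) ->
  T3base Z = src k ->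
  let A := lmx (jp (jp k)) in let V2 := lsubmx (lsubmx Z.2) in
  let X := Z.1.1.2 in let X' := rsubmx (lsubmx Z.2) in
  act3 k Z =
    ((act1 (jp (jp k)) Z.1.1, act_formula A P Q X (lsubmx Z.1.2) (rsubmx Z.1.2)),
     row_mx (row_mx (V2 *m P1) (X' *m A + X *m vec_mx (V2 *m C1)))
       (dact_formula A (vec_mx (V2 *m C1)) P (vec_mx (V2 *m L1)) Q (vec_mx (V2 *m L2))
          X X' (lsubmx Z.1.2) (lsubmx (rsubmx Z.2)) (rsubmx Z.1.2) (rsubmx (rsubmx Z.2)))).
Proof.
move=> ik kPQ kD Zk A V2 X X'.
set x := src k; set c := chart_at M x; set d := chart_at M (tgt k).
rewrite -/x -/c -/d in kPQ Zk.
have cx : dom M c x := cM x; have dy : dom M d (tgt k) := cM _.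
have ij := jet2_is_jet ik.
have [a1 a2] := act2_chart aM pM ij Zk cx dy kPQ.
have Zc (Y : TM) : Y.1 = x -> tcoord c Y = Y.2.
  by move=> e; rewrite /c -e; exact: tcoord_at.
have ZTc (Y : TTM) : Y.1.1 = x -> @tcoord _ _ TM c Y = Y.2.
  by move=> e; rewrite /c -e; exact: (tcoord_at aT pT).
have ZTTc (Y : T3 M) : Y.1.1.1 = x -> @tcoord _ _ TTM c Y = Y.2.
  by move=> e; rewrite /c -e; exact: (tcoord_at aTT pTT).
have AE : loc c d (jp (jp k)) = A.
  by rewrite /loc (tr_id aM cx) (tr_id aM dy) mul1mx mulmx1.
pose y : TTM := act2 (jp k) Z.1.
have ye : y = (act1 (jp (jp k)) Z.1.1, act_formula A P Q X (lsubmx Z.1.2) (rsubmx Z.1.2)).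
  rewrite [LHS]surjective_pairing -/(act2 _ _); congr pair; first exact: a1.
  rewrite -(ZTc Z.1 Zk) -AE -[X](Zc Z.1.1 Zk) -a2.
  rewrite -(tcoord_at aT pT y); congr (tcoord _ _).
  by rewrite a1.
have y11 : y.1.1 = tgt k by rewrite ye.
pose v := row_mx (row_mx (V2 *m P1) (X' *m A + X *m vec_mx (V2 *m C1)))
       (dact_formula A (vec_mx (V2 *m C1)) P (vec_mx (V2 *m L1)) Q (vec_mx (V2 *m L2))
          X X' (lsubmx Z.1.2) (lsubmx (rsubmx Z.2)) (rsubmx Z.1.2) (rsubmx (rsubmx Z.2))).
suff [w1 w2] : (act3 k Z).1 = y /\ @tcoord _ _ TTM d (act3 k Z) = v.
  rewrite -ye [LHS]surjective_pairing w1; congr pair; rewrite -/v -w2.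
  rewrite -(tcoord_at aTT pTT (act3 k Z)) w1; congr (tcoord _ _).
  by rewrite -[chart_at TTM y]/(chart_at M y.1.1) y11.
apply: (jact_chart aTT pTT ik) => [|b z rb vz f].
  by rewrite -[dom TTM d y]/(dom M d y.1.1) y11.
have [bx nb dF] := represents2_is_diff rb.
rewrite -/x -/c -/d in bx nb dF.
have cZ : dom TTM c Z.1 by rewrite -[dom TTM c Z.1]/(dom M c Z.1.1.1) [Z.1.1.1]Zk.
have [z0 nz dz] := (velocity_chart aTT pTT z cZ).1 vz.
rewrite (ZTTc Z Zk) in dz.
pose u0 := coord M c x.
pose w (t : R) := coord TTM c (z t).
have w0 : w 0 = row_mx (row_mx u0 X) Z.1.2.
  rewrite /w z0 coord_tangent (ZTc Z.1 Zk) coord_tangent (Zc Z.1.1 Zk).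
  by rewrite [Z.1.1.1]Zk.
pose uT t := lsubmx (lsubmx (w t)); pose XT t := rsubmx (lsubmx (w t)).
pose VT t := lsubmx (rsubmx (w t)); pose WT t := rsubmx (rsubmx (w t)).
have du : is_derive (0 : R) (1 : R) uT V2 := deriv_lsubmx (deriv_lsubmx dz).
have dX : is_derive (0 : R) (1 : R) XT X' := deriv_rsubmx (deriv_lsubmx dz).
have dV : is_derive (0 : R) (1 : R) VT (lsubmx (rsubmx Z.2)) := deriv_lsubmx (deriv_rsubmx dz).
have dW : is_derive (0 : R) (1 : R) WT (rsubmx (rsubmx Z.2)) := deriv_rsubmx (deriv_rsubmx dz).
have uT0 : uT 0 = u0 by rewrite /uT w0 !row_mxKl.
have XT0 : XT 0 = X by rewrite /XT w0 row_mxKl row_mxKr.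
have VT0 : VT 0 = lsubmx Z.1.2 by rewrite /VT w0 row_mxKr.
have WT0 : WT 0 = rsubmx Z.1.2 by rewrite /WT w0 row_mxKr.
pose F u := coord (B11nh M) (c, (c, d)) (b (param x c u)).
have dFu : is_derive (0 : R) (1 : R) (fun t => F (uT t)) (V2 *m k.2) := deriv_chain du uT0 dF.
pose FT t := F (uT t).
pose yT t := lsubmx (rsubmx (lsubmx (FT t))).
pose AT t : 'M[R]_n := vec_mx (rsubmx (rsubmx (lsubmx (FT t)))).
pose GT t : 'M[R]_(n, n + (n + n * n)) := vec_mx (rsubmx (FT t)).
pose PT t := lsubmx (rsubmx (GT t)); pose QT t := rsubmx (rsubmx (GT t)).
rewrite kD in dFu.
have dy' : is_derive (0 : R) (1 : R) yT (V2 *m P1).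
  by have := deriv_lsubmx (deriv_rsubmx (deriv_lsubmx dFu)); rewrite row_mxKl row_mxKr row_mxKl.
have dA : is_derive (0 : R) (1 : R) AT (vec_mx (V2 *m C1)).
  have := deriv_vec_mx (deriv_rsubmx (deriv_rsubmx (deriv_lsubmx dFu))).
  by rewrite row_mxKl !row_mxKr.
have dG : is_derive (0 : R) (1 : R) GT (row_mx 0 (row_mx (vec_mx (V2 *m L1)) (vec_mx (V2 *m L2)))).
  by have := deriv_vec_mx (deriv_rsubmx dFu); rewrite row_mxKr mxvecK.
have dP : is_derive (0 : R) (1 : R) PT (vec_mx (V2 *m L1)).
  by have := deriv_lsubmx (deriv_rsubmx dG); rewrite row_mxKr row_mxKl.
have dQ : is_derive (0 : R) (1 : R) QT (vec_mx (V2 *m L2)).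
  by have := deriv_rsubmx (deriv_rsubmx dG); rewrite !row_mxKr.
have FE u : is_jet (b (param x c u)) -> dom M c (src (b (param x c u))) ->
   dom M d (tgt (b (param x c u))) -> F u = row_mx (coord (B1 M) (c, d) (jp (b (param x c u))))
     (mxvec (jmx1 c d (b (param x c u)))).
  by move=> h1 h2 h3; exact: (coord_B11 aM pM h1 h2 h2 h3).
have F0 : F u0 = row_mx (coord (B1 M) (c, d) (jp (jp k))) (mxvec (jmx1 c d (jp k))).
  by have := FE u0; rewrite /u0 (param_coord aM _ cx) bx; apply.
have AT0 : AT 0 = A.
  by rewrite /AT /FT uT0 F0 row_mxKl coord_B1 !row_mxKr mxvecK AE.
have GT0 : GT 0 = row_mx 1%:M (row_mx P Q) by rewrite /GT /FT uT0 F0 row_mxKr mxvecK kPQ.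
have PT0 : PT 0 = P by rewrite /PT GT0 row_mxKr row_mxKl.
have QT0 : QT 0 = Q by rewrite /QT GT0 !row_mxKr.
have nu := near_continuous (is_derive_continuous du) uT0 nb.
(* Near 0 the value of the bisection is itself a jet with source block 1, so [act2_chart] applies to
   it and writes the whole curve in terms of the curves [yT], [AT], [PT], [QT]. *)
have nf : \forall t \near (0 : R), dom TTM d (f t) /\
    row_mx (row_mx (yT t) (XT t *m AT t)) (act_formula (AT t) (PT t) (QT t) (XT t) (VT t) (WT t))
    = coord TTM d (f t).
  apply: (filterS2 _ _ nz nu) => t zt [h1 h2 h3 h4].
  have wt : w t = row_mx (row_mx (coord M c (z t).1.1) (tcoord c (z t).1)) (@tcoord _ _ TM c (z t)).
    by rewrite /w !coord_tangent.
  have e1 : uT t = coord M c (z t).1.1 by rewrite /uT wt !row_mxKl.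
  have e2 : XT t = tcoord c (z t).1 by rewrite /XT wt row_mxKl row_mxKr.
  have e3 : VT t = lsubmx (@tcoord _ _ TM c (z t)) by rewrite /VT wt row_mxKr.
  have e4 : WT t = rsubmx (@tcoord _ _ TM c (z t)) by rewrite /WT wt row_mxKr.
  have e5 : param x c (uT t) = (z t).1.1 by rewrite e1; exact: param_coord.
  have h2' : dom M c (src (b (param x c (uT t)))) by rewrite h2.
  have FtE := FE _ h1 h2' h4.
  rewrite e5 in h1 h2 h3 h4 FtE.
  have ft : f t = act2 (b (z t).1.1) (z t) by [].
  set jt := b (z t).1.1 in h1 h2 h4 FtE ft.
  have AtE : AT t = loc c d (jp jt) by rewrite /AT /FT FtE row_mxKl coord_B1 !row_mxKr mxvecK.
  have GtE : GT t = jmx1 c d jt by rewrite /GT /FT FtE row_mxKr mxvecK.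
  have ytE : yT t = coord M d (tgt jt) by rewrite /yT /FT FtE row_mxKl coord_B1 row_mxKr row_mxKl.
  rewrite -h2 in h3.
  have jtPQ : jmx1 c d jt = row_mx 1%:M (row_mx (PT t) (QT t)).
    by rewrite -(jmx_src_block aM pM h1 h3 h4) -GtE /PT /QT !hsubmxK.
  have [b1 b2] := act2_chart aM pM h1 (esym h2) h3 h4 jtPQ.
  rewrite ft; split; first by rewrite -[dom TTM d _]/(dom M d (act2 jt (z t)).1.1) b1.
  rewrite coord_tangent b2 b1 coord_tangent e2 e3 e4 AtE ytE; congr (row_mx (row_mx _ _) _).
  exact/esym/(tcoord_act1 aM pM (esym h2) h3 h4).
split.
- by rewrite /f z0 -[tproj _]/(T3base Z) Zk bx.
- by apply: filterS nf => t [].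
apply: (@deriv_near _ _ (fun t => row_mx (row_mx (yT t) (XT t *m AT t))
   (act_formula (AT t) (PT t) (QT t) (XT t) (VT t) (WT t)))).
  by apply: filterS nf => t [].
have r1 := deriv_mulmx dX dA XT0 AT0.
have r2 := deriv_mulmx dV dP VT0 PT0.
have r3 := deriv_mulmx dW dA WT0 AT0.
have VQ0 : vec_mx (VT 0 *m QT 0) = vec_mx (lsubmx Z.1.2 *m Q) by rewrite VT0 QT0.
have r4 := deriv_mulmx dX (deriv_vec_mx (deriv_mulmx dV dQ VT0 QT0)) XT0 VQ0.
exact: (deriv_row_mx (deriv_row_mx dy' r1) (deriv_row_mx r2 (deriv_add r3 r4))).
Qed.

End SecondAction.

(** * The connection in charts *)

Section Fields.
Context {R : realType} {n : nat} (M : charted R n).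
Hypotheses (aM : smooth_atlas M) (pM : forall x : M, points x).
Let cM (x : M) : dom M (chart_at M x) x := pM x.
Implicit Types (X Y : vfield M).

Fact vin_def : {v : chart M -> vfield M -> M -> 'rV[R]_n |
  v = fun c Y x => tcoord c (vsec Y x)}.
Proof. by eexists. Qed.

(* components of a vector field in the chart [c], at a point and as a         *)
(* function of the coordinates                                                *)
Definition vin : chart M -> vfield M -> M -> 'rV[R]_n := sval vin_def.

Lemma vin_tcoord c Y x : vin c Y x = tcoord c (vsec Y x).
Proof. by rewrite /vin (svalP vin_def). Qed.

Definition vfun c x Y (u : 'rV[R]_n) : 'rV[R]_n := vin c Y (param x c u).

Lemma vinE c Y x : vin c Y x = Y x *m tr (chart_at M x) c x.
Proof. by rewrite vin_tcoord. Qed.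

Lemma vcompE x Y : vcomp x Y = vfun (chart_at M x) x Y.
Proof. by apply/funext => u; rewrite /vcomp coord_tangent row_mxKr /vfun vin_tcoord. Qed.

Lemma vfun_coord c x Y : dom M c x -> vfun c x Y (coord M c x) = vin c Y x.
Proof. by move=> cx; rewrite /vfun param_coord. Qed.

Lemma vfield_smooth (U : set M) Y c : smooth_vfield U Y -> exists W,
  [/\ open W, forall x, U x -> dom M c x -> W (coord M c x) &
      forall x, smooth W (vfun c x Y)].
Proof.
move=> [_ sY]; have [oW sW] := sY c c; eexists; split; first exact: oW.
  by move=> x Ux cx; exists x.
move=> x; have S := smooth_lin rsubmx oW (proj1 (CinftyE _ _) (sW x)).
by apply: smooth_eq oW _ S => u _; rewrite -[LHS]/(rsubmx (coord (tangent M) c (vsec Y (param x c u)))) coord_tangent row_mxKr /vfun vin_tcoord.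
Qed.

Lemma vfield_differentiable (U : set M) Y c x : smooth_vfield U Y -> U x -> dom M c x ->
  differentiable (vfun c x Y) (coord M c x).
Proof.
move=> /(vfield_smooth c) [W [oW WU sW]] Ux cx.
exact: smooth_differentiable (sW x) (WU x Ux cx).
Qed.

Definition const_field c (v : 'rV[R]_n) : vfield M := fun x => v *m tr c (chart_at M x) x.

Lemma vin_const c v x : dom M c x -> vin c (const_field c v) x = v.
Proof.
by move=> cx; rewrite vinE -mulmxA (tr_comp aM cx (cM _) cx) (tr_id aM cx) mulmx1.
Qed.

Lemma const_field_smooth c v : smooth_vfield (dom M c) (const_field c v).
Proof.
apply: (smooth_on_local aM (smooth_atlas_extendable (tangent_atlas aM pM))) => x cx.
  exact: cM.
exists c, c, (coord M c @` dom M c), (fun u => row_mx u v); split.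
- exact: cx.
- exact: open_image.
- by exists x.
- apply: smooth_row_mx; [exact: open_image|exact: smooth_id|exact: smooth_const].
- move=> y cy _; split; [exact: cy|exact: cy|].
  by rewrite coord_tangent -vin_tcoord vin_const.
Qed.

Lemma open_in_dom c : open_in (dom M c).
Proof.
apply: (open_in_local aM) => x cx; exists c, (coord M c @` dom M c); split.
- exact: cx.
- exact: open_image.
- by exists x.
- by [].
Qed.

(* The second derivatives of the transition do not contribute where the field *)
(* vanishes.                                                                  *)
Lemma vfun_change_zero c a x Y h : dom M c x -> dom M a x ->
  differentiable (vfun c x Y) (coord M c x) -> vin c Y x = 0 ->
  'd (vfun a x Y) (coord M a x) h =
  'd (vfun c x Y) (coord M c x) (h *m tr a c x) *m tr c a x.
Proof.
move=> cx ax dY Y0.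
have dT := is_diff_transition aM x ax cx.
have Tx : coord M c (param x a (coord M a x)) = coord M c x by rewrite param_coord.
pose J u := 'J (fun u => coord M a (param x c u)) u.
have sJ : smooth (overlap c a) J.
  exact: (smooth_jacobian (open_overlap aM c a) (smooth_transition aM x c a)).
have dJ := smooth_is_diff sJ (overlap_coord cx ax).
have K1 := is_diff_chain_at Tx dT (differentiableP dY).
have K2 := is_diff_chain_at Tx dT dJ.
have K := is_diff_mulmx K1 K2.
have L : is_diff (coord M a x) (vfun a x Y) (fun v =>
   'd (vfun c x Y) (coord M c x) (v *m tr a c x) *m tr c a x).
  apply: (is_diff_ext (f := vfun a x Y) (near_is_diff _ K)) => //.
    near=> u; have [y [ay cy] <-] : overlap a c u by near: u; exact: near_overlap.
    rewrite /vfun !(param_coord aM x ay) (param_coord aM x cy) /J -(trE aM x cy ay).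
    by rewrite !vin_tcoord -(tcoord_tr aM pM (X := vsec Y y) cy ay).
  move=> v /=; rewrite Tx (vfun_coord _ cx) Y0 mul0mx addr0 /J.
  by rewrite -(trE aM x cx ax).
exact: is_diffE L.
Unshelve. all: by end_near. Qed.

(** The left inverse [g] makes the base map injective on the domain, so the partial inverse used by
    [pushfield] coincides with [g] on the image. *)
Lemma pushfield_act (b : local_section (B1 M)) g Y z :
  (forall x, ldom b x -> g (base_map b x) = x) -> (base_map b @` ldom b) z ->
  ldom b (g z) /\ vsec (pushfield b Y) z = act1 (b (g z)) (vsec Y (g z)).
Proof.
move=> gb im; have [x bx e] := im; have gz : g z = x by rewrite -e gb.
have E : 'pinv_(fun=> z) (ldom b) (base_map b) z = x.
  rewrite -e; apply: pinvKV; last by rewrite inE.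
  by move=> x1 x2; rewrite !inE => h1 h2 h12; rewrite -(gb x1 h1) h12 gb.
split; first by rewrite gz.
rewrite gz /vsec /pushfield E [RHS]surjective_pairing; congr pair.
by rewrite -e.
Qed.

(** In charts the field bY is v |-> Y(gam v) A(gam v), where [gam] is the inverse of the base map.
    The Jacobian of [gam] is inverse to [P], so evaluating the differential at [v *m P] leaves no
    inverse matrix in the result. *)
Lemma push_deriv b (j : B11nh M) c d (P : 'M[R]_n) Q Y : represents b j ->
  dom M c (src j) -> dom M d (tgt j) -> P \in unitmx ->
  jmx1 c d j = row_mx 1%:M (row_mx P Q) ->
  differentiable (vfun c (src j) Y) (coord M c (src j)) ->
  [/\ vin d (pushfield b Y) (tgt j) = vin c Y (src j) *m loc c d (jp j),
      differentiable (vfun d (tgt j) (pushfield b Y)) (coord M d (tgt j)) &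
      forall v, 'd (vfun d (tgt j) (pushfield b Y)) (coord M d (tgt j)) (v *m P) =
        'd (vfun c (src j) Y) (coord M c (src j)) v *m loc c d (jp j)
        + vin c Y (src j) *m vec_mx (v *m Q)].
Proof.
move=> rb cx dy uP jPQ dY; set x := src j in cx dY *; set y := tgt j in dy *.
have [lb bx ej] := rb; have [ob sb bs [sbb oim [g sg gb]]] := lb.
have [bj nb dB] := represents_is_diff aM pM rb cx dy.
rewrite -/x in bx bj nb dB.
have by' : base_map b x = y by rewrite /base_map bj.
have imy : (base_map b @` ldom b) y by exists x.
have gy : g y = x by rewrite -by' gb.
have cgy : dom M c (g y) by rewrite gy.
have gd : chart_diff d c g y := smooth_on_chart_diff aM sg imy dy cgy.
have [_ _ ngc _] := gd.
have dg := is_diff_jacin gd; set G := jacin _ _ _ _ in dg.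
pose gam v := coord M c (g (param y d v)).
have gamy : gam (coord M d y) = coord M c x by rewrite /gam param_coord // gy.
have nz : \forall v \near coord M d y, [/\ (base_map b @` ldom b) (param y d v),
   dom M d (param y d v) & dom M c (g (param y d v))].
  near=> v; split.
  - by near: v; exact: open_in_near.
  - by near: v; exact: near_dom.
  - by near: v.
have PG : P *m G = 1%:M.
  have [fb E] := base_map_jacin aM pM rb cx dy.
  have dal := is_diff_jacin fb; rewrite E jPQ row_mxKr row_mxKl in dal.
  have e1 : coord M d (base_map b (param x c (coord M c x))) = coord M d y.
    by rewrite (param_coord aM x cx) by'.
  have K := is_diff_chain_at e1 dal dg.
  have K2 : is_diff (coord M c x) id (fun v => v *m P *m G).
    apply: (near_is_diff _ K).
    have [_ _ nd _] := fb.
    apply: (filterS2 _ _ nb nd) => u [h1 h2 h3 h4 h5] h6.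
    by rewrite (param_coord aM y h6) gb.
  apply: eq_mulmx_rV => v; rewrite mulmx1 mulmxA.
  by have /(congr1 (@^~ v)) := is_diff_uniq K2 (is_diff_id (coord M c x)).
pose B u := coord (B1 M) (c, d) (b (param x c u)).
have dgam : is_diff (coord M d y) gam (mulmxr G) := dg.
have KB := is_diff_vec_mx (is_diff_rsubmx (is_diff_rsubmx (is_diff_chain_at (g := B) gamy dgam dB))).
have KY := is_diff_chain_at gamy dgam (differentiableP dY).
have K := is_diff_mulmx KY KB.
have E v : (base_map b @` ldom b) (param y d v) -> dom M d (param y d v) ->
    dom M c (g (param y d v)) ->
    vfun c x Y (gam v) *m vec_mx (rsubmx (rsubmx (B (gam v)))) = vfun d y (pushfield b Y) v.
  move=> imv dv cv; have [b1 b2] := pushfield_act Y gb imv.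
  rewrite /vfun !vin_tcoord b2 /B /gam !(param_coord aM x cv) coord_B1 !row_mxKr mxvecK.
  have s1 := bs _ b1.
  have t1 : tgt (b (g (param y d v))) = param y d v.
    have [x1 b3 e3] := imv; rewrite -[LHS]/(base_map b _); rewrite -{2}e3 -e3.
    by rewrite gb.
  apply/esym/(tcoord_act1 aM pM (xi := b (g (param y d v)))).
  - exact/esym/s1.
  - by rewrite -[lsrc _]/(src (b (g (param y d v)))) s1.
  - by rewrite -[ltgt _]/(tgt (b (g (param y d v)))) t1.
have nE : \forall v \near coord M d y, vfun c x Y (gam v) *m
    vec_mx (rsubmx (rsubmx (B (gam v)))) = vfun d y (pushfield b Y) v.
  by apply: filterS nz => v [h1 h2 h3]; exact: E.
have L := near_is_diff nE K.
have pdy : param y d (coord M d y) = y by rewrite param_coord.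
have Bx : vec_mx (rsubmx (rsubmx (B (coord M c x)))) = loc c d (jp j).
  by rewrite /B (param_coord aM x cx) bj coord_B1 !row_mxKr mxvecK.
split.
- rewrite -(vfun_coord _ dy) -E ?pdy ?gy //.
  by rewrite gamy (vfun_coord _ cx) Bx.
- exact: is_diff_ex L.
- move=> v; have vc := vfun_coord Y cx.
  etransitivity; first exact: is_diffE L.
  rewrite gamy Bx vc.
  have vPG : mulmxr G (v *m P) = v by rewrite /= -mulmxA PG mulmx1.
  have jv (w : 'rV_n) : mulmxr (jmx1 c d j) w = row_mx w (row_mx (w *m P) (w *m Q)).
    by rewrite /= jPQ !mul_mx_row mulmx1.
  by rewrite vPG jv !row_mxKr.
Unshelve. all: by end_near. Qed.

End Fields.

Arguments open_in_dom {R n M} aM c.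
Arguments const_field_smooth {R n M} aM pM c v.

Section Connection.
Context {R : realType} {n : nat} (M : charted R n).
Hypotheses (aM : smooth_atlas M) (pM : forall x : M, points x).
Let cM (x : M) : dom M (chart_at M x) x := pM x.
Context (s : M -> B11nh M).
Hypothesis hs : symmetry_jet s.
Implicit Types (X Y : vfield M).

Fact vder_def : {f : chart M -> M -> vfield M -> 'rV[R]_n -> 'rV[R]_n |
  f = fun c x Y v => 'd (vfun c x Y) (coord M c x) v}.
Proof. by eexists. Qed.

Definition vder : chart M -> M -> vfield M -> 'rV[R]_n -> 'rV[R]_n := sval vder_def.

Lemma vderE c x Y v : vder c x Y v = 'd (vfun c x Y) (coord M c x) v.
Proof. by rewrite /vder (svalP vder_def). Qed.

Lemma is_diff_vder c x Y : differentiable (vfun c x Y) (coord M c x) ->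
  is_diff (coord M c x) (vfun c x Y) (vder c x Y).
Proof.
move=> /differentiableP dY; apply: (is_diff_ext (f := vfun c x Y) dY) => // v.
exact/esym/vderE.
Qed.

Lemma is_diff_vderE c x Y D v : is_diff (coord M c x) (vfun c x Y) D -> vder c x Y v = D v.
Proof. by move=> h; rewrite vderE; exact: is_diffE h. Qed.

Lemma vder0 c x Y : vder c x Y 0 = 0.
Proof. by rewrite vderE; exact: linear0. Qed.

Lemma vderN c x Y v : vder c x Y (- v) = - vder c x Y v.
Proof. by rewrite !vderE; exact: linearN. Qed.

Lemma push_vder b (j : B11nh M) c d (P : 'M[R]_n) Q Y : represents b j ->
  dom M c (src j) -> dom M d (tgt j) -> P \in unitmx ->
  jmx1 c d j = row_mx 1%:M (row_mx P Q) ->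
  differentiable (vfun c (src j) Y) (coord M c (src j)) ->
  [/\ vin d (pushfield b Y) (tgt j) = vin c Y (src j) *m loc c d (jp j),
      differentiable (vfun d (tgt j) (pushfield b Y)) (coord M d (tgt j)) &
      forall v, vder d (tgt j) (pushfield b Y) (v *m P) =
        vder c (src j) Y v *m loc c d (jp j) + vin c Y (src j) *m vec_mx (v *m Q)].
Proof.
move=> rb cx dy uP J dY; have [p1 p2 p3] := push_deriv aM pM rb cx dy uP J dY.
split; [exact: p1|exact: p2|move=> v].
apply: etrans (vderE _ _ _ _) _; apply: etrans (p3 v) _.
exact: (congr1 (fun z => z *m _ + _) (esym (vderE _ _ _ _))).
Qed.

Lemma vder_change_zero c a x Y h : dom M c x -> dom M a x ->
  differentiable (vfun c x Y) (coord M c x) -> vin c Y x = 0 ->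
  vder a x Y h = vder c x Y (h *m tr a c x) *m tr c a x.
Proof.
move=> cx ax dY Y0; apply: etrans (vderE _ _ _ _) _.
apply: etrans (vfun_change_zero aM pM h cx ax dY Y0) _.
exact: (congr1 (mulmx^~ _) (esym (vderE _ _ _ _))).
Qed.

Lemma bracketE x X Y : bracket X Y x =
  vder (chart_at M x) x Y (vin (chart_at M x) X x) -
  vder (chart_at M x) x X (vin (chart_at M x) Y x).
Proof.
rewrite !vderE -(vfun_coord aM X (cM x)) -(vfun_coord aM Y (cM x)).
by rewrite -!vcompE.
Qed.

(* derivative, in the chart [c], of the linear part of the symmetry jet *)
Definition jet_deriv c (x : M) : 'M[R]_(n, n * n) := rsubmx (rsubmx (jmx1 c c (s x))).

(** The bisection s_x has linear part -1 and derivative Q at [x], so Y + s_x Y has derivative 2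
    DY(V) - Y Q_V there; half of it is DY(V) plus this term. *)
Definition christoffel c x (V X : 'rV[R]_n) : 'rV[R]_n :=
  - 2^-1 *: (X *m vec_mx (V *m jet_deriv c x)).

Lemma loc_homothety c (a : R) x : dom M c x -> loc c c (homothety a x : B1 M) = a%:M.
Proof.
move=> cx; rewrite /loc /= scalar_mxC -mulmxA (tr_comp aM cx (cM x) cx).
by rewrite (tr_id aM cx) mulmx1.
Qed.

Lemma symmetry_jetP x : [/\ B11sh (s x), jp (s x) = homothety (-1) x,
  src (s x) = x & tgt (s x) = x].
Proof.
have [h1 h2] := hs.2 x; split=> //.
  by rewrite -[src _]/(lsrc (jp (s x))) h2.
by rewrite -[tgt _]/(ltgt (jp (s x))) h2.
Qed.

Lemma symmetry_jmx c x : dom M c x ->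
  jmx1 c c (s x) = row_mx 1%:M (row_mx (-1)%:M (jet_deriv c x)).
Proof.
move=> cx; have [h1 h2 h3 h4] := symmetry_jetP x.
have cs : dom M c (src (s x)) by rewrite h3.
have ct : dom M c (tgt (s x)) by rewrite h4.
by rewrite (B11sh_jmx aM pM h1 cs ct) h2 (loc_homothety _ cx).
Qed.

Lemma vin_add c x Y Z : vin c (fun y => Y y + Z y) x = vin c Y x + vin c Z x.
Proof. by rewrite !vinE mulmxDl. Qed.

(** The field Y + s_x Y vanishes at [x]. Hence the bracket with X retains only the derivative of
    this field along X, and that derivative changes as a vector between [c] and the distinguished
    chart. *)
Lemma nabla_chart c x X Y : dom M c x -> differentiable (vfun c x Y) (coord M c x) ->
  vin c (nabla s X Y) x =
  vder c x Y (vin c X x) + christoffel c x (vin c X x) (vin c Y x).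
Proof.
move=> cx dY; have [h1 h2 h3 h4] := symmetry_jetP x.
have rb := represents_rep h1.1; set b := rep (s x) in rb.
have cs : dom M c (src (s x)) by rewrite h3.
have ct : dom M c (tgt (s x)) by rewrite h4.
have u1 : (-1)%:M \in @unitmx R n by rewrite -scalemx1 unitmxZ ?unitmx1 // unitrN unitr1.
have dY' : differentiable (vfun c (src (s x)) Y) (coord M c (src (s x))) by rewrite h3.
have [p1 p2 p3] := push_vder rb cs ct u1 (symmetry_jmx cx) dY'.
rewrite h3 h4 h2 (loc_homothety _ cx) in p1 p2 p3.
set pY := pushfield b Y in p1 p2 p3.
pose W : vfield M := fun y => Y y + pY y.
have vW : vfun c x W = fun u => vfun c x Y u + vfun c x pY u.
  by apply/funext => u; exact: vin_add.
have dW : is_diff (coord M c x) (vfun c x W) (fun v => vder c x Y v + vder c x pY v).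
  by rewrite vW; apply: is_diff_add; apply: is_diff_vder; [exact: dY|exact: p2].
have W0 : vin c W x = 0 by rewrite vin_add p1 mul_mx_scalar scaleN1r subrr.
have Wa0 : vin (chart_at M x) W x = 0.
  by rewrite vin_tcoord (tcoord_tr aM pM (X := vsec W x) cx (cM x)) -vin_tcoord W0 mul0mx.
have E : vin c (nabla s X Y) x = 2^-1 *: vder c x W (vin c X x).
  rewrite vinE /nabla -/b -/pY -/W -scalemxAl bracketE; congr (_ *: _).
  rewrite Wa0 vder0 subr0 (vder_change_zero _ cx (cM x) (is_diff_ex dW) W0).
  rewrite -mulmxA (tr_comp aM cx (cM x) cx) (tr_id aM cx) mulmx1; congr (vder _ _ _ _).
  by rewrite !vin_tcoord -(tcoord_tr aM pM (X := vsec X x) (cM x) cx).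
rewrite E; set V := vin c X x.
rewrite (is_diff_vderE V dW).
have q3 : vder c x pY V = vder c x Y V - vin c Y x *m vec_mx (V *m jet_deriv c x).
  (* The base map of s_x has differential -1, so the derivative along V is read at [- V]. *)
  have := p3 (- V); rewrite mul_mx_scalar scaleN1r opprK => ->.
  by rewrite vderN mul_mx_scalar scaleN1r opprK mulNmx (linearN vec_mx) mulmxN.
have half (w : 'rV[R]_n) : 2^-1 *: (w + w) = w.
  by rewrite -mulr2n -(scaler_nat 2 w) scalerA mulVf ?pnatr_eq0 // scale1r.
by rewrite q3 addrA scalerDr half scalerN /christoffel scaleNr.
Qed.

(* derivative part of the affine extension of a linear map of matrix [A] *)
Definition ext_mx (A : 'M[R]_n) (Q1 Q2 : 'M[R]_(n, n * n)) : 'M[R]_(n, n * n) :=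
  - 2^-1 *: (Q1 *m lin_mulmxr A - A *m Q2 *m lin_mulmx A).

Lemma vec_ext_mx A Q1 Q2 V : vec_mx (V *m ext_mx A Q1 Q2) =
  - 2^-1 *: (vec_mx (V *m Q1) *m A - A *m vec_mx (V *m A *m Q2)).
Proof.
rewrite /ext_mx -scalemxAr linearZ /=; congr (_ *: _).
rewrite mulmxBr linearB /= !mulmxA; congr (_ - _).
  by rewrite mul_rV_lin mxvecK.
by rewrite mul_rV_lin mxvecK.
Qed.

(** Links the two forms of C: the matrix [ext_mx], which appears in jet coordinates and is what gets
    differentiated, and A G_x(V, X) - G_y(AV, AX). *)
Lemma affine_formula c d x y A (V X : 'rV[R]_n) :
  X *m vec_mx (V *m ext_mx A (jet_deriv c x) (jet_deriv d y)) =
  christoffel c x V X *m A - christoffel d y (V *m A) (X *m A).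
Proof.
rewrite vec_ext_mx /christoffel -scalemxAr -scalemxAl -scalerBr; congr (_ *: _).
by rewrite mulmxBr !mulmxA.
Qed.

(** Affinity is tested on fields with constant components V and X. The terms with the derivative of
    X occur on both sides and cancel, leaving the second order part equal to C. *)
Lemma affine_jmx c d (j : B11nh M) : B11sh j -> affine_jet s j ->
  dom M c (src j) -> dom M d (tgt j) ->
  jmx1 c d j = row_mx 1%:M (row_mx (loc c d (jp j))
    (ext_mx (loc c d (jp j)) (jet_deriv c (src j)) (jet_deriv d (tgt j)))).
Proof.
move=> shj aff cx dy; have J := B11sh_jmx aM pM shj cx dy.
have uA : loc c d (jp j) \in unitmx by rewrite (loc_unit aM pM) //; exact: jet_unit shj.1.
rewrite J; congr (row_mx _ (row_mx _ _)); set Q := rsubmx _ in J *.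
apply: eq_mulmx_rV => V; apply: (can_inj (@vec_mxK _ _ _)).
apply: eq_mulmx_rV => X; rewrite affine_formula.
have rb := represents_rep shj.1.
set A := loc c d (jp j) in uA J *.
pose VF := const_field c V; pose XF := const_field c X; pose VF' := const_field d (V *m A).
have aV : vsec VF' (tgt j) = act1 (jp j) (vsec VF (src j)).
  apply: (tcoord_inj aM pM (c := d)) => //.
  rewrite (tcoord_act1 aM pM (c := c) (d := d)) //.
  by rewrite -!vin_tcoord (vin_const aM pM _ dy) (vin_const aM pM _ cx).
have H := aff _ rb _ _ VF XF VF' (open_in_dom aM c) cx (const_field_smooth aM pM c V)
  (const_field_smooth aM pM c X) (open_in_dom aM d) dy (const_field_smooth aM pM d (V *m A)) aV.
have dX : differentiable (vfun c (src j) XF) (coord M c (src j)).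
  exact: (vfield_differentiable (const_field_smooth aM pM c X) cx).
have [p1 p2 p3] := push_vder rb cx dy uA J dX.
have := congr1 (tcoord d) H.
rewrite (tcoord_act1 aM pM (c := c) (d := d)) // -!vin_tcoord -/A.
move=> {}H; have := etrans (esym (congr1 (mulmx^~ A) (nabla_chart VF cx dX)))
  (etrans H (nabla_chart VF' dy p2)).
rewrite p1 (vin_const aM pM V cx) (vin_const aM pM X cx) (vin_const aM pM _ dy) (p3 V) mulmxDl.
rewrite (vin_const aM pM X cx).
by rewrite -addrA => /addrI ->; rewrite addrK.
Qed.

Lemma affine_jetI c d (j : B11nh M) : B11sh j -> dom M c (src j) -> dom M d (tgt j) ->
  jmx1 c d j = row_mx 1%:M (row_mx (loc c d (jp j))
    (ext_mx (loc c d (jp j)) (jet_deriv c (src j)) (jet_deriv d (tgt j)))) ->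
  affine_jet s j.
Proof.
move=> shj cx dy J b rb U V X Y X' oU Ux sX sY oV Vy sX' e.
have uA : loc c d (jp j) \in unitmx by rewrite (loc_unit aM pM) //; exact: jet_unit shj.1.
have dY := vfield_differentiable sY Ux cx.
have [p1 p2 p3] := push_vder rb cx dy uA J dY.
set A := loc c d (jp j) in uA J p1 p2 p3 *.
have eX : vin d X' (tgt j) = vin c X (src j) *m A.
  by rewrite !vin_tcoord e (tcoord_act1 aM pM (c := c) (d := d)).
apply: (tcoord_inj aM pM (c := d)) => //.
rewrite (tcoord_act1 aM pM (c := c) (d := d)) // -!vin_tcoord -/A.
etransitivity; first exact: (congr1 (mulmx^~ A) (nabla_chart X cx dY)).
apply/esym; etransitivity; first exact: (nabla_chart X' dy p2).
by rewrite p1 eX (p3 (vin c X (src j))) affine_formula mulmxDl -addrA subrK.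
Qed.

(** A jet with the matrix prescribed by C exists and is affine by [affine_jetI], so the description
    of [Sext] is met; [affine_jmx] then forces this matrix on whatever jet was picked. *)
Lemma Sext_spec c d (xi : B1 M) : lmx xi \in unitmx -> dom M c (lsrc xi) ->
  dom M d (ltgt xi) ->
  [/\ B11sh (Sext s xi), jp (Sext s xi) = xi & jmx1 c d (Sext s xi) =
    row_mx 1%:M (row_mx (loc c d xi)
      (ext_mx (loc c d xi) (jet_deriv c (lsrc xi)) (jet_deriv d (ltgt xi))))].
Proof.
move=> uxi cx dy.
have uA : loc c d xi \in unitmx by rewrite (loc_unit aM pM).
have pxi : points xi by apply/points_B1.
have [j [ij ej jE]] := B1_jet_exists aM pM
  (ext_mx (loc c d xi) (jet_deriv c (lsrc xi)) (jet_deriv d (ltgt xi))) pxi cx dy uA.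
have cx' : dom M c (src j) by rewrite -[src j]/(lsrc j.1) ej.
have dy' : dom M d (tgt j) by rewrite -[tgt j]/(ltgt j.1) ej.
have shj : B11sh j.
  by apply: (B11shP aM pM ij cx' dy'); rewrite jE row_mxKr row_mxKl /jp ej.
have jE' : jmx1 c d j = row_mx 1%:M (row_mx (loc c d (jp j))
    (ext_mx (loc c d (jp j)) (jet_deriv c (src j)) (jet_deriv d (tgt j)))).
  by rewrite jE -[src j]/(lsrc j.1) -[tgt j]/(ltgt j.1) /jp ej.
have aff := affine_jetI shj cx' dy' jE'.
have [k1 k2 k3] : [set j | [/\ B11sh j, jp j = xi & affine_jet s j]] (Sext s xi).
  apply: (@xgetI {classic B11nh M} _ [set j | [/\ B11sh j, jp j = xi & affine_jet s j]] j).
  by split.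
have ex : src (Sext s xi) = lsrc xi by rewrite -[src _]/(lsrc (jp (Sext s xi))) k2.
have ey : tgt (Sext s xi) = ltgt xi by rewrite -[tgt _]/(ltgt (jp (Sext s xi))) k2.
split; [exact: k1|exact: k2|].
have E := @affine_jmx c d (Sext s xi) k1 k3.
by rewrite ex ey k2 in E; exact: E.
Qed.

End Connection.

(** * Torsion and curvature in terms of Christoffel symbols *)

Section Curvature.
Context {R : realType} {n : nat} (M : charted R n).
Hypotheses (aM : smooth_atlas M) (pM : forall x : M, points x).
Let cM (x : M) : dom M (chart_at M x) x := pM x.
Context (s : M -> B11nh M).
Hypothesis hs : symmetry_jet s.
Implicit Types (X Y Z : vfield M).

Lemma christoffelDl c x V V' W :
  christoffel s c x (V + V') W = christoffel s c x V W + christoffel s c x V' W.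
Proof. by rewrite /christoffel mulmxDl linearD mulmxDr scalerDr. Qed.

Lemma christoffelDr c x V W W' :
  christoffel s c x V (W + W') = christoffel s c x V W + christoffel s c x V W'.
Proof. by rewrite /christoffel mulmxDl scalerDr. Qed.

Lemma christoffelZl c x k V W : christoffel s c x (k *: V) W = k *: christoffel s c x V W.
Proof. by rewrite /christoffel -scalemxAl linearZ /= -scalemxAr !scalerA mulrC. Qed.

Lemma christoffelZr c x k V W : christoffel s c x V (k *: W) = k *: christoffel s c x V W.
Proof. by rewrite /christoffel -scalemxAl !scalerA mulrC. Qed.

Lemma christoffelBl c x V V' W :
  christoffel s c x (V - V') W = christoffel s c x V W - christoffel s c x V' W.
Proof. by rewrite christoffelDl -scaleN1r christoffelZl scaleN1r. Qed.

Lemma jet_deriv_differentiable c x : dom M c x ->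
  differentiable (fun u => jet_deriv s c (param x c u)) (coord M c x).
Proof.
move=> cx; have [h1 h2 h3 h4] := symmetry_jetP hs x.
have ds : dom (B11nh M) (c, (c, c)) (s x).
  apply: (And3 h1.1); first by rewrite -[src (s x).1]/(src (s x)) h3.
  apply: (And3 (jet_unit h1.1)); first by rewrite -[lsrc _]/(src (s x)) h3.
  by rewrite -[ltgt _]/(tgt (s x)) h4.
have [_ _ nd df] := smooth_on_chart_diff aM hs.1 I cx ds.
have K := is_diff_rsubmx (is_diff_rsubmx (is_diff_vec_mx (is_diff_rsubmx (differentiableP df)))).
apply: near_differentiable (is_diff_ex K).
near=> u; have [i1 i2 [_ i3 i4]] : dom (B11nh M) (c, (c, c)) (s (param x c u)) by near: u.
have E : coord (B11nh M) (c, (c, c)) (s (param x c u)) =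
    row_mx (coord (B1 M) (c, c) (jp (s (param x c u)))) (mxvec (jmx1 c c (s (param x c u)))).
  exact: (coord_B11 aM pM i1 i2 i3 i4).
by rewrite E row_mxKr mxvecK.
Unshelve. all: by end_near. Qed.

Fact jder_def : {f : chart M -> M -> 'rV[R]_n -> 'M[R]_(n, n * n) |
  f = fun c x v => 'd (fun u => jet_deriv s c (param x c u)) (coord M c x) v}.
Proof. by eexists. Qed.

Definition jder : chart M -> M -> 'rV[R]_n -> 'M[R]_(n, n * n) := sval jder_def.

Lemma is_diff_jder c x : dom M c x ->
  is_diff (coord M c x) (fun u => jet_deriv s c (param x c u)) (jder c x).
Proof.
move=> /jet_deriv_differentiable /differentiableP dJ.
by apply: (is_diff_ext dJ) => // v; rewrite /jder (svalP jder_def).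
Qed.

Lemma jderZ c x k v : jder c x (k *: v) = k *: jder c x v.
Proof. by rewrite /jder (svalP jder_def); exact: linearZ. Qed.

Definition dchristoffel c x (h V W : 'rV[R]_n) : 'rV[R]_n :=
  - 2^-1 *: (W *m vec_mx (V *m jder c x h)).

Lemma is_diff_christoffel c x (f df g dg : 'rV[R]_n -> 'rV[R]_n) V W : dom M c x ->
  is_diff (coord M c x) f df -> is_diff (coord M c x) g dg ->
  f (coord M c x) = V -> g (coord M c x) = W ->
  is_diff (coord M c x) (fun u => christoffel s c (param x c u) (f u) (g u))
    (fun h => dchristoffel c x h V W + christoffel s c x (df h) W + christoffel s c x V (dg h)).
Proof.
move=> cx hf hg fV gW.
have K := is_diff_scale (- 2^-1) (is_diff_mulmx hg (is_diff_vec_mx (is_diff_mulmx hf (is_diff_jder cx)))).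
apply: (is_diff_ext K) => // h.
rewrite /dchristoffel /christoffel fV gW (param_coord aM _ cx) (linearD vec_mx) mulmxDr.
by rewrite !scalerDr addrC [X in X + _ = _]addrC.
Qed.

Lemma vfun_smooth c x Y : smooth_vfield setT Y ->
  smooth (coord M c @` dom M c) (vfun c x Y).
Proof.
move=> /(vfield_smooth c) [W [oW WU sW]].
by apply: smoothS (sW x) => _ [y cy <-]; exact: WU.
Qed.

Lemma vfun_base c x y z Y : dom M c z -> vfun c x Y (coord M c z) = vfun c y Y (coord M c z).
Proof. by move=> cz; rewrite /vfun !(param_coord aM _ cz). Qed.

Lemma vder_jacobian c x y Y v : dom M c y -> smooth_vfield setT Y ->
  vder c y Y v = v *m 'J (vfun c x Y) (coord M c y).
Proof.
move=> cy sY; have im : (coord M c @` dom M c) (coord M c y) by exists y.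
have dY := is_diff_jacobian (smooth_differentiable (vfun_smooth c x sY) im).
apply: (is_diff_vderE (D := mulmxr ('J (vfun c x Y) (coord M c y)))).
apply: near_is_diff dY; near=> u.
have [z cz <-] : (coord M c @` dom M c) u.
  by near: u; apply: open_nbhs_nbhs; split; [exact: open_image|].
exact: vfun_base.
Unshelve. all: by end_near. Qed.

(** The row [v *m dJ w] is the second derivative of [f] along v and w, so this is the symmetry of
    second derivatives. *)
Lemma jacobian_sym m p (A : set 'rV[R]_m) (f : 'rV[R]_m -> 'rV[R]_p) u dJ v w :
  open A -> A u -> smooth A f -> is_diff u (fun y => 'J f y) dJ -> v *m dJ w = w *m dJ v.
Proof.
move=> oA Au sf dJf.
have K a b : 'D_b ('D_a f) u = a *m dJ b.
  have D := is_diff_mulmx (is_diff_const a u) dJf.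
  have D' : is_diff u ('D_a f) (fun h => 0 *m 'J f u + a *m dJ h).
    apply: near_is_diff D; near=> y.
    have Ay : A y by near: y; exact: open_nbhs_nbhs.
    have sy := smooth_is_diff sf Ay.
    by rewrite (jacobianE a sy) (derive_is_diff a sy).
  by rewrite (derive_is_diff b D') mul0mx add0r.
by rewrite -!K; exact: (derive_comm _ _ oA Au sf).
Unshelve. all: by end_near. Qed.

Lemma vfun_diff c x Y : dom M c x -> smooth_vfield setT Y ->
  differentiable (vfun c x Y) (coord M c x).
Proof. by move=> cx sY; exact: (vfield_differentiable sY I cx). Qed.

(** The second derivative [dJ] of Z is symmetric and chosen before Y: the same one serves both
    iterated derivatives in the curvature, where its contributions cancel. *)
Lemma nabla_is_diff c x Z : dom M c x -> smooth_vfield setT Z ->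
  exists2 dJ : 'rV[R]_n -> 'M[R]_n, forall v w, v *m dJ w = w *m dJ v &
  forall Y, smooth_vfield setT Y -> is_diff (coord M c x) (vfun c x (nabla s Y Z)) (fun h =>
    vder c x Z (vder c x Y h) + vin c Y x *m dJ h
    + (dchristoffel c x h (vin c Y x) (vin c Z x)
       + christoffel s c x (vder c x Y h) (vin c Z x)
       + christoffel s c x (vin c Y x) (vder c x Z h))).
Proof.
move=> cx sZ; have im : (coord M c @` dom M c) (coord M c x) by exists x.
have oD := open_image aM (c := c); have sZ' := vfun_smooth c x sZ.
have dJ := smooth_is_diff (smooth_jacobian oD sZ') im.
set D := ('d _ _) in dJ; exists D; first by move=> v w; exact: jacobian_sym oD im sZ' dJ.
move=> Y sY.
have dY := is_diff_vder (vfun_diff cx sY); have dZ := is_diff_vder (vfun_diff cx sZ).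
have K := is_diff_add (is_diff_mulmx dY dJ)
  (is_diff_christoffel cx dY dZ (vfun_coord aM Y cx) (vfun_coord aM Z cx)).
apply: (@near_is_diff _ _ _ (fun u => vfun c x Y u *m 'J (vfun c x Z) u +
    christoffel s c (param x c u) (vfun c x Y u) (vfun c x Z u))).
  near=> u.
  have [z cz <-] : (coord M c @` dom M c) u by near: u; exact: open_nbhs_nbhs.
  rewrite !(vfun_base x z _ cz) !(vfun_coord aM _ cz) (param_coord aM _ cz).
  apply: etrans (esym (nabla_chart aM pM hs Y cz (vfun_diff cz sZ))).
  by rewrite (vder_jacobian x (vin c Y z) cz sZ).
apply: (is_diff_ext K) => // h.
by rewrite (vfun_coord aM Y cx) (vder_jacobian x (vder c x Y h) cx sZ).
Unshelve. all: by end_near. Qed.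

Lemma vin_at x Y : vin (chart_at M x) Y x = Y x.
Proof. by rewrite vinE (tr_id aM (cM x)) mulmx1. Qed.

Section AtPoint.
Context (X Y Z : vfield M) (x : M).
Hypotheses (hX : smooth_vfield setT X) (hY : smooth_vfield setT Y) (hZ : smooth_vfield setT Z).
Let c := chart_at M x.
Let cx : dom M c x := cM x.

Lemma bracket_vder : bracket X Y x = vder c x Y (X x) - vder c x X (Y x).
Proof. by rewrite bracketE // !vin_at. Qed.

Lemma nabla_vder : nabla s X Y x = vder c x Y (X x) + christoffel s c x (X x) (Y x).
Proof.
rewrite -(vin_at x (nabla s X Y)); apply: etrans (nabla_chart aM pM hs X cx (vfun_diff cx hY)) _.
by rewrite !vin_at.
Qed.

End AtPoint.

Lemma torsion_christoffel X Y x : smooth_vfield setT X -> smooth_vfield setT Y ->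
  torsion s X Y x = christoffel s (chart_at M x) x (X x) (Y x)
    - christoffel s (chart_at M x) x (Y x) (X x).
Proof.
move=> hX hY; rewrite /torsion !nabla_vder // bracket_vder.
set a := vder _ _ Y _; set b := vder _ _ X _.
by apply/rowP => i; rewrite !mxE; ring.
Qed.

(** The second derivatives of Z cancel by symmetry, and the first derivatives of X and Y are
    absorbed by the term in the bracket of X and Y. *)
Lemma curvature_christoffel X Y Z x (c := chart_at M x) : smooth_vfield setT X ->
  smooth_vfield setT Y -> smooth_vfield setT Z ->
  curvature s X Y Z x =
    dchristoffel c x (X x) (Y x) (Z x) - dchristoffel c x (Y x) (X x) (Z x)
    + christoffel s c x (X x) (christoffel s c x (Y x) (Z x))
    - christoffel s c x (Y x) (christoffel s c x (X x) (Z x)).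
Proof.
move=> hX hY hZ; have cx : dom M c x := cM x.
have [J Js dJ] := nabla_is_diff cx hZ.
have dYZ := dJ Y hY; have dXZ := dJ X hX.
(* For the second covariant derivative, [V] will be a field such as [nabla s Y Z], known through its
   differential [D] at [x]. *)
have E1 U V D : is_diff (coord M c x) (vfun c x V) D ->
    nabla s U V x = D (U x) + christoffel s c x (U x) (V x).
  move=> dV; rewrite -(is_diff_vderE (U x) dV) -(vin_at x (nabla s U V)).
  apply: etrans (nabla_chart aM pM hs U cx (is_diff_ex dV)) _.
  by rewrite !vin_at.
have n1 := E1 X (nabla s Y Z) _ dYZ; have n2 := E1 Y (nabla s X Z) _ dXZ.
have n3 := nabla_vder (bracket X Y) x hZ; have b1 := bracket_vder X Y x.
have n4 := nabla_vder X x hZ; have n5 := nabla_vder Y x hZ.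
rewrite !vin_at -/c in n1 n2 n3 b1 n4 n5.
rewrite /curvature n1 n2 n3 b1 n4 n5 (Js (X x) (Y x)).
have vderB U V W : vder c x U (V - W) = vder c x U V - vder c x U W.
  by rewrite !vderE; exact: linearB.
rewrite vderB christoffelBl !christoffelDr.
move: (dchristoffel _ _ _ _ _) (dchristoffel _ _ _ _ _) => t1 t2.
move: (vder c x Z (vder c x Y (X x))) (vder c x Z (vder c x X (Y x))) => t3 t4.
move: (christoffel s c x (vder c x Y (X x)) (Z x)) (christoffel s c x (vder c x X (Y x)) (Z x)) => t5 t6.
move: (Y x *m J (X x)) => t7.
move: (christoffel s c x (X x) _) (christoffel s c x (Y x) _) => t8 t9.
move: (christoffel s c x (X x) _) (christoffel s c x (Y x) _) => t10 t11.
by apply/rowP => i; rewrite !mxE; ring.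
Qed.

End Curvature.

(** * Affine extensions of homotheties *)

Section AffineExtension.
Context {R : realType} {n : nat} (M : charted R n).
Hypotheses (aM : smooth_atlas M) (pM : forall x : M, points x).
Let cM (x : M) : dom M (chart_at M x) x := pM x.
Context (s : M -> B11nh M).
Hypothesis hs : symmetry_jet s.

Lemma is_diff_ext_mx (A dA : 'rV[R]_n -> 'M[R]_n) (Q1 dQ1 Q2 dQ2 : 'rV[R]_n -> 'M[R]_(n, n * n)) u :
  is_diff u A dA -> is_diff u Q1 dQ1 -> is_diff u Q2 dQ2 ->
  is_diff u (fun v => ext_mx (A v) (Q1 v) (Q2 v)) (fun h => - 2^-1 *:
    (dQ1 h *m lin_mulmxr (A u) + Q1 u *m lin_mulmxr (dA h)
     - ((dA h *m Q2 u + A u *m dQ2 h) *m lin_mulmx (A u) + A u *m Q2 u *m lin_mulmx (dA h)))).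
Proof.
move=> dA' dQ1' dQ2'; apply: is_diff_scale; apply: is_diff_sub.
  exact: is_diff_mulmx dQ1' (is_diff_lin lin_mulmxr dA').
exact: is_diff_mulmx (is_diff_mulmx dA' dQ2') (is_diff_lin lin_mulmx dA').
Qed.

Section Homothety.
Context (a : R) (x : M).
Hypothesis a0 : a != 0.
Let c := chart_at M x.
Let cx : dom M c x := cM x.
Let xi : B1 M := homothety a x.
Let j := Sext s xi.
Let Q := jet_deriv s c x.
Let C := ext_mx a%:M Q Q.

Lemma scalar_unit : a%:M \in @unitmx R n.
Proof. by rewrite -scalemx1 unitmxZ ?unitmx1 // unitfE. Qed.

Lemma Sext_homothety : [/\ B11sh j, jp j = xi, src j = x, tgt j = x &
  jmx1 c c j = row_mx 1%:M (row_mx a%:M C)].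
Proof.
have [h1 h2 h3] := @Sext_spec _ _ _ aM pM s hs c c xi scalar_unit cx cx.
rewrite (loc_homothety aM pM a cx) in h3.
by split; [exact: h1|exact: h2|rewrite -[src j]/(lsrc (jp j)) h2|rewrite -[tgt j]/(ltgt (jp j)) h2|exact: h3].
Qed.

(* derivative at [x] of the second order part of [S(b(x'))], [j^1_x b = S(m_a)] *)
Definition dext (h : 'rV[R]_n) : 'M[R]_(n, n * n) := - 2^-1 *:
    (jder s c x h *m lin_mulmxr a%:M + Q *m lin_mulmxr (vec_mx (h *m C))
     - ((vec_mx (h *m C) *m Q + a%:M *m jder s c x (a *: h)) *m lin_mulmx a%:M
        + a%:M *m Q *m lin_mulmx (vec_mx (h *m C)))).

Lemma vec_dext h V : vec_mx (V *m dext h) = - 2^-1 *: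
  (vec_mx (V *m jder s c x h) *m a%:M + vec_mx (V *m Q) *m vec_mx (h *m C)
   - (a%:M *m vec_mx (V *m vec_mx (h *m C) *m Q + V *m a%:M *m jder s c x (a *: h))
      + vec_mx (h *m C) *m vec_mx (V *m a%:M *m Q))).
Proof.
rewrite /dext -scalemxAr linearZ /=; congr (_ *: _).
rewrite mulmxBr !mulmxDr !mulmxDl !mulmxDr linearB !linearD /= !mulmxA.
by rewrite !mul_rV_lin !mxvecK.
Qed.

(** At A = a the second order part C is aG - a^2 G = a(1 - a) G. The derivative of G contributes a
    at the source and a^3 at the target, where one factor a comes from each of V and W and one from
    the base point moving along [a *: h]. The other terms come from varying the linear map, whose
    derivative is again C. *)
Lemma dext_christoffel h V W : W *m vec_mx (V *m dext h) =
  (a * (1 - a ^+ 2)) *: dchristoffel s c x h V W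
  + (a * (1 - a)) *: (christoffel s c x h (christoffel s c x V W)
     - a *: christoffel s c x (christoffel s c x h V) W
     - a *: christoffel s c x V (christoffel s c x h W)).
Proof.
have E V' W' : W' *m vec_mx (V' *m C) = (a * (1 - a)) *: christoffel s c x V' W'.
  rewrite (affine_formula s c c x x) !mul_mx_scalar christoffelZl christoffelZr scalerA -scalerBl.
  by congr (_ *: _); ring.
have two (w : 'rV[R]_n) : - 2 *: (- 2^-1 *: w) = w.
  by rewrite scalerA mulrNN divff ?pnatr_eq0 // scale1r.
have F V' W' : W' *m vec_mx (V' *m Q) = - 2 *: christoffel s c x V' W' by rewrite two.
have dF V' W' : W' *m vec_mx (V' *m jder s c x h) = - 2 *: dchristoffel s c x h V' W'.
  by rewrite two.
have T1 : W *m (vec_mx (V *m jder s c x h) *m a%:M) = a *: (- 2 *: dchristoffel s c x h V W).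
  by rewrite mulmxA dF mul_mx_scalar.
have T2 : W *m (vec_mx (V *m Q) *m vec_mx (h *m C)) =
    - 2 *: ((a * (1 - a)) *: christoffel s c x h (christoffel s c x V W)).
  by rewrite mulmxA F -scalemxAl E.
have T3 : W *m vec_mx (V *m vec_mx (h *m C) *m Q) =
    - 2 *: ((a * (1 - a)) *: christoffel s c x (christoffel s c x h V) W).
  by rewrite F E christoffelZl.
have T4 : W *m vec_mx (V *m a%:M *m jder s c x (a *: h)) =
    a *: (a *: (- 2 *: dchristoffel s c x h V W)).
  have vZ k (m : 'rV[R]_(n * n)) : vec_mx (k *: m) = k *: vec_mx m :> 'M[R]_n := linearZ _ _.
  by rewrite mul_mx_scalar jderZ -scalemxAr -scalemxAl !vZ -!scalemxAr dF.
have T5 : W *m (vec_mx (h *m C) *m vec_mx (V *m a%:M *m Q)) =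
    - 2 *: (a *: ((a * (1 - a)) *: christoffel s c x V (christoffel s c x h W))).
  by rewrite mulmxA E F mul_mx_scalar christoffelZl christoffelZr.
have T6 : W *m (a%:M *m vec_mx (V *m vec_mx (h *m C) *m Q + V *m a%:M *m jder s c x (a *: h))) =
    a *: (- 2 *: ((a * (1 - a)) *: christoffel s c x (christoffel s c x h V) W)
      + a *: (a *: (- 2 *: dchristoffel s c x h V W))).
  by rewrite mulmxA mul_mx_scalar -scalemxAl (linearD vec_mx) mulmxDr T3 T4.
rewrite vec_dext -scalemxAr mulmxBr (mulmxDr W (_ *m a%:M)) T1 T2 (mulmxDr W (a%:M *m _)) T6 T5.
move: (dchristoffel _ _ _ _ _ _) (christoffel _ _ _ _ _) (christoffel _ _ _ _ _) (christoffel _ _ _ _ _) => t1 t2 t3 t4.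
apply/rowP => i; rewrite !mxE; field.
by [].
Qed.

(** Near [x], the coordinates of S(b(x')) are those of b(x') followed by a jet matrix with blocks 1,
    A and [ext_mx] of A. By semiholonomy the middle block repeats the linear map of b(x'), which is
    why [C] occurs twice in the differential. *)
Lemma SSext_spec : exists L2 : 'M[R]_(n, n * (n * n)),
  [/\ is_jet (SSext s xi), jp (SSext s xi) = j, forall h, vec_mx (h *m L2) = dext h &
   forall v, v *m (SSext s xi).2 =
    row_mx (row_mx v (row_mx (v *m a%:M) (v *m C)))
      (mxvec (row_mx 0 (row_mx (vec_mx (v *m C)) (vec_mx (v *m L2)))))].
Proof.
have [shj jpj sj tj jE] := Sext_homothety.
have rb := represents_rep shj.1; set b := rep j in rb.
have cs : dom M c (src j) by rewrite sj.
have ct : dom M c (tgt j) by rewrite tj.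
have [bx nb dB] := represents_is_diff aM pM rb cs ct.
have [[ob sb bs _] lx _] := rb.
rewrite sj in bx nb dB lx.
pose f y : B11nh M := Sext s (b y).
have fx : f x = j by rewrite /f bx jpj.
pose B u := coord (B1 M) (c, c) (b (param x c u)).
pose u0 := coord M c x.
have B0 : B u0 = row_mx u0 (row_mx u0 (mxvec a%:M)).
  by rewrite /B /u0 (param_coord aM _ cx) bx jpj coord_B1 (loc_homothety aM pM a cx).
pose A u : 'M[R]_n := vec_mx (rsubmx (rsubmx (B u))).
pose al u := lsubmx (rsubmx (B u)).
have al0 : al u0 = u0 by rewrite /al B0 row_mxKr row_mxKl.
have A0 : A u0 = a%:M by rewrite /A B0 !row_mxKr mxvecK.
pose J u := jet_deriv s c (param x c u).
(* The Christoffel data are taken at the source [u] and at the target [al u]; the latter moves with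
   differential a, whence [a *: h] in [dext]. *)
pose E u := ext_mx (A u) (J u) (J (al u)).
pose G u := row_mx (B u) (mxvec (row_mx 1%:M (row_mx (A u) (E u)))).
have nG : \forall u \near u0, dom (B11nh M) (c, (c, c)) (f (param x c u)) /\
    G u = coord (B11nh M) (c, (c, c)) (f (param x c u)).
  apply: filterS nb => u [k1 k2 k3 k4 k5].
  have uB : lmx (b (param x c u)) \in unitmx by apply/(points_B1 pM); exact: sb.1.
  have k2' : dom M c (lsrc (b (param x c u))).
    by rewrite -[lsrc _]/(src (b (param x c u))) k5.
  have [l1 l2 l3] := Sext_spec aM pM hs uB k2' k4.
  rewrite -/(f _) in l1 l2 l3.
  have s1 : dom M c (src (f (param x c u))) by rewrite -[src _]/(lsrc (jp (f (param x c u)))) l2.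
  have t1 : dom M c (tgt (f (param x c u))) by rewrite -[tgt _]/(ltgt (jp (f (param x c u)))) l2.
  split; first exact: (And3 l1.1 s1 (And3 (jet_unit l1.1) s1 t1)).
  have e1 : al u = coord M c (ltgt (b (param x c u))).
    by rewrite /al /B coord_B1 row_mxKr row_mxKl.
  have e2 : A u = loc c c (b (param x c u)) by rewrite /A /B coord_B1 !row_mxKr mxvecK.
  rewrite (coord_B11 aM pM l1.1 s1 s1 t1) -[jmx _ _ _]/(jmx1 c c (f (param x c u))) l3.
  have k5' : lsrc (b (param x c u)) = param x c u := k5.
  have e3 : J (al u) = jet_deriv s c (ltgt (b (param x c u))).
    exact: (congr1 (jet_deriv s c) (etrans (congr1 (param x c) e1) (param_coord aM x k4))).
  by rewrite l2 k5' /G /E e2 e3.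
have dB' : is_diff u0 B (fun v => row_mx v (row_mx (v *m a%:M) (v *m C))).
  apply: (is_diff_ext dB) => // v.
  by rewrite /= jE !mul_mx_row mulmx1.
have dA : is_diff u0 A (fun v => vec_mx (v *m C)).
  apply: (is_diff_ext (is_diff_vec_mx (is_diff_rsubmx (is_diff_rsubmx dB')))) => // v.
  by rewrite !row_mxKr.
have dal : is_diff u0 al (fun v => a *: v).
  apply: (is_diff_ext (is_diff_lsubmx (is_diff_rsubmx dB'))) => // v.
  by rewrite row_mxKr row_mxKl mul_mx_scalar.
have dJ : is_diff u0 J (jder s c x) := is_diff_jder aM pM hs cx.
have dE : is_diff u0 E dext.
  have K := is_diff_ext_mx dA dJ (is_diff_chain_at al0 dal dJ).
  apply: (is_diff_ext K) => // h.
  by rewrite A0 al0 /J /u0 (param_coord aM _ cx).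
pose L2 := 'J (fun u => mxvec (E u)) u0.
have L2E h : vec_mx (h *m L2) = dext h.
  by rewrite /L2 (jacobianE h (is_diff_mxvec dE)) mxvecK.
have dG := is_diff_row_mx dB' (is_diff_mxvec (is_diff_row_mx (is_diff_const (1%:M : 'M[R]_n) u0) (is_diff_row_mx dA dE))).
have nd : \forall u \near u0, dom (B11nh M) (c, (c, c)) (f (param x c u)).
  by apply: filterS nG => u [].
have nE : \forall u \near u0, G u = coord (B11nh M) (c, (c, c)) (f (param x c u)).
  by apply: filterS nG => u [].
have dG' := near_is_diff nE dG.
have fd : @chart_diff _ _ _ M (B11nh M) c (c, (c, c)) f x.
  split; [exact: cx| |exact: nd|exact: (is_diff_ex dG')].
  by have := nbhs_singleton nd; rewrite (param_coord aM x cx).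
pose dGv v : 'rV[R]_(n + (n + n * n) + n * (n + (n + n * n))) :=
  row_mx (row_mx v (row_mx (v *m a%:M) (v *m C)))
      (mxvec (row_mx 0 (row_mx (vec_mx (v *m C)) (dext v)))).
have jacE v : v *m @jacin _ _ _ M (B11nh M) c (c, (c, c)) f x = dGv v.
  have K1 := is_diff_jacin fd.
  have K2 := is_diff_uniq K1 dG'.
  exact: (congr1 (fun g => g v) K2).
have chx : chart_at (B11nh M) (f x) = (c, (c, c)).
  by rewrite fx -[chart_at _ _]/(chart_at M (src j), (chart_at M (lsrc (jp j)), chart_at M (ltgt (jp j)))) sj jpj.
have jacE2 v : v *m jac f x = dGv v.
  by rewrite -jacE jac_jacin chx.
have jE' : jmx1 (chart_at M (src j)) (chart_at M (tgt j)) j = row_mx 1%:M (row_mx a%:M C).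
  by rewrite sj tj.
(* To be a jet requires a smooth bisection, whereas [f] has been differentiated at [x] alone; [k] is
   a jet by construction and has the same value and differential. *)
have [k [ik kj kD]] := B11_jet_exists aM pM C C L2 shj.1 scalar_unit scalar_unit jE'.
have eE : SSext s xi = (f x, jac f x) by [].
have ek : SSext s xi = k.
  rewrite eE [RHS]surjective_pairing kj fx; congr pair.
  by apply: eq_mulmx_rV => v; rewrite jacE2 kD L2E.
exists L2; rewrite ek.
by split; [exact: ik|exact: kj|exact: L2E|exact: kD].
Qed.

End Homothety.
End AffineExtension.

(** * The third tangent bundle *)

Section Flip.
Context {R : realType} {n q : nat}.

(* [(v, w) |-> w *m vec_mx (v *m L)] with its arguments exchanged *)
Definition flip_mx (L : 'M[R]_(n, n * q)) : 'M[R]_(n, n * q) :=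
  \matrix_(i < n) mxvec (\matrix_(k < n) row i (vec_mx (row k L))).

Lemma flip_mxE L (v w : 'rV[R]_n) : w *m vec_mx (v *m flip_mx L) = v *m vec_mx (w *m L).
Proof.
rewrite [v *m flip_mx L]mulmx_sum_row linear_sum mulmx_sumr.
rewrite [w *m L]mulmx_sum_row linear_sum mulmx_sumr.
under eq_bigr => i _.
  rewrite linearZ /= rowK mxvecK -scalemxAr mulmx_sum_row scaler_sumr.
  under eq_bigr => k _ do rewrite rowK.
  over.
rewrite exchange_big /=; apply: eq_bigr => k _.
rewrite linearZ /= -scalemxAr [v *m vec_mx _]mulmx_sum_row scaler_sumr; apply: eq_bigr => i _.
by rewrite !scalerA mulrC.
Qed.

End Flip.

Section Kappa.
Context {R : realType} {n : nat} (M : charted R n).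
Hypotheses (aM : smooth_atlas M) (pM : forall x : M, points x).

(** The witness is the jet with [L1] and [L2] flipped. The involution exchanges the pair moved by
    [P], [Q] with the pair moved by the differential of the bisection; since these two are moved by
    the same matrices here, only the terms in [L1] and [L2] see the exchange. *)
Lemma kappaJ_act (e : B111nh M) (P : 'M[R]_n) (Q L1 : 'M[R]_(n, n * n))
    (L2 : 'M[R]_(n, n * (n * n))) : is_jet e -> P \in unitmx ->
  jmx1 (chart_at M (src e)) (chart_at M (tgt e)) (jp e) = row_mx 1%:M (row_mx P Q) ->
  (forall v, v *m e.2 =
    row_mx (row_mx v (row_mx (v *m P) (v *m Q)))
      (mxvec (row_mx 0 (row_mx (vec_mx (v *m L1)) (vec_mx (v *m L2)))))) ->
  forall Z : T3 M, T3base Z = src e -> act3 (kappaJ e) Z = kappa (act3 e (kappa Z)).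
Proof.
move=> ie uP ePQ eD.
have [k [ik ke kD]] := B11_jet_exists aM pM Q (flip_mx L1) (flip_mx L2) (jet2_is_jet ie) uP uP ePQ.
have sk : src k = src e by rewrite -[LHS]/(src k.1) ke.
have kPQ : jmx1 (chart_at M (src k)) (chart_at M (tgt k)) (jp k) = row_mx 1%:M (row_mx P Q).
  by rewrite sk -[tgt k]/(tgt k.1) /jp ke.
have K : forall Z : T3 M, T3base Z = src e -> act3 k Z = kappa (act3 e (kappa Z)).
  move=> Z Ze; have Zk : T3base Z = src k by rewrite sk.
  have Ze' : T3base (kappa Z) = src e := Ze.
  rewrite (act3E aM pM ik kPQ kD Zk) (act3E aM pM ie ePQ eD Ze').
  have kk : jp k = jp e := ke.
  rewrite kk /kappa /cinv /act_formula /dact_formula !row_mxKl !row_mxKr.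
  congr pair; congr (row_mx _ (row_mx _ _)).
    by rewrite flip_mxE.
  set W1 := rsubmx (rsubmx Z.2); rewrite (linearD vec_mx) [in RHS](linearD vec_mx) !mulmxDr flip_mxE.
  by rewrite -!addrA; congr (_ + _); exact: addrCA.
have [_ _ kappaE] : [set k : B111nh M | [/\ is_jet k, src k = src e
    & forall Z : T3 M, T3base Z = src e -> act3 k Z = kappa (act3 e (kappa Z))]] (kappaJ e).
  apply: (@xgetI {classic B111nh M} _ [set k : B111nh M | [/\ is_jet k, src k = src e
    & forall Z : T3 M, T3base Z = src e -> act3 k Z = kappa (act3 e (kappa Z))]] k).
  by split.
exact: kappaE.
Qed.

End Kappa.

Section ChartMaps.
Context {R : realType} {m p : nat} (M : charted R m) (N : charted R p).
Hypothesis aM : smooth_atlas M.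

Lemma near_param c x : dom M c x ->
  \forall u \near coord M c x, dom M c (param x c u) /\ coord M c (param x c u) = u.
Proof.
move=> cx; near=> u; apply: coord_param; near: u; apply: open_nbhs_nbhs.
by split; [exact: open_image|exists x].
Unshelve. all: by end_near. Qed.

Lemma chart_diffI c d (f : M -> N) x g dg : dom M c x ->
  (\forall u \near coord M c x, dom N d (f (param x c u)) /\ g u = coord N d (f (param x c u))) ->
  is_diff (coord M c x) g dg ->
  chart_diff c d f x /\ forall v, v *m jacin c d f x = dg v.
Proof.
move=> cx nf gd.
have nd : \forall u \near coord M c x, dom N d (f (param x c u)) by apply: filterS nf => u [].
have ng : \forall u \near coord M c x, g u = coord N d (f (param x c u)).
  by apply: filterS nf => u [].
have gd' := near_is_diff ng gd.
split; last by move=> v; rewrite jacinJ; exact: jacobianE gd'.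
split; [exact: cx| |exact: nd|exact: is_diff_ex gd'].
by have := nbhs_singleton nd; rewrite (param_coord aM x cx).
Qed.

End ChartMaps.

Section Projections.
Context {R : realType} {m : nat} (N : charted R m).
Hypotheses (aN : smooth_atlas N) (pN : forall x : N, points x).
Let TN := tangent N.
Let aT : smooth_atlas TN := tangent_atlas aN pN.
Let pT (X : TN) : points X := pN X.1.
Let TTN := tangent TN.
Let aTT : smooth_atlas TTN := tangent_atlas aT pT.

Lemma tproj_jacin c (X : TN) : dom N c X.1 ->
  @chart_diff _ _ _ TN N c c (@tproj R m N) X /\
  forall v : 'rV[R]_(m + m), v *m @jacin _ _ _ TN N c c (@tproj R m N) X = lsubmx v.
Proof.
move=> cX; have cX' : dom TN c X := cX.
apply: (@chart_diffI _ _ _ TN N aT c c (@tproj R m N) X lsubmx lsubmx) => //.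
  apply: filterS (near_param aT cX') => u [k1 k2].
  split; first exact: k1.
  by rewrite -{1}k2 coord_tangent row_mxKl.
exact: (is_diff_linear lsubmx).
Qed.

Lemma tmap_tproj (W : TTN) : tmap (@tproj R m N) W = (W.1.1, lsubmx W.2).
Proof.
rewrite [LHS]surjective_pairing; congr pair.
have [_ E] := tproj_jacin (pN W.1.1 : dom N (chart_at N W.1.1) W.1.1).
by rewrite -E -jac_jacin.
Qed.

Lemma tcoord_tmap_tproj c (W : TTN) : dom N c W.1.1 ->
  tcoord c (tmap (@tproj R m N) W) = lsubmx (@tcoord _ _ TN c W).
Proof.
move=> cW; have [h1 h2] := tproj_jacin cW.
by rewrite (tcoord_tmap aT aN pT pN h1) h2.
Qed.

Lemma tmap_tmap_tproj (W : tangent TTN) : tmap (tmap (@tproj R m N)) W =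
  (tmap (@tproj R m N) W.1, row_mx (lsubmx (lsubmx W.2)) (lsubmx (rsubmx W.2))).
Proof.
rewrite [LHS]surjective_pairing; congr pair.
set c := chart_at N W.1.1.1; have cW : dom TTN c W.1 := pN W.1.1.1.
pose ll (v : 'rV[R]_(m + m + (m + m))) := row_mx (lsubmx (lsubmx v)) (lsubmx (rsubmx v)).
have dll u : is_diff u ll ll.
  apply: is_diff_row_mx; first exact: is_diff_lsubmx (is_diff_linear lsubmx u).
  exact: is_diff_lsubmx (is_diff_linear rsubmx u).
have [_ E] : @chart_diff _ _ _ TTN TN c c (tmap (@tproj R m N)) W.1 /\
  forall v : 'rV[R]_(m + m + (m + m)), v *m @jacin _ _ _ TTN TN c c (tmap (@tproj R m N)) W.1 = ll v.
  apply: (@chart_diffI _ _ _ TTN TN aTT c c (tmap (@tproj R m N)) W.1 ll ll) => //.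
  apply: filterS (near_param aTT cW) => u [k1 k2].
  split; first exact: k1.
  by rewrite coord_tangent tcoord_tmap_tproj // -{1}k2 /ll !coord_tangent !row_mxKl row_mxKr.
rewrite -[RHS]/(ll W.2) -E; exact: (congr1 (mulmx W.2) (jac_jacin _ _)).
Qed.

End Projections.

Section TangentOfFields.
Context {R : realType} {n : nat} (M : charted R n).
Hypotheses (aM : smooth_atlas M) (pM : forall x : M, points x).
Let cM (x : M) : dom M (chart_at M x) x := pM x.
Let TM := tangent M.
Let aT : smooth_atlas TM := tangent_atlas aM pM.
Let pT (X : TM) : points X := pM X.1.
Let TTM := tangent TM.

Lemma vsec_jacin c x Y : smooth_vfield setT Y -> dom M c x ->
  @chart_diff _ _ _ M TM c c (vsec Y) x /\
  forall v : 'rV[R]_n, v *m @jacin _ _ _ M TM c c (vsec Y) x = row_mx v (vder c x Y v).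
Proof.
move=> sY cx.
apply: (@chart_diffI _ _ _ M TM aM c c (vsec Y) x (fun u => row_mx u (vfun c x Y u))) => //.
  apply: filterS (near_param aM cx) => u [k1 k2]; split; first exact: k1.
  by rewrite coord_tangent k2 -vin_tcoord.
exact: is_diff_row_mx (is_diff_id _) (is_diff_vder (vfield_differentiable sY I cx)).
Qed.

Lemma tmap_vsec x v Y : smooth_vfield setT Y ->
  tmap (vsec Y) (x, v) = (vsec Y x, row_mx v (vder (chart_at M x) x Y v)).
Proof.
move=> sY; rewrite [LHS]surjective_pairing; congr pair.
have [_ <-] := vsec_jacin sY (cM x).
by rewrite -[chart_at M x in RHS]/(chart_at TM (vsec Y x)) -jac_jacin.
Qed.

(** The last component [t] contains the second derivative of Z. It contributes equally to both
    vectors compared by [Pi], so it is left unnamed. *)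
Lemma tmap_tmap_vsec x v w k Z : smooth_vfield setT Z ->
  exists t, tmap (tmap (vsec Z)) ((x, v), row_mx w k) =
  (tmap (vsec Z) (x, v), row_mx (row_mx w (vder (chart_at M x) x Z w)) (row_mx k t)).
Proof.
move=> sZ; set c := chart_at M x; have cx : dom M c x := cM x.
pose zeta := vfun c x Z.
pose g (u : 'rV[R]_(n + n)) : 'rV[R]_(n + n + (n + n)) :=
  row_mx (row_mx (lsubmx u) (zeta (lsubmx u))) (row_mx (rsubmx u) (rsubmx u *m 'J zeta (lsubmx u))).
have cX : dom TM c (x, v) := cx.
have l0 : lsubmx (coord TM c (x, v)) = coord M c x by rewrite coord_tangent row_mxKl.
have im : (coord M c @` dom M c) (coord M c x) by exists x.
have sJ := smooth_is_diff (smooth_jacobian (open_image aM (c := c)) (vfun_smooth c x sZ)) im.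
have dl : is_diff (coord TM c (x, v)) (lsubmx : 'rV[R]_(n + n) -> 'rV[R]_n) lsubmx := is_diff_linear lsubmx _.
have dr : is_diff (coord TM c (x, v)) (rsubmx : 'rV[R]_(n + n) -> 'rV[R]_n) rsubmx := is_diff_linear rsubmx _.
have dz := is_diff_chain_at l0 dl (is_diff_vder (vfield_differentiable sZ I cx)).
have dg := is_diff_row_mx (is_diff_row_mx dl dz) (is_diff_row_mx dr (is_diff_mulmx dr (is_diff_chain_at l0 dl sJ))).
have nf : \forall u \near coord TM c (x, v), dom TTM c (tmap (vsec Z) (param ((x, v) : TM) c u)) /\
    g u = coord TTM c (tmap (vsec Z) (param ((x, v) : TM) c u)).
  apply: filterS (near_param aT cX) => u [k1 k2].
  set X := param _ _ u in k1 k2 *.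
  have cX' : dom M c X.1 := k1.
  have [h1 h2] := vsec_jacin sZ cX'.
  have lu : lsubmx u = coord M c X.1 by rewrite -k2 coord_tangent row_mxKl.
  have ru : rsubmx u = tcoord c X by rewrite -k2 coord_tangent row_mxKr.
  split; first exact: k1.
  rewrite coord_tangent (tcoord_tmap aM aT pM pT h1) h2 (vder_jacobian aM x _ cX' sZ).
  by rewrite -[(tmap _ _).1]/(vsec Z X.1) coord_tangent -vin_tcoord /g lu ru /zeta (vfun_base aM x X.1 _ cX') (vfun_coord aM _ cX').
have [_ E] := @chart_diffI _ _ _ TM TTM aT c c (tmap (vsec Z)) (x, v) g _ cX nf dg.
eexists; rewrite [LHS]surjective_pairing; congr pair.
set D := (X in is_diff _ _ X) in dg E.
have K : (tmap (tmap (vsec Z)) ((x, v), row_mx w k)).2 = row_mx w k *m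
   @jacin _ _ _ TM TTM c c (tmap (vsec Z)) (x, v) := congr1 (mulmx _) (jac_jacin _ _).
by rewrite K E /D row_mxKl row_mxKr.
Qed.

End TangentOfFields.

(** * The vector Pi for a jet and its image under kappa *)

Section ThirdTangent.
Context {R : realType} {n : nat} (M : charted R n).
Hypotheses (aM : smooth_atlas M) (pM : forall x : M, points x).
Let TM := tangent M.
Let aT : smooth_atlas TM := tangent_atlas aM pM.
Let pT (X : TM) : points X := pM X.1.
Let TTM := tangent TM.
Let aTT : smooth_atlas TTM := tangent_atlas aT pT.
Let pTT (X : TTM) : points X := pM X.1.1.

Lemma same_projectionsI (W1 W2 : T3 M) b (d e1 e2 : 'rV[R]_n) : W1.1 = W2.1 ->
  W1.2 = row_mx b (row_mx d e1) -> W2.2 = row_mx b (row_mx d e2) ->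
  same_projections W1 W2 /\ Pi W1 W2 = e1 - e2.
Proof.
move=> e E1 E2; have P (W : T3 M) : T3pstar W = (W.1.1, lsubmx W.2) := tmap_tproj aT pT W.
have PP (W : T3 M) : T3pstarstar W = _ := tmap_tmap_tproj aM pM W.
split; first by split; [exact: e|rewrite !P e E1 E2 !row_mxKl|rewrite !PP e E1 E2 !row_mxKl !row_mxKr !row_mxKl].
have L (W : T3 M) : W.1 = W1.1 ->
    last_coords (chart_at M (T3base W1)) W = rsubmx (rsubmx W.2).
  move=> eW; rewrite /last_coords -(tcoord_at aTT pTT W).
  rewrite -[chart_at M (T3base W1)]/(chart_at TTM W1.1) -eW.
  by rewrite (@coord_tangent _ _ TTM (chart_at TTM W.1) W) row_mxKr.
by rewrite /Pi !L // E1 E2 !row_mxKr.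
Qed.

Lemma kappa_pair (Y : TM) (u b w : 'rV[R]_(n + n)) :
  kappa (((Y, u), row_mx b w) : T3 M) = ((Y, b), row_mx u w).
Proof. by rewrite /kappa /cinv !row_mxKl row_mxKr. Qed.

Lemma act3_row_mx (k : B111nh M) (P P1 : 'M[R]_n) (Q C1 L1 : 'M[R]_(n, n * n))
    (L2 : 'M[R]_(n, n * (n * n))) (Y : TM) (V W V2 X2 V3 W3 : 'rV[R]_n)
    (A := lmx (jp (jp k))) : is_jet k ->
  jmx1 (chart_at M (src k)) (chart_at M (tgt k)) (jp k) = row_mx 1%:M (row_mx P Q) ->
  (forall v, v *m k.2 =
    row_mx (row_mx v (row_mx (v *m P1) (v *m C1)))
      (mxvec (row_mx 0 (row_mx (vec_mx (v *m L1)) (vec_mx (v *m L2)))))) ->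
  Y.1 = src k ->
  act3 k (((Y, row_mx V W), row_mx (row_mx V2 X2) (row_mx V3 W3)) : T3 M) =
    ((act1 (jp (jp k)) Y, row_mx (V *m P) (W *m A + Y.2 *m vec_mx (V *m Q))),
     row_mx (row_mx (V2 *m P1) (X2 *m A + Y.2 *m vec_mx (V2 *m C1)))
       (row_mx (V3 *m P + V *m vec_mx (V2 *m L1))
         (W3 *m A + W *m vec_mx (V2 *m C1) + (X2 *m vec_mx (V *m Q) + Y.2 *m vec_mx (V3 *m Q + V *m vec_mx (V2 *m L2)))))).
Proof.
move=> ik kPQ kD Yk.
have E := @act3E _ _ _ aM pM k P P1 Q C1 L1 L2
  (((Y, row_mx V W), row_mx (row_mx V2 X2) (row_mx V3 W3)) : T3 M) ik kPQ kD Yk.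
by apply: etrans E _; rewrite /act_formula /dact_formula !(row_mxKl, row_mxKr).
Qed.

(** Applying [kappa] before and after the action exchanges (V, W) with (V2, X2) in the formula for
    [act3]. The last components then differ only in the term with [L2], the mixed first order terms
    being merely permuted. *)
Lemma Pi_kappaJ (e : B111nh M) (P : 'M[R]_n) (Q : 'M[R]_(n, n * n))
    (L2 : 'M[R]_(n, n * (n * n))) (Y : TM) (V W V2 X2 V3 W3 : 'rV[R]_n)
    (Z := ((Y, row_mx V W), row_mx (row_mx V2 X2) (row_mx V3 W3)) : T3 M) :
  is_jet e -> P \in unitmx ->
  jmx1 (chart_at M (src e)) (chart_at M (tgt e)) (jp e) = row_mx 1%:M (row_mx P Q) ->
  (forall v, v *m e.2 =
    row_mx (row_mx v (row_mx (v *m P) (v *m Q)))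
      (mxvec (row_mx 0 (row_mx (vec_mx (v *m Q)) (vec_mx (v *m L2)))))) ->
  Y.1 = src e -> V *m vec_mx (V2 *m Q) = V2 *m vec_mx (V *m Q) ->
  same_projections (act3 e Z) (act3 (kappaJ e) Z) /\
  Pi (act3 e Z) (act3 (kappaJ e) Z) =
    Y.2 *m vec_mx (V *m vec_mx (V2 *m L2)) - Y.2 *m vec_mx (V2 *m vec_mx (V *m L2)).
Proof.
move=> ie uP ePQ eD Ye sym.
have E1 := act3_row_mx V W V2 X2 V3 W3 ie ePQ eD Ye.
have E2 : act3 (kappaJ e) Z = _ := etrans (kappaJ_act aM pM ie uP ePQ eD (Z := Z) Ye)
  (etrans (congr1 (fun z => kappa (act3 e z)) (kappa_pair Y _ _ _))
  (etrans (congr1 (@kappa _ _ _) (act3_row_mx V2 X2 V W V3 W3 ie ePQ eD Ye)) (kappa_pair _ _ _ _))).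
(* The block seen by the third projection is V3 P + V Q_V2 for one vector and V3 P + V2 Q_V for the
   other; [sym] makes them equal. *)
have [h1 h2] := same_projectionsI (etrans (congr1 fst E1) (esym (congr1 fst E2)))
  (congr1 snd (etrans E1 (congr1 (fun t => (_, row_mx _ (row_mx (_ + t) _))) sym))) (congr1 snd E2).
split; first exact: h1.
rewrite h2 (linearD vec_mx) (linearD vec_mx) !mulmxDr.
set t1 := Y.2 *m vec_mx (V *m _); set t2 := Y.2 *m vec_mx (V2 *m _).
by apply/rowP => i; rewrite !mxE; ring.
Qed.

End ThirdTangent.

(** * The curvature formula *)

Lemma is_manifold_atlas (R : realType) (n : nat) (M : charted R n) :
  is_manifold M -> smooth_atlas M.
Proof. by case=> _ h1 h2 _ _; split. Qed.

Theorem corollary7p5 (R : realType) (n : nat) (M : charted R n)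
    (hM : is_manifold M) (s : M -> B11nh M) (hs : symmetry_jet s)
    (htorsion : forall X Y : vfield M,
       smooth_vfield setT X -> smooth_vfield setT Y ->
       forall x, torsion s X Y x = 0)
    (a : R) (ha0 : a != 0) (ha1 : a != 1) (haN1 : a != -1)
    (X Y Z : vfield M)
    (hX : smooth_vfield setT X) (hY : smooth_vfield setT Y)
    (hZ : smooth_vfield setT Z) (x : M) :
  let XX : T3 M := tmap (tmap (vsec Z)) (tmap (vsec Y) (vsec X x)) in
  let eta : B111nh M := SSext s (homothety a x) in
  same_projections (act3 eta XX) (act3 (kappaJ eta) XX) /\
  curvature s X Y Z x =
    (a * (1 - a ^+ 2))^-1 *: Pi (act3 eta XX) (act3 (kappaJ eta) XX).
Proof.
move=> XX eta; have aM := is_manifold_atlas hM; have [pM _ _ _ _] := hM.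
set c := chart_at M x.
have [L2 [ie je L2E eD]] := SSext_spec aM pM hs x ha0.
have [shj jpj sj tj jE] := Sext_homothety aM pM hs x ha0.
rewrite -/eta -/c in ie je eD jE.
set C := ext_mx _ _ _ in eD jE.
have seta : src eta = x by rewrite -[src eta]/(src (jp eta)) je.
have teta : tgt eta = x by rewrite -[tgt eta]/(tgt (jp eta)) je.
have ePQ : jmx1 (chart_at M (src eta)) (chart_at M (tgt eta)) (jp eta) = row_mx 1%:M (row_mx a%:M C).
  by rewrite seta teta je.
have [t XXE] : exists t, XX = ((vsec Z x, row_mx (Y x) (vder c x Z (Y x))),
    row_mx (row_mx (X x) (vder c x Z (X x))) (row_mx (vder c x Y (X x)) t)).
  rewrite /XX /vsec (tmap_vsec aM pM x (X x) hY).
  have [t h] := tmap_tmap_vsec aM pM x (Y x) (X x) (vder c x Y (X x)) hZ.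
  by exists t; rewrite -(tmap_vsec aM pM x (Y x) hZ); exact: h.
(* Vanishing torsion of the given fields at [x] is the symmetry of G on their values. It will give
   [sym], and so equal projections, and will identify the terms G(G(X, Y), Z) in [E]. *)
have tor : christoffel s c x (X x) (Y x) = christoffel s c x (Y x) (X x).
  by apply/eqP; rewrite -subr_eq0 -(torsion_christoffel aM pM hs x hX hY) htorsion.
have CE V W : W *m vec_mx (V *m C) = (a * (1 - a)) *: christoffel s c x V W.
  rewrite (affine_formula s c c x x) !mul_mx_scalar christoffelZl christoffelZr scalerA -scalerBl.
  by congr (_ *: _); ring.
have sym : Y x *m vec_mx (X x *m C) = X x *m vec_mx (Y x *m C) by rewrite !CE tor.
have [h1 h2] := @Pi_kappaJ _ _ _ aM pM eta _ _ L2 (vsec Z x) (Y x) (vder c x Z (Y x)) (X x)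
  (vder c x Z (X x)) (vder c x Y (X x)) t ie (scalar_unit ha0) ePQ eD (esym seta) sym.
rewrite -XXE !L2E in h1 h2.
split; first exact: h1.
have E := etrans h2 (congr2 (fun p q => p - q)
  (dext_christoffel s a x (X x) (Y x) (Z x)) (dext_christoffel s a x (Y x) (X x) (Z x))).
rewrite -/c tor in E.
apply: etrans (curvature_christoffel aM pM hs x hX hY hZ) _.
apply/esym; apply: etrans (congr1 (fun p => _ *: p) E) _.
move: (dchristoffel _ _ _ _ _ _) (dchristoffel _ _ _ _ _ _) => d1 d2.
set g1 := christoffel s c x (X x) _; set g2 := christoffel s c x (Y x) (christoffel s c x (X x) _).
set g3 := christoffel s c x _ (Z x).
have k0 : a * (1 - a ^+ 2) != 0.
  (* The factor 1 + a is written as a difference so that [subr_eq0] reduces both factors to the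
     hypotheses on [a]. *)
  rewrite mulf_neq0 // (_ : 1 - a ^+ 2 = (1 - a) * (a - -1)); last by ring.
  by rewrite mulf_neq0 // subr_eq0 // eq_sym.
(* G(X, G(Y, Z)) has coefficient a(1 - a) in D(X; Y, Z) and -a^2(1 - a) in D(Y; X, Z), hence a(1 -
   a^2) in the difference; likewise with X and Y exchanged and the opposite sign. The terms [g3]
   cancel. *)
apply: (scalerI k0); rewrite scalerA mulfV // scale1r.
by apply/rowP => i; rewrite !mxE; ring.
Qed.
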